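(* Let $\sigma\in\{+1,-1\}$. There exist constants $\varepsilon_0>0$ and $C>0$ such that for every $0<\varepsilon\le\varepsilon_0$ the following holds. Let $\psi$ be the unique global solution of the Cauchy problem $$ i\psi_t=-\psi_{xx}+2\sigma\cos(2x)\,|\psi|^2\psi,\quad x\in S^1,\ t\in\mathbb{R},\qquad \psi(0,x)=\varepsilon(\cos x+\sin x), $$ and write $\psi(t,x)=\sum_{k\in\mathbb{Z}}\hat\psi_k(t)e^{ikx}$. Then for all $t\in\mathbb{R}$ with $|t|\le\varepsilon^{-9/4}$, $$ \Big||\hat\psi_1(t)|^2+|\hat\psi_{-1}(t)|^2-\varepsilon^2\Big|\le C\varepsilon^{3} $$ and $$ \Big||\hat\psi_1(t)|^2-|\hat\psi_{-1}(t)|^2-\sigma\,\varepsilon^2\sin(2\varepsilon^2t)\Big|\le C\varepsilon^{9/4}. $$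
   Context: $S^1=\mathbb{R}/2\pi\mathbb{Z}$, and the Fourier coefficients are $\hat\psi_k(t)=\frac1{2\pi}\int_{-\pi}^{\pi}\psi(t,x)e^{-ikx}\,dx$. The Cauchy problem is known to have a unique global solution in every Sobolev space $H^s(S^1)$, $s\ge1$; $\psi$ denotes this solution. *)

(* Defs.v *)
From Stdlib Require Import Reals ZArith.
From Coquelicot Require Import Coquelicot.

Open Scope R_scope.

(** Functions on the circle [R / 2 pi Z] are 2pi-periodic functions on [R]. *)
Definition periodic_2PI (f : R -> C) : Prop :=
  forall x : R, f (x + 2 * PI) = f x.

(** [cis y] is the exponential [e^{iy}]. *)
Definition cis (y : R) : C := (cos y, sin y).

Definition fourier (f : R -> C) (k : Z) : C :=
  (RtoC (/ (2 * PI)) *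
   RInt (V := C_R_CompleteNormedModule)
     (fun x : R => (f x * cis (- (IZR k * x)))%C) (- PI) PI)%C.

(** Sums over [Z] are only taken of nonnegative families, so grouping the
    indices [n] and [-n] changes neither convergence nor the sum. *)
Definition fold_Z (g : Z -> R) (n : nat) : R :=
  match n with
  | O => g 0%Z
  | S _ => g (Z.of_nat n) + g (- Z.of_nat n)%Z
  end.

(** For any real [s], an element of [H^s(S^1)] is represented by the family of
    its Fourier coefficients, with
    [||a||_{H^s}^2 = sum_k (1 + k^2)^s |a_k|^2]. *)
Definition sobolev_terms (s : R) (a : Z -> C) : nat -> R :=
  fold_Z (fun k : Z => Rpower (1 + IZR k ^ 2) s * Cmod (a k) ^ 2).

Definition in_sobolev (s : R) (a : Z -> C) : Prop :=
  ex_series (sobolev_terms s a).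

Definition sobolev_norm (s : R) (a : Z -> C) : R :=
  sqrt (Series (sobolev_terms s a)).

(** Convergence in [H^s] along a filter.  [Series] is a junk value on divergent
    series, hence the explicit membership condition. *)
Definition sobolev_lim (s : R) (F : (R -> Prop) -> Prop)
    (a : R -> Z -> C) (l : Z -> C) : Prop :=
  forall eta : R, 0 < eta ->
    F (fun t : R =>
         in_sobolev s (fun k : Z => (a t k - l k)%C) /\
         sobolev_norm s (fun k : Z => (a t k - l k)%C) < eta).

(** [s >= 1 > 1/2], so every element of [H^s(S^1)] has exactly one continuous
    representative. *)
Definition sobolev_function (s : R) (f : R -> C) : Prop :=
  (forall x : R, continuous f x) /\
  periodic_2PI f /\
  in_sobolev s (fourier f).

Definition nonlinearity (sigma : R) (u : R -> C) (x : R) : C :=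
  (RtoC (2 * sigma * cos (2 * x) * Cmod (u x) ^ 2) * u x)%C.

(** Fourier coefficients of [f_xx], for [f] in [H^s], as an element of
    [H^(s-2)]: the second derivative is taken in the sense of distributions. *)
Definition fourier_dxx (f : R -> C) (k : Z) : C :=
  (RtoC (- IZR k ^ 2) * fourier f k)%C.

(** Global [H^s] solutions of
    [i psi_t = - psi_xx + 2 sigma cos(2x) |psi|^2 psi]:
    [psi] belongs to [C(R; H^s)], is differentiable in time as an
    [H^(s-2)]-valued map, and satisfies the equation in [H^(s-2)]. *)
Definition global_solution (s sigma : R) (psi : R -> R -> C) : Prop :=
  (forall t : R, sobolev_function s (psi t)) /\
  (forall t : R,
     sobolev_lim s (locally t) (fun t' : R => fourier (psi t'))
       (fourier (psi t))) /\
  (exists psi_t : R -> Z -> C,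
     (forall t : R,
        sobolev_lim (s - 2) (locally' 0)
          (fun h k =>
             ((fourier (psi (t + h)%R) k - fourier (psi t) k) / RtoC h)%C)
          (psi_t t)) /\
     (forall (t : R) (k : Z),
        (Ci * psi_t t k)%C =
        (- fourier_dxx (psi t) k + fourier (nonlinearity sigma (psi t)) k)%C)).

(* Main.v *)
(** Write [psi = sum_k a_k e^{ikx}].  The mass [sum |a_k|^2] and the energy
    [sum k^2 |a_k|^2 + mean (sigma cos(2x) |psi|^4)] are conserved, and the even
    modes stay zero because the equation is invariant under the shift by [pi]
    combined with [psi -> - psi].  Energy minus mass controls
    [sum (k^2 - 1) |a_k|^2], so all modes other than [1] and [-1] have size
    [O(eps^2)] in [H^1] for all times, whence in the sup norm.  Up to [O(eps^4)], the
    cubic term may thus be computed on [p e^{ix} + q e^{-ix}].  There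
    [J = |p|^2 - |q|^2] and [L = 2 sigma Im(conj p q)] rotate into each other with
    frequency [2 (|p|^2 + |q|^2) = 2 eps^2 + O(eps^4)]; the errors are [O(eps^5)]
    and are integrated over a time [eps^(-9/4)].

    For [H^1] solutions the conservation laws are obtained from the truncations
    [|k| <= n]: their mass and energy have derivatives which tend to zero
    uniformly on compact time intervals. *)

Require Import Defs.
From Stdlib Require Import Reals ZArith Lra Lia Psatz ClassicalEpsilon.
From Coquelicot Require Import Coquelicot.

Open Scope R_scope.

(** * Trigonometric polynomials *)

(** Energy minus mass is small because the weight k^2 - 1 vanishes on the modes that carry the data:
    kinetic energy and mass start equal, and only the quartic potential, of size eps^4, is left. The
    weight is negative at k = 0 alone, and parity removes that mode. The modes 1 and -1 share their
    linear phase, which cancels in J and L, so these see only the cubic term.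

    The difficulty is regularity. With N the cubic term and P_n the truncation, the derivative of
    the truncated energy pairs k^2 a_k with the modes of N(psi) - N(P_n psi), which therefore has to
    be small in H^1. Since psi has no pointwise x-derivative to work with, a second truncation P_m
    is inserted: N(P_m psi) - N(P_n psi) is smooth, while N(psi) - N(P_m psi) is small in the sup
    norm, which suffices for the finitely many modes |k| <= n once m is large in terms of n. Uniform
    convergence of P_n psi to psi is Fourier inversion, obtained from the kernels (1 + cos)^N. *)

Definition SZ (n : nat) (g : Z -> R) : R := sum_f_R0 (fold_Z g) n.

Lemma SZ_0 g : SZ 0 g = g 0%Z.
Proof. reflexivity. Qed.

Lemma SZ_S n g :
  SZ (S n) g = SZ n g + (g (Z.of_nat (S n)) + g (- Z.of_nat (S n))%Z).
Proof. reflexivity. Qed.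

Lemma SZ_ext n g h :
  (forall k, (Z.abs k <= Z.of_nat n)%Z -> g k = h k) -> SZ n g = SZ n h.
Proof.
  induction n as [|n IH]; intros H.
  - rewrite !SZ_0. apply H. lia.
  - rewrite !SZ_S, IH by (intros; apply H; lia).
    rewrite !H by lia. reflexivity.
Qed.

Lemma SZ_plus n g h : SZ n (fun k => g k + h k) = SZ n g + SZ n h.
Proof. induction n as [|n IH]; rewrite ?SZ_0, ?SZ_S, ?IH; ring. Qed.

Lemma SZ_scal n c g : SZ n (fun k => c * g k) = c * SZ n g.
Proof. induction n as [|n IH]; rewrite ?SZ_0, ?SZ_S, ?IH; ring. Qed.

Lemma SZ_minus n g h : SZ n (fun k => g k - h k) = SZ n g - SZ n h.
Proof. induction n as [|n IH]; rewrite ?SZ_0, ?SZ_S, ?IH; ring. Qed.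

Lemma SZ_le n g h :
  (forall k, (Z.abs k <= Z.of_nat n)%Z -> g k <= h k) -> SZ n g <= SZ n h.
Proof.
  induction n as [|n IH]; intros H.
  - rewrite !SZ_0. apply H. lia.
  - rewrite !SZ_S.
    assert (SZ n g <= SZ n h) by (apply IH; intros; apply H; lia).
    assert (g (Z.of_nat (S n)) <= h (Z.of_nat (S n))) by (apply H; lia).
    assert (g (- Z.of_nat (S n))%Z <= h (- Z.of_nat (S n))%Z) by (apply H; lia).
    lra.
Qed.

Lemma SZ_zero n g :
  (forall k, (Z.abs k <= Z.of_nat n)%Z -> g k = 0) -> SZ n g = 0.
Proof.
  intros H. rewrite (SZ_ext n g (fun _ => 0 * 0)) by (intros; rewrite H; auto; ring).
  rewrite (SZ_scal n 0 (fun _ => 0)). ring.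
Qed.

Lemma SZ_nonneg n g :
  (forall k, (Z.abs k <= Z.of_nat n)%Z -> 0 <= g k) -> 0 <= SZ n g.
Proof.
  intros H. rewrite <- (SZ_zero n (fun _ => 0)) by auto. now apply SZ_le.
Qed.

Lemma SZ_mono n m g : (forall k, 0 <= g k) -> (n <= m)%nat -> SZ n g <= SZ m g.
Proof.
  intros H Hm. induction Hm as [|m Hm IH]; [lra|]. rewrite SZ_S.
  pose proof (H (Z.of_nat (S m))). pose proof (H (- Z.of_nat (S m))%Z). lra.
Qed.

Lemma Rabs_SZ n g : Rabs (SZ n g) <= SZ n (fun k => Rabs (g k)).
Proof.
  induction n as [|n IH]; rewrite ?SZ_0, ?SZ_S; [lra|].
  eapply Rle_trans; [apply Rabs_triang|]. apply Rplus_le_compat; [exact IH|].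
  apply Rabs_triang.
Qed.

Lemma SZ_single n l c :
  (Z.abs l <= Z.of_nat n)%Z ->
  SZ n (fun k => if Z.eq_dec k l then c k else 0) = c l.
Proof.
  induction n as [|n IH]; intros H.
  - rewrite SZ_0. replace l with 0%Z by lia. reflexivity.
  - rewrite SZ_S.
    destruct (Z_le_gt_dec (Z.abs l) (Z.of_nat n)) as [Hl|Hl].
    + rewrite IH by assumption.
      destruct (Z.eq_dec (Z.of_nat (S n)) l); [lia|].
      destruct (Z.eq_dec (- Z.of_nat (S n)) l); [lia|]. ring.
    + rewrite SZ_zero.
      2:{ intros k Hk. destruct (Z.eq_dec k l); [lia|reflexivity]. }
      destruct (Z.eq_dec (Z.of_nat (S n)) l), (Z.eq_dec (- Z.of_nat (S n)) l);
        subst; try lia; ring.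
Qed.

Lemma SZ_ge_term n g l :
  (forall k, 0 <= g k) -> (Z.abs l <= Z.of_nat n)%Z -> g l <= SZ n g.
Proof.
  intros Hg Hl. rewrite <- (SZ_single n l g Hl). apply SZ_le. intros k _.
  destruct (Z.eq_dec k l); [lra|apply Hg].
Qed.

(** Deleting the low modes turns a difference of partial sums into a partial sum of another family,
    so every estimate for [SZ], [TA] and [TB] also serves for tails. *)
Definition mask (n : nat) (g : Z -> R) (k : Z) : R :=
  if Z_le_gt_dec (Z.abs k) (Z.of_nat n) then 0 else g k.

Lemma SZ_mask n m g : (n <= m)%nat -> SZ m (mask n g) = SZ m g - SZ n g.
Proof.
  intros H. induction H as [|m H IH].
  - rewrite SZ_zero; [ring|]. intros k Hk. unfold mask.
    destruct Z_le_gt_dec; [reflexivity|lia].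
  - rewrite !SZ_S, IH. unfold mask.
    repeat (destruct Z_le_gt_dec; [lia|]). ring.
Qed.

(** Telescoping: (n + 1/2)(n + 3/2) = (n + 1)^2 - 1/4 lies below 1 + (n + 1)^2. The constant 5 is 1
    for the mode 0, plus twice the telescoped sum 2 for the modes of either sign. *)
Lemma SZ_inv_weight n : SZ n (fun k => / (1 + IZR k ^ 2)) <= 5.
Proof.
  enough (SZ n (fun k => / (1 + IZR k ^ 2)) <= 5 - 2 / (INR n + / 2)) as H.
  { pose proof (pos_INR n). assert (0 < 2 / (INR n + / 2)); [|lra].
    apply Rdiv_lt_0_compat; lra. }
  induction n as [|n IH].
  - rewrite SZ_0. simpl. lra.
  - rewrite SZ_S, opp_IZR, <- INR_IZR_INZ.
    pose proof (pos_INR n). rewrite S_INR in *.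
    replace ((- (INR n + 1)) ^ 2) with ((INR n + 1) ^ 2) by ring.
    assert (/ (1 + (INR n + 1) ^ 2) <= / (INR n + / 2) - / (INR n + 1 + / 2)).
    { replace (/ (INR n + / 2) - / (INR n + 1 + / 2))
        with (/ ((INR n + / 2) * (INR n + 1 + / 2))) by (field; nra).
      apply Rinv_le_contravar; nra. }
    unfold Rdiv in *. lra.
Qed.

Lemma SZ_Cauchy_Schwarz n (w x : Z -> R) :
  (forall k, 0 < w k) ->
  (SZ n x) ^ 2 <= SZ n (fun k => / w k) * SZ n (fun k => w k * x k ^ 2).
Proof.
  intros Hw.
  assert (step : forall W Q S v y, 0 <= W -> 0 <= Q -> 0 < v -> S ^ 2 <= W * Q ->
    (S + y) ^ 2 <= (W + / v) * (Q + v * y ^ 2)).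
  { intros W Q S v y HW HQ Hv HS.
    assert (Hi : 0 < / v) by now apply Rinv_0_lt_compat.
    assert (Hvi : v * / v = 1) by (field; lra).
    (* Arithmetic-geometric mean: the two terms on the right have product [W * Q * y ^ 2], which is
       at least [S ^ 2 * y ^ 2]. *)
    assert (2 * S * y <= W * v * y ^ 2 + Q * / v).
    { apply Rsqr_incr_0_var; [|assert (0 <= W * v * y ^ 2) by (apply Rmult_le_pos;
        [nra|apply pow2_ge_0]); nra].
      unfold Rsqr.
      assert (E : S ^ 2 * y ^ 2 <= (W * Q) * y ^ 2)
        by (apply Rmult_le_compat_r; [apply pow2_ge_0|exact HS]).
      assert (F : W * v * y ^ 2 * (Q * / v) = W * Q * y ^ 2)
        by (field; lra).
      pose proof (pow2_ge_0 (W * v * y ^ 2 - Q * / v)). nra. }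
    replace ((W + / v) * (Q + v * y ^ 2))
      with (W * Q + W * v * y ^ 2 + Q * / v + (v * / v) * y ^ 2) by ring.
    rewrite Hvi. nra. }
  assert (P1 : forall k, 0 < / w k) by (intros; apply Rinv_0_lt_compat; auto).
  assert (P2 : forall k, 0 <= w k * x k ^ 2).
  { intros k. apply Rmult_le_pos; [apply Rlt_le, Hw|apply pow2_ge_0]. }
  assert (N1 : forall n, 0 <= SZ n (fun k => / w k)).
  { intros. apply SZ_nonneg. intros. apply Rlt_le, P1. }
  assert (N2 : forall n, 0 <= SZ n (fun k => w k * x k ^ 2)).
  { intros. apply SZ_nonneg. intros. apply P2. }
  induction n as [|n IH].
  - rewrite !SZ_0. pose proof (Hw 0%Z). right. field. lra.
  - rewrite !SZ_S, <- !Rplus_assoc.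
    apply step; auto.
    + pose proof (N1 n). specialize (P1 (Z.of_nat (S n))). lra.
    + pose proof (N2 n). specialize (P2 (Z.of_nat (S n))). lra.
Qed.

(** * Continuous functions and their normalised means over a period *)

Definition cont (f : R -> R) : Prop := forall x, continuous f x.

Lemma cont_const c : cont (fun _ => c).
Proof. intros x. apply continuous_const. Qed.
Lemma cont_id : cont (fun x => x).
Proof. intros x. apply continuous_id. Qed.
Lemma cont_plus f g : cont f -> cont g -> cont (fun x => f x + g x).
Proof. intros Hf Hg x. apply (continuous_plus f g); auto. Qed.
Lemma cont_mult f g : cont f -> cont g -> cont (fun x => f x * g x).
Proof. intros Hf Hg x. apply (continuous_mult f g); auto. Qed.
Lemma cont_opp f : cont f -> cont (fun x => - f x).
Proof. intros Hf x. apply (continuous_opp f); auto. Qed.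
Lemma cont_minus f g : cont f -> cont g -> cont (fun x => f x - g x).
Proof. intros Hf Hg x. apply (continuous_minus f g); auto. Qed.
Lemma cont_pow f n : cont f -> cont (fun x => f x ^ n).
Proof.
  intros Hf. induction n; simpl; [apply cont_const|now apply cont_mult].
Qed.
Lemma cont_cos f : cont f -> cont (fun x => cos (f x)).
Proof. intros Hf x. now apply continuous_cos_comp. Qed.
Lemma cont_sin f : cont f -> cont (fun x => sin (f x)).
Proof. intros Hf x. now apply continuous_sin_comp. Qed.

Lemma cont_SZ n (F : Z -> R -> R) :
  (forall k, cont (F k)) -> cont (fun x => SZ n (fun k => F k x)).
Proof.
  intros H. induction n as [|n IH]; [apply H|].
  intros x. apply continuous_ext with (f := fun x => SZ n (fun k => F k x) +
    (F (Z.of_nat (S n)) x + F (- Z.of_nat (S n))%Z x)).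
  { intros y. now rewrite SZ_S. }
  apply cont_plus; [assumption|]. now apply cont_plus.
Qed.

Ltac cont_tac :=
  repeat match goal with
    | |- forall _, cont _ => intro
    | H : cont ?f |- cont ?f => exact H
    | |- cont (fun _ => ?c) => apply cont_const
    | |- cont (fun x => x) => apply cont_id
    | |- cont (fun x => @?f x + @?g x) => apply (cont_plus f g)
    | |- cont (fun x => @?f x - @?g x) => apply (cont_minus f g)
    | |- cont (fun x => - @?f x) => apply (cont_opp f)
    | |- cont (fun x => @?f x * @?g x) => apply (cont_mult f g)
    | |- cont (fun x => @?f x ^ ?n) => apply (cont_pow f n)
    | |- cont (fun x => cos (@?f x)) => apply (cont_cos f)
    | |- cont (fun x => sin (@?f x)) => apply (cont_sin f)
    | |- cont (fun x => SZ ?n (fun k => @?F x k)) =>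
        apply (cont_SZ n (fun k x => F x k)); intros ?
    | |- cont (fun x => ?f x) => change (cont f)
    | _ => progress cbv beta
    end; try assumption; auto.

Definition mean (h : R -> R) : R := / (2 * PI) * RInt h (- PI) PI.

Lemma cont_ex_RInt f a b : cont f -> ex_RInt f a b.
Proof. intros H. apply (ex_RInt_continuous (V := R_CompleteNormedModule)); auto. Qed.

Lemma mean_ext f g : (forall x, f x = g x) -> mean f = mean g.
Proof. intros H. unfold mean. f_equal. apply RInt_ext. auto. Qed.

Lemma mean_plus f g : cont f -> cont g ->
  mean (fun x => f x + g x) = mean f + mean g.
Proof.
  intros Hf Hg. unfold mean. rewrite <- Rmult_plus_distr_l. f_equal.
  apply (RInt_plus f g); now apply cont_ex_RInt.
Qed.

Lemma mean_scal c f : cont f -> mean (fun x => c * f x) = c * mean f.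
Proof.
  intros Hf. unfold mean.
  transitivity (/ (2 * PI) * (c * RInt f (- PI) PI)); [|ring]. f_equal.
  apply (RInt_scal f). now apply cont_ex_RInt.
Qed.

Lemma mean_minus f g : cont f -> cont g ->
  mean (fun x => f x - g x) = mean f - mean g.
Proof.
  intros Hf Hg.
  rewrite (mean_ext _ (fun x => f x + (-1) * g x)) by (intros; ring).
  rewrite mean_plus by cont_tac. rewrite mean_scal by assumption. ring.
Qed.

Lemma mean_const c : mean (fun _ => c) = c.
Proof.
  unfold mean. rewrite RInt_const. unfold scal; simpl. unfold mult; simpl.
  pose proof PI_RGT_0. field. lra.
Qed.

(** The comparison is asked for on the open interval only, because Fourier inversion yields
    pointwise bounds only there. *)
Lemma mean_le f g : cont f -> cont g ->
  (forall x, - PI < x < PI -> f x <= g x) -> mean f <= mean g.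
Proof.
  intros Hf Hg H. unfold mean. pose proof PI_RGT_0.
  apply Rmult_le_compat_l.
  - apply Rlt_le, Rinv_0_lt_compat. lra.
  - apply RInt_le; [lra|now apply cont_ex_RInt..|assumption].
Qed.

Lemma mean_nonneg f : cont f -> (forall x, - PI < x < PI -> 0 <= f x) -> 0 <= mean f.
Proof.
  intros Hf H. rewrite <- (mean_const 0). apply mean_le; cont_tac.
Qed.

Lemma Rabs_mean_le f g : cont f -> cont g ->
  (forall x, - PI < x < PI -> Rabs (f x) <= g x) -> Rabs (mean f) <= mean g.
Proof.
  intros Hf Hg H. apply Rabs_le. split.
  - assert (mean (fun x => (-1) * g x) <= mean f).
    { apply mean_le; cont_tac. intros x Hx. specialize (H x Hx).
      apply Rabs_le_between in H. lra. }
    rewrite mean_scal in H0 by assumption. lra.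
  - apply mean_le; auto. intros x Hx. specialize (H x Hx).
    apply Rabs_le_between in H. lra.
Qed.

Lemma Rabs_mean_bound f M : cont f ->
  (forall x, - PI < x < PI -> Rabs (f x) <= M) -> Rabs (mean f) <= M.
Proof.
  intros Hf H. rewrite <- (mean_const M). apply Rabs_mean_le; cont_tac.
Qed.

Lemma mean_SZ n (F : Z -> R -> R) : (forall k, cont (F k)) ->
  mean (fun x => SZ n (fun k => F k x)) = SZ n (fun k => mean (F k)).
Proof.
  intros H. induction n as [|n IH]; [reflexivity|].
  rewrite SZ_S, <- IH.
  rewrite <- mean_plus by auto. rewrite <- mean_plus; cont_tac; auto.
Qed.

Lemma sin_IZR_PI k : sin (IZR k * PI) = 0.
Proof. apply sin_eq_0_1. now exists k. Qed.

Lemma RInt_deriv f df : (forall x, is_derive f x (df x)) -> cont df ->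
  RInt df (- PI) PI = f PI - f (- PI).
Proof.
  intros Hd Hc. apply is_RInt_unique.
  apply (is_RInt_derive f df); auto.
Qed.

Lemma mean_cos k : mean (fun x => cos (IZR k * x)) = if Z.eq_dec k 0 then 1 else 0.
Proof.
  destruct (Z.eq_dec k 0) as [->|Hk].
  - rewrite (mean_ext _ (fun _ => 1)); [apply mean_const|].
    intros x. rewrite Rmult_0_l. apply cos_0.
  - assert (Hk' : IZR k <> 0) by now apply not_0_IZR.
    unfold mean. rewrite (RInt_deriv (fun x => sin (IZR k * x) / IZR k)).
    + replace (IZR k * - PI) with (- (IZR k * PI)) by ring.
      rewrite sin_neg, sin_IZR_PI. field. pose proof PI_RGT_0. lra.
    + intros x. auto_derive; auto. field. auto.
    + cont_tac.
Qed.

Lemma mean_sin k : mean (fun x => sin (IZR k * x)) = 0.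
Proof.
  destruct (Z.eq_dec k 0) as [->|Hk].
  - rewrite (mean_ext _ (fun _ => 0)); [apply mean_const|].
    intros x. rewrite Rmult_0_l. apply sin_0.
  - assert (Hk' : IZR k <> 0) by now apply not_0_IZR.
    unfold mean. rewrite (RInt_deriv (fun x => - cos (IZR k * x) / IZR k)).
    + replace (IZR k * - PI) with (- (IZR k * PI)) by ring.
      rewrite cos_neg. field. pose proof PI_RGT_0. lra.
    + intros x. auto_derive; auto. field. auto.
    + cont_tac.
Qed.

(** Real and imaginary parts of the [k]-th Fourier coefficient of [f + i g]. *)
Definition fre (f g : R -> R) (k : Z) : R :=
  mean (fun x => f x * cos (IZR k * x) + g x * sin (IZR k * x)).
Definition fim (f g : R -> R) (k : Z) : R :=
  mean (fun x => g x * cos (IZR k * x) - f x * sin (IZR k * x)).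

(** Real and imaginary parts of the sum of [(a k + i b k) e^{ikx}] over [|k| <= n]. *)
Definition TA (n : nat) (a b : Z -> R) (x : R) : R :=
  SZ n (fun k => a k * cos (IZR k * x) - b k * sin (IZR k * x)).
Definition TB (n : nat) (a b : Z -> R) (x : R) : R :=
  SZ n (fun k => a k * sin (IZR k * x) + b k * cos (IZR k * x)).

Lemma cont_TA n a b : cont (TA n a b).
Proof. change (cont (fun x => TA n a b x)). unfold TA. cont_tac. Qed.
Lemma cont_TB n a b : cont (TB n a b).
Proof. change (cont (fun x => TB n a b x)). unfold TB. cont_tac. Qed.
#[export] Hint Resolve cont_TA cont_TB : core.

Lemma TA_ext n a b a' b' x :
  (forall k, (Z.abs k <= Z.of_nat n)%Z -> a k = a' k /\ b k = b' k) ->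
  TA n a b x = TA n a' b' x.
Proof. intros H. apply SZ_ext. intros k Hk. destruct (H k Hk) as [-> ->]. auto. Qed.
Lemma TB_ext n a b a' b' x :
  (forall k, (Z.abs k <= Z.of_nat n)%Z -> a k = a' k /\ b k = b' k) ->
  TB n a b x = TB n a' b' x.
Proof. intros H. apply SZ_ext. intros k Hk. destruct (H k Hk) as [-> ->]. auto. Qed.

Lemma TA_mask n m a b x : (n <= m)%nat ->
  TA m (mask n a) (mask n b) x = TA m a b x - TA n a b x.
Proof.
  intros H. unfold TA. rewrite <- SZ_mask by assumption. apply SZ_ext.
  intros k _. unfold mask. destruct Z_le_gt_dec; ring.
Qed.
Lemma TB_mask n m a b x : (n <= m)%nat ->
  TB m (mask n a) (mask n b) x = TB m a b x - TB n a b x.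
Proof.
  intros H. unfold TB. rewrite <- SZ_mask by assumption. apply SZ_ext.
  intros k _. unfold mask. destruct Z_le_gt_dec; ring.
Qed.

Lemma is_derive_SZ n (F : Z -> R -> R) (dF : Z -> R) x :
  (forall k, (Z.abs k <= Z.of_nat n)%Z -> is_derive (F k) x (dF k)) ->
  is_derive (fun y => SZ n (fun k => F k y)) x (SZ n dF).
Proof.
  induction n as [|n IH]; intros H; [apply H; lia|].
  apply (is_derive_plus (fun y => SZ n (fun k => F k y))
    (fun y => F (Z.of_nat (S n)) y + F (- Z.of_nat (S n))%Z y)).
  - apply IH. intros. apply H. lia.
  - apply (is_derive_plus (F (Z.of_nat (S n))) (F (- Z.of_nat (S n))%Z)); apply H; lia.
Qed.

(** Differentiation in [x] multiplies the coefficients by [ik]. *)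
Lemma is_derive_TA n a b x :
  is_derive (TA n a b) x
    (TA n (fun k => - IZR k * b k) (fun k => IZR k * a k) x).
Proof.
  apply is_derive_SZ. intros k _. auto_derive; auto. ring.
Qed.
Lemma is_derive_TB n a b x :
  is_derive (TB n a b) x
    (TB n (fun k => - IZR k * b k) (fun k => IZR k * a k) x).
Proof.
  apply is_derive_SZ. intros k _. auto_derive; auto. ring.
Qed.

(** Real part of the L^2 pairing of [f + i g] with the trigonometric polynomial of coefficients
    [a + i b]. It is the bridge between sums over modes and integrals, and the source of [Parseval]
    and [Bessel]. *)
Lemma mean_dual n a b f g : cont f -> cont g ->
  SZ n (fun k => a k * fre f g k + b k * fim f g k) =
  mean (fun x => f x * TA n a b x + g x * TB n a b x).
Proof.
  intros Hf Hg.
  transitivity (mean (fun x => SZ n (fun k =>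
    a k * (f x * cos (IZR k * x) + g x * sin (IZR k * x)) +
    b k * (g x * cos (IZR k * x) - f x * sin (IZR k * x))))).
  - rewrite mean_SZ by (intros; cont_tac). apply SZ_ext. intros k _.
    unfold fre, fim. rewrite <- !mean_scal by cont_tac.
    now rewrite <- mean_plus by cont_tac.
  - apply mean_ext. intros x. unfold TA, TB. rewrite <- !SZ_scal, <- SZ_plus.
    apply SZ_ext. intros. ring.
Qed.

Lemma fre_T n a b l : (Z.abs l <= Z.of_nat n)%Z -> fre (TA n a b) (TB n a b) l = a l.
Proof.
  intros Hl. unfold fre.
  rewrite (mean_ext _ (fun x => SZ n (fun k =>
    a k * cos (IZR (k - l) * x) - b k * sin (IZR (k - l) * x)))).
  - rewrite mean_SZ by (intros; cont_tac).
    rewrite <- (SZ_single n l a Hl). apply SZ_ext. intros k _.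
    rewrite mean_minus, !mean_scal, mean_cos, mean_sin by cont_tac.
    destruct (Z.eq_dec (k - l) 0), (Z.eq_dec k l); try lia; ring.
  - intros x. unfold TA, TB. rewrite !(Rmult_comm (SZ _ _)), <- !SZ_scal, <- SZ_plus.
    apply SZ_ext. intros k _. rewrite minus_IZR, Rmult_minus_distr_r, cos_minus, sin_minus.
    ring.
Qed.

Lemma fim_T n a b l : (Z.abs l <= Z.of_nat n)%Z -> fim (TA n a b) (TB n a b) l = b l.
Proof.
  intros Hl. unfold fim.
  rewrite (mean_ext _ (fun x => SZ n (fun k =>
    b k * cos (IZR (k - l) * x) + a k * sin (IZR (k - l) * x)))).
  - rewrite mean_SZ by (intros; cont_tac).
    rewrite <- (SZ_single n l b Hl). apply SZ_ext. intros k _.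
    rewrite mean_plus, !mean_scal, mean_cos, mean_sin by cont_tac.
    destruct (Z.eq_dec (k - l) 0), (Z.eq_dec k l); try lia; ring.
  - intros x. unfold TA, TB. rewrite !(Rmult_comm (SZ _ _)), <- !SZ_scal, <- SZ_minus.
    apply SZ_ext. intros k _. rewrite minus_IZR, Rmult_minus_distr_r, cos_minus, sin_minus.
    ring.
Qed.

Lemma Parseval n a b :
  mean (fun x => TA n a b x ^ 2 + TB n a b x ^ 2) = SZ n (fun k => a k ^ 2 + b k ^ 2).
Proof.
  rewrite (mean_ext _ (fun x => TA n a b x * TA n a b x + TB n a b x * TB n a b x))
    by (intros; ring).
  rewrite <- mean_dual by auto. apply SZ_ext. intros k Hk.
  rewrite fre_T, fim_T by assumption. ring.
Qed.

(** Expand the nonnegative mean of the squared distance from [f + i g] to its own partial sum. *)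
Lemma Bessel n f g : cont f -> cont g ->
  SZ n (fun k => fre f g k ^ 2 + fim f g k ^ 2) <= mean (fun x => f x ^ 2 + g x ^ 2).
Proof.
  intros Hf Hg. set (a := fre f g). set (b := fim f g).
  pose proof (cont_TA n a b) as HA. pose proof (cont_TB n a b) as HB.
  assert (H : 0 <= mean (fun x => (f x ^ 2 + g x ^ 2) +
    ((-2) * (f x * TA n a b x + g x * TB n a b x) + (TA n a b x ^ 2 + TB n a b x ^ 2)))).
  { apply mean_nonneg; [cont_tac|]. intros x _.
    pose proof (pow2_ge_0 (f x - TA n a b x)).
    pose proof (pow2_ge_0 (g x - TB n a b x)). nra. }
  rewrite (mean_plus (fun x => f x ^ 2 + g x ^ 2)) in H by cont_tac.
  rewrite (mean_plus (fun x => (-2) * _)) in H by cont_tac.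
  rewrite mean_scal, Parseval, <- mean_dual in H by cont_tac.
  fold a b in H.
  rewrite (SZ_ext n (fun k => a k * a k + b k * b k) (fun k => a k ^ 2 + b k ^ 2)) in H
    by (intros; ring).
  lra.
Qed.

(** Embedding of H^1 into bounded functions: Cauchy-Schwarz against the weight 1 + k^2, whose
    inverses sum to at most 5. *)
Lemma sup_T n a b x :
  TA n a b x ^ 2 <= 5 * SZ n (fun k => (1 + IZR k ^ 2) * (a k ^ 2 + b k ^ 2)) /\
  TB n a b x ^ 2 <= 5 * SZ n (fun k => (1 + IZR k ^ 2) * (a k ^ 2 + b k ^ 2)).
Proof.
  assert (Hw : forall k, 0 < 1 + IZR k ^ 2) by (intros; pose proof (pow2_ge_0 (IZR k)); lra).
  assert (H : forall c : Z -> R, (forall k, c k ^ 2 <= a k ^ 2 + b k ^ 2) ->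
    SZ n c ^ 2 <= 5 * SZ n (fun k => (1 + IZR k ^ 2) * (a k ^ 2 + b k ^ 2))).
  { intros c Hc. eapply Rle_trans; [apply (SZ_Cauchy_Schwarz n _ c Hw)|].
    apply Rmult_le_compat.
    - apply SZ_nonneg. intros. apply Rlt_le, Rinv_0_lt_compat, Hw.
    - apply SZ_nonneg. intros. apply Rmult_le_pos; [apply Rlt_le, Hw|apply pow2_ge_0].
    - apply SZ_inv_weight.
    - apply SZ_le. intros k _. apply Rmult_le_compat_l; [apply Rlt_le, Hw|apply Hc]. }
  assert (trig : forall y, sin y ^ 2 + cos y ^ 2 = 1).
  { intros y. rewrite <- !Rsqr_pow2. apply sin2_cos2. }
  split; apply H; intros k; specialize (trig (IZR k * x)); revert trig;
    set (c := cos _); set (s := sin _); intros trig.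
  - replace (a k ^ 2 + b k ^ 2) with ((a k ^ 2 + b k ^ 2) * (s ^ 2 + c ^ 2))
      by (rewrite trig; ring).
    pose proof (pow2_ge_0 (a k * s + b k * c)). nra.
  - replace (a k ^ 2 + b k ^ 2) with ((a k ^ 2 + b k ^ 2) * (s ^ 2 + c ^ 2))
      by (rewrite trig; ring).
    pose proof (pow2_ge_0 (a k * c - b k * s)). nra.
Qed.

(** * Fourier inversion *)

Lemma cont_continuity_pt f : cont f -> forall x, continuity_pt f x.
Proof. intros H x. apply continuity_pt_filterlim. apply H. Qed.

(* Integrating the derivative of [sin y (1 + cos y)^N]. *)
Lemma mean_kernel_rec x0 N :
  INR (S N) * mean (fun x => (1 + cos (x - x0)) ^ S N) =
  INR (2 * N + 1) * mean (fun x => (1 + cos (x - x0)) ^ N).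
Proof.
  set (F := fun x => sin (x - x0) * (1 + cos (x - x0)) ^ N).
  set (dF := fun x => INR (S N) * (1 + cos (x - x0)) ^ S N
                      - INR (2 * N + 1) * (1 + cos (x - x0)) ^ N).
  assert (HdF : forall x, is_derive F x (dF x)).
  { intros x. unfold F, dF. auto_derive; auto.
    assert (T : sin (x + - x0) * sin (x + - x0) = 1 - cos (x + - x0) * cos (x + - x0)).
    { pose proof (sin2_cos2 (x + - x0)) as T. unfold Rsqr in T. lra. }
    unfold Rminus. revert T. set (c := cos (x + - x0)). set (s := sin (x + - x0)).
    intros T. rewrite S_INR, plus_INR, mult_INR. simpl (INR 2). simpl (INR 1).
    destruct N as [|N]; [simpl; ring|]. simpl Nat.pred.
    transitivity (c * (1 + c) ^ S N - INR (S N) * (s * s) * (1 + c) ^ N); [ring|].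
    rewrite T. simpl. ring. }
  assert (H0 : mean dF = 0).
  { unfold mean. rewrite (RInt_deriv F dF HdF) by (unfold dF; cont_tac).
    unfold F. replace (PI - x0) with (- PI - x0 + 2 * PI) by ring.
    rewrite sin_plus, cos_plus, sin_2PI, cos_2PI, !Rmult_0_r, Rminus_0_r, Rplus_0_r,
      !Rmult_1_r.
    ring. }
  unfold dF in H0. rewrite mean_minus, !mean_scal in H0 by cont_tac. lra.
Qed.

(** The kernels [(1 + cos (x - x0))^N] concentrate at [x0]; quantitatively, the
    ratio of consecutive means tends to the maximum [2] of [1 + cos]. *)
Lemma kernel_sign h x0 : cont h -> - PI < x0 < PI ->
  (forall N, mean (fun x => h x * (1 + cos (x - x0)) ^ N) <= 0) -> h x0 <= 0.
Proof.
  intros Hh Hx0 HN. apply Rnot_lt_le. intros Hc. set (c := h x0) in *.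
  assert (Hnear : exists d, 0 < d /\ d < PI + x0 /\ d < PI - x0 /\ d < PI /\
    forall x, Rabs (x - x0) < d -> c / 2 < h x).
  { destruct (proj1 (filterlim_locally h (h x0)) (Hh x0) (mkposreal (c / 2) ltac:(lra)))
      as [e He].
    set (d := Rmin e (Rmin ((PI + x0) / 2) (Rmin ((PI - x0) / 2) (PI / 2)))).
    pose proof (cond_pos e). pose proof PI_RGT_0.
    exists d. repeat split; unfold d.
    - repeat apply Rmin_glb_lt; lra.
    - eapply Rle_lt_trans; [eapply Rle_trans; [apply Rmin_r|apply Rmin_l]|]; lra.
    - eapply Rle_lt_trans; [eapply Rle_trans; [apply Rmin_r|eapply Rle_trans;
        [apply Rmin_r|apply Rmin_l]]|]; lra.
    - eapply Rle_lt_trans; [eapply Rle_trans; [apply Rmin_r|eapply Rle_trans;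
        [apply Rmin_r|apply Rmin_r]]|]; lra.
    - intros x Hx.
      assert (Hb : ball x0 e x).
      { eapply Rlt_le_trans; [exact Hx|apply Rmin_l]. }
      specialize (He x Hb). apply Rabs_lt_between in He. simpl in He.
      unfold minus, plus, opp in He; simpl in He. unfold c in *. lra. }
  destruct Hnear as (d & Hd0 & Hd1 & Hd2 & Hd3 & Hd).
  destruct (continuity_ab_min h (- PI) PI) as (xm & Hxm & _).
  { pose proof PI_RGT_0. lra. }
  { intros. now apply cont_continuity_pt. }
  set (H := Rabs (h xm)).
  assert (Hcd : cos d < 1).
  { rewrite <- cos_0. apply cos_decreasing_1; lra. }
  (* With this slope, c/2 - A (1 - cos (x - x0)) has dropped below -H, a lower bound of [h], as soon
     as x is at distance at least d from x0 on the circle. *)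
  set (A := (H + c / 2) / (1 - cos d)).
  assert (HA : 0 < A).
  { apply Rdiv_lt_0_compat; [|lra]. pose proof (Rabs_pos (h xm)). unfold H. lra. }
  assert (Hlow : forall x, - PI < x < PI -> c / 2 - A * (1 - cos (x - x0)) <= h x).
  { intros x Hx. destruct (Rlt_le_dec (Rabs (x - x0)) d) as [Hn|Hf].
    - specialize (Hd x Hn). pose proof (COS_bound (x - x0)).
      assert (0 <= A * (1 - cos (x - x0))) by (apply Rmult_le_pos; lra). lra.
    - assert (Hcos : cos (x - x0) <= cos d).
      { replace (cos (x - x0)) with (cos (Rabs (x - x0))).
        2:{ unfold Rabs. destruct Rcase_abs; [apply cos_neg|reflexivity]. }
        destruct (Rle_lt_dec (Rabs (x - x0)) PI) as [Hp|Hp].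
        - destruct Hf as [Hf|<-]; [|lra]. apply Rlt_le, cos_decreasing_1; lra.
        (* Here [x] is closer to [x0] around the other side of the circle; [d < PI + x0] and
           [d < PI - x0] keep it at distance more than [d] there too. *)
        - assert (Rabs (x - x0) < 2 * PI - d) by (apply Rabs_def1; lra).
          replace (cos (Rabs (x - x0))) with (cos (2 * PI - Rabs (x - x0))).
          2:{ rewrite cos_minus, cos_2PI, sin_2PI. ring. }
          apply Rlt_le, cos_decreasing_1; lra. }
      assert (A * (1 - cos d) = H + c / 2) by (unfold A; field; lra).
      assert (A * (1 - cos d) <= A * (1 - cos (x - x0)))
        by (apply Rmult_le_compat_l; lra).
      specialize (Hxm x ltac:(lra)). pose proof (Rle_abs (- h xm)).
      rewrite Rabs_Ropp in H2. unfold H in *. lra. }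
  set (m := fun N => mean (fun x => (1 + cos (x - x0)) ^ N)).
  assert (Hm : forall N, (c / 2 - 2 * A) * m N + A * m (S N) <= 0).
  { intros N. eapply Rle_trans; [|apply (HN N)]. unfold m.
    rewrite <- !mean_scal by cont_tac. rewrite <- mean_plus by cont_tac.
    apply mean_le; cont_tac. intros x Hx.
    replace ((c / 2 - 2 * A) * (1 + cos (x - x0)) ^ N +
      A * (1 + cos (x - x0)) ^ S N) with
      ((c / 2 - A * (1 - cos (x - x0))) * (1 + cos (x - x0)) ^ N) by (simpl; ring).
    apply Rmult_le_compat_r; [apply pow_le; pose proof (COS_bound (x - x0)); lra|].
    auto. }
  (* By [mean_kernel_rec], [N + 1] times the left side of [Hm] equals ((N + 1) c/2 - A) m(N), which
     is positive once N c > 2 A. *)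
  destruct (INR_unbounded (2 * A / c)) as [N HNc].
  assert (Hpos : 0 < m N).
  { assert (0 < m 0%nat).
    { unfold m. rewrite (mean_ext _ (fun _ => 1)) by reflexivity.
      rewrite mean_const. lra. }
    clear - H0. induction N as [|N IH]; [assumption|].
    pose proof (mean_kernel_rec x0 N) as E. fold (m N) (m (S N)) in E.
    assert (0 < INR (S N)) by (apply lt_0_INR; lia).
    assert (0 < INR (2 * N + 1)) by (apply lt_0_INR; lia).
    apply Rmult_lt_reg_l with (INR (S N)); [assumption|].
    rewrite Rmult_0_r, E. now apply Rmult_lt_0_compat. }
  pose proof (mean_kernel_rec x0 N) as E. fold (m N) (m (S N)) in E.
  specialize (Hm N). rewrite S_INR, plus_INR, mult_INR in E. simpl (INR 2) in E.
  simpl (INR 1) in E. pose proof (pos_INR N).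
  assert (2 * A < INR N * c).
  { apply Rmult_lt_reg_r with (/ c); [now apply Rinv_0_lt_compat|].
    replace (INR N * c * / c) with (INR N) by (field; lra). exact HNc. }
  assert ((INR N + 1) * ((c / 2 - 2 * A) * m N + A * m (S N)) <= 0) by nra.
  assert ((INR N + 1) * ((c / 2 - 2 * A) * m N + A * m (S N)) =
    ((INR N + 1) * c / 2 - A) * m N).
  { transitivity ((INR N + 1) * (c / 2 - 2 * A) * m N + A * ((INR N + 1) * m (S N)));
      [ring|]. rewrite E. field. }
  assert (0 < ((INR N + 1) * c / 2 - A) * m N); [|lra].
  apply Rmult_lt_0_compat; [nra|assumption].
Qed.

(** Each factor 1 + cos (x - x0) moves a frequency by at most one, so N factors use up N of the m
    frequencies to which [g] is orthogonal. *)
Lemma kernel_orthogonal g x0 m : cont g ->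
  (forall l, (Z.abs l <= Z.of_nat m)%Z ->
     mean (fun x => g x * cos (IZR l * x)) = 0 /\
     mean (fun x => g x * sin (IZR l * x)) = 0) ->
  forall N l, (Z.abs l + Z.of_nat N <= Z.of_nat m)%Z ->
     mean (fun x => g x * (1 + cos (x - x0)) ^ N * cos (IZR l * x)) = 0 /\
     mean (fun x => g x * (1 + cos (x - x0)) ^ N * sin (IZR l * x)) = 0.
Proof.
  intros Hg H0 N. induction N as [|N IH]; intros l Hl.
  - destruct (H0 l ltac:(lia)) as [C0 S0].
    split; [rewrite <- C0 | rewrite <- S0]; apply mean_ext; intros; simpl; ring.
  - destruct (IH l ltac:(lia)) as [C0 S0].
    destruct (IH (l + 1)%Z ltac:(lia)) as [C1 S1].
    destruct (IH (l - 1)%Z ltac:(lia)) as [C2 S2].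
    set (G := fun x => g x * (1 + cos (x - x0)) ^ N).
    assert (HG : cont G) by (unfold G; cont_tac).
    split.
    + rewrite (mean_ext _ (fun x => G x * cos (IZR l * x) +
        ((cos x0 / 2) * (G x * cos (IZR (l + 1) * x)) +
         (cos x0 / 2) * (G x * cos (IZR (l - 1) * x))) +
        ((sin x0 / 2) * (G x * sin (IZR (l + 1) * x)) -
         (sin x0 / 2) * (G x * sin (IZR (l - 1) * x))))).
      * rewrite !mean_plus, mean_minus, !mean_scal by cont_tac.
        unfold G. rewrite C0, C1, C2, S1, S2. ring.
      * intros x. unfold G. rewrite plus_IZR, minus_IZR.
        rewrite !Rmult_plus_distr_r, !Rmult_minus_distr_r, !Rmult_1_l.
        rewrite (cos_plus (IZR l * x)), (sin_plus (IZR l * x)).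
        rewrite (cos_minus (IZR l * x)), (sin_minus (IZR l * x)).
        simpl. rewrite (cos_minus x x0). field.
    + rewrite (mean_ext _ (fun x => G x * sin (IZR l * x) +
        ((cos x0 / 2) * (G x * sin (IZR (l + 1) * x)) +
         (cos x0 / 2) * (G x * sin (IZR (l - 1) * x))) +
        ((sin x0 / 2) * (G x * cos (IZR (l - 1) * x)) -
         (sin x0 / 2) * (G x * cos (IZR (l + 1) * x))))).
      * rewrite !mean_plus, mean_minus, !mean_scal by cont_tac.
        unfold G. rewrite S0, C1, C2, S1, S2. ring.
      * intros x. unfold G. rewrite plus_IZR, minus_IZR.
        rewrite !Rmult_plus_distr_r, !Rmult_minus_distr_r, !Rmult_1_l.
        rewrite (cos_plus (IZR l * x)), (sin_plus (IZR l * x)).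
        rewrite (cos_minus (IZR l * x)), (sin_minus (IZR l * x)).
        simpl. rewrite (cos_minus x x0). field.
Qed.

(** Sums and differences of the coefficients at [l] and [-l] separate [f] from [g]. This reduces
    inversion to real functions, where the order argument of [kernel_sign] applies. *)
Lemma fourier_zero_components f g l : cont f -> cont g ->
  fre f g l = 0 -> fim f g l = 0 -> fre f g (- l) = 0 -> fim f g (- l) = 0 ->
  (mean (fun x => f x * cos (IZR l * x)) = 0 /\
   mean (fun x => f x * sin (IZR l * x)) = 0) /\
  (mean (fun x => g x * cos (IZR l * x)) = 0 /\
   mean (fun x => g x * sin (IZR l * x)) = 0).
Proof.
  intros Hf Hg. unfold fre, fim. rewrite !opp_IZR.
  rewrite (mean_ext (fun x => f x * cos (- IZR l * x) + g x * sin (- IZR l * x))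
    (fun x => f x * cos (IZR l * x) - g x * sin (IZR l * x))).
  2:{ intros x. rewrite Ropp_mult_distr_l_reverse, cos_neg, sin_neg. ring. }
  rewrite (mean_ext (fun x => g x * cos (- IZR l * x) - f x * sin (- IZR l * x))
    (fun x => g x * cos (IZR l * x) + f x * sin (IZR l * x))).
  2:{ intros x. rewrite Ropp_mult_distr_l_reverse, cos_neg, sin_neg. ring. }
  rewrite !mean_plus, !mean_minus by cont_tac. lra.
Qed.

(** Against a kernel of degree N <= m, [f] and [T m] have the same mean, so [f - T n] may be
    replaced by [T m - T n], which is bounded by [rho]. Then [kernel_sign] turns the bound on means
    into one at [x0]. The index m is chosen after N, and no limit in m is taken. *)
Lemma inversion_component f (T : nat -> R -> R) n rho :
  cont f -> (forall m, cont (T m)) ->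
  (forall m l, (Z.abs l <= Z.of_nat m)%Z ->
     mean (fun x => (f x - T m x) * cos (IZR l * x)) = 0 /\
     mean (fun x => (f x - T m x) * sin (IZR l * x)) = 0) ->
  (forall m x, (n <= m)%nat -> Rabs (T m x - T n x) <= rho) ->
  forall x0, - PI < x0 < PI -> Rabs (f x0 - T n x0) <= rho.
Proof.
  intros Hf HT Horth Hrho x0 Hx0.
  assert (Hker : forall m N, (N <= m)%nat ->
    mean (fun x => (f x - T m x) * (1 + cos (x - x0)) ^ N) = 0).
  { intros m N HmN.
    destruct (kernel_orthogonal (fun x => f x - T m x) x0 m) with (N := N) (l := 0%Z)
      as [H _]; auto; [cont_tac; auto|lia|].
    rewrite <- H. apply mean_ext. intros x. rewrite Rmult_0_l, cos_0. ring. }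
  assert (Hk0 : forall x N, 0 <= (1 + cos (x - x0)) ^ N).
  { intros x N. apply pow_le. pose proof (COS_bound (x - x0)). lra. }
  pose proof (HT n) as HTn.
  apply Rabs_le. split.
  - enough ((fun x => (-1) * (f x - T n x) - rho) x0 <= 0) by (simpl in *; lra).
    apply (kernel_sign (fun x => (-1) * (f x - T n x) - rho) x0); [cont_tac|assumption|]. intros N.
    set (m := Nat.max n N). pose proof (HT m) as HTm.
    rewrite <- (Rmult_0_r (-1)), <- (Hker m N) by lia.
    rewrite <- mean_scal by cont_tac.
    apply mean_le; cont_tac. intros x _.
    assert (Hd := Hrho m x ltac:(lia)). apply Rabs_le_between in Hd.
    rewrite <- Rmult_assoc. apply Rmult_le_compat_r; [apply Hk0|]. lra.
  - enough ((fun x => (f x - T n x) - rho) x0 <= 0) by (simpl in *; lra).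
    apply (kernel_sign (fun x => (f x - T n x) - rho) x0); [cont_tac|assumption|]. intros N.
    set (m := Nat.max n N). pose proof (HT m) as HTm.
    rewrite <- (Hker m N) by lia.
    apply mean_le; cont_tac. intros x _.
    assert (Hd := Hrho m x ltac:(lia)). apply Rabs_le_between in Hd.
    apply Rmult_le_compat_r; [apply Hk0|]. lra.
Qed.

Definition h1 (a b : Z -> R) (k : Z) : R := (1 + IZR k ^ 2) * (a k ^ 2 + b k ^ 2).

Lemma h1_nonneg a b k : 0 <= h1 a b k.
Proof.
  unfold h1. pose proof (pow2_ge_0 (IZR k)). pose proof (pow2_ge_0 (a k)).
  pose proof (pow2_ge_0 (b k)). apply Rmult_le_pos; lra.
Qed.

Lemma Rabs_le_sqrt x y : x ^ 2 <= y -> Rabs x <= sqrt y.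
Proof.
  intros H. rewrite <- sqrt_Rsqr_abs. apply sqrt_le_1_alt. now rewrite Rsqr_pow2.
Qed.

Lemma sup_T_abs n a b x K : SZ n (h1 a b) <= K ->
  Rabs (TA n a b x) <= sqrt (5 * K) /\ Rabs (TB n a b x) <= sqrt (5 * K).
Proof.
  intros H. destruct (sup_T n a b x) as [H1 H2]. fold (h1 a b) in H1, H2.
  split; apply Rabs_le_sqrt; lra.
Qed.

Lemma h1_mask n a b k : h1 (mask n a) (mask n b) k = mask n (h1 a b) k.
Proof. unfold h1, mask. destruct Z_le_gt_dec; ring. Qed.

Lemma T_tail n m a b x tau : (n <= m)%nat -> SZ m (h1 a b) - SZ n (h1 a b) <= tau ->
  Rabs (TA m a b x - TA n a b x) <= sqrt (5 * tau) /\
  Rabs (TB m a b x - TB n a b x) <= sqrt (5 * tau).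
Proof.
  intros Hnm H. rewrite <- TA_mask, <- TB_mask by assumption. apply sup_T_abs.
  rewrite (SZ_ext m _ (mask n (h1 a b))) by (intros; apply h1_mask).
  now rewrite SZ_mask.
Qed.

Lemma fourier_inversion f g n tau : cont f -> cont g ->
  (forall m, (n <= m)%nat ->
     SZ m (h1 (fre f g) (fim f g)) - SZ n (h1 (fre f g) (fim f g)) <= tau) ->
  forall x, - PI < x < PI ->
    Rabs (f x - TA n (fre f g) (fim f g) x) <= sqrt (5 * tau) /\
    Rabs (g x - TB n (fre f g) (fim f g) x) <= sqrt (5 * tau).
Proof.
  intros Hf Hg Htau x Hx. set (a := fre f g) in *. set (b := fim f g) in *.
  assert (Hz : forall m l, (Z.abs l <= Z.of_nat m)%Z ->
    fre (fun x => f x - TA m a b x) (fun x => g x - TB m a b x) l = 0 /\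
    fim (fun x => f x - TA m a b x) (fun x => g x - TB m a b x) l = 0).
  { intros m l Hl.
    pose proof (fre_T m a b l Hl) as E1. pose proof (fim_T m a b l Hl) as E2.
    pose proof (cont_TA m a b) as HA. pose proof (cont_TB m a b) as HB.
    split.
    - transitivity (fre f g l - fre (TA m a b) (TB m a b) l);
        [|rewrite E1; unfold a; ring].
      unfold fre. rewrite <- mean_minus by cont_tac. apply mean_ext. intros. ring.
    - transitivity (fim f g l - fim (TA m a b) (TB m a b) l);
        [|rewrite E2; unfold b; ring].
      unfold fim. rewrite <- mean_minus by cont_tac. apply mean_ext. intros. ring. }
  assert (Hcomp : forall m l, (Z.abs l <= Z.of_nat m)%Z -> _) by
    (intros m l Hl; exact (fourier_zero_components _ _ l
      (cont_minus _ _ Hf (cont_TA m a b)) (cont_minus _ _ Hg (cont_TB m a b))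
      (proj1 (Hz m l Hl)) (proj2 (Hz m l Hl))
      (proj1 (Hz m (- l)%Z ltac:(lia))) (proj2 (Hz m (- l)%Z ltac:(lia))))).
  split.
  - apply (inversion_component f (fun m => TA m a b)); auto.
    + intros m l Hl. apply (Hcomp m l Hl).
    + intros m y Hm. apply (T_tail n m a b y tau Hm). auto.
  - apply (inversion_component g (fun m => TB m a b)); auto.
    + intros m l Hl. apply (Hcomp m l Hl).
    + intros m y Hm. apply (T_tail n m a b y tau Hm). auto.
Qed.

(** * Solutions as families of Fourier coefficients *)

Lemma Cmod_sqr z : Cmod z ^ 2 = fst z ^ 2 + snd z ^ 2.
Proof.
  unfold Cmod. apply pow2_sqrt.
  pose proof (pow2_ge_0 (fst z)). pose proof (pow2_ge_0 (snd z)). lra.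
Qed.

Lemma cont_fst (f : R -> C) : (forall x, continuous f x) -> cont (fun x => fst (f x)).
Proof.
  intros H x. apply (continuous_comp f fst); [apply H|].
  destruct (f x). apply continuous_fst.
Qed.
Lemma cont_snd (f : R -> C) : (forall x, continuous f x) -> cont (fun x => snd (f x)).
Proof.
  intros H x. apply (continuous_comp f snd); [apply H|].
  destruct (f x). apply continuous_snd.
Qed.

Lemma fourier_components (f : R -> C) k :
  cont (fun x => fst (f x)) -> cont (fun x => snd (f x)) ->
  fourier f k =
  (fre (fun x => fst (f x)) (fun x => snd (f x)) k,
   fim (fun x => fst (f x)) (fun x => snd (f x)) k).
Proof.
  intros H1 H2. unfold fourier, fre, fim, mean.
  set (u := fun x => fst (f x) * cos (IZR k * x) + snd (f x) * sin (IZR k * x)).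
  set (v := fun x => snd (f x) * cos (IZR k * x) - fst (f x) * sin (IZR k * x)).
  assert (Hu : cont u) by (unfold u; cont_tac).
  assert (Hv : cont v) by (unfold v; cont_tac).
  assert (E : RInt (V := C_R_CompleteNormedModule)
     (fun x : R => (f x * cis (- (IZR k * x)))%C) (- PI) PI =
     (RInt u (- PI) PI, RInt v (- PI) PI)).
  { apply (is_RInt_unique (V := C_R_CompleteNormedModule)).
    apply (is_RInt_fct_extend_pair (U := R_NormedModule) (V := R_NormedModule)).
    - apply is_RInt_ext with u.
      + intros x _. unfold u, cis, Cmult. simpl. rewrite cos_neg, sin_neg. ring.
      + apply (RInt_correct (V := R_CompleteNormedModule)). now apply cont_ex_RInt.
    - apply is_RInt_ext with v.
      + intros x _. unfold v, cis, Cmult. simpl. rewrite cos_neg, sin_neg. ring.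
      + apply (RInt_correct (V := R_CompleteNormedModule)). now apply cont_ex_RInt. }
  rewrite E. unfold Cmult, RtoC. simpl. f_equal; ring.
Qed.

Definition sob (s : R) (c : Z -> C) (k : Z) : R :=
  Rpower (1 + IZR k ^ 2) s * Cmod (c k) ^ 2.

Lemma sob_nonneg s c k : 0 <= sob s c k.
Proof.
  unfold sob. apply Rmult_le_pos; [|apply pow2_ge_0].
  apply Rlt_le. unfold Rpower. apply exp_pos.
Qed.

Lemma SZ_is_lim g : ex_series (fold_Z g) -> is_lim_seq (fun n => SZ n g) (Series (fold_Z g)).
Proof.
  intros H. apply Series_correct in H.
  apply is_lim_seq_ext with (sum_n (fold_Z g)); [|exact H].
  intros n. apply sum_n_Reals.
Qed.

Lemma SZ_le_Series g n : (forall k, 0 <= g k) -> ex_series (fold_Z g) ->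
  SZ n g <= Series (fold_Z g).
Proof.
  intros Hg H. apply SZ_is_lim in H.
  apply is_lim_seq_incr_compare with (n := n) in H; [exact H|].
  intros m. apply SZ_mono; [assumption|lia].
Qed.

Lemma SZ_sob_le s c n : in_sobolev s c -> SZ n (sob s c) <= sobolev_norm s c ^ 2.
Proof.
  intros H. unfold sobolev_norm. rewrite pow2_sqrt.
  - apply SZ_le_Series; [apply sob_nonneg|exact H].
  - eapply Rle_trans; [|apply (SZ_le_Series (sob s c) 0); [apply sob_nonneg|exact H]].
    apply sob_nonneg.
Qed.

Lemma h1_le_sob s c k : 1 <= s ->
  h1 (fun k => fst (c k)) (fun k => snd (c k)) k <= sob s c k.
Proof.
  intros Hs. unfold h1, sob. rewrite Cmod_sqr.
  pose proof (pow2_ge_0 (IZR k)).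
  apply Rmult_le_compat_r.
  - pose proof (pow2_ge_0 (fst (c k))). pose proof (pow2_ge_0 (snd (c k))). lra.
  - rewrite <- (Rpower_1 (1 + IZR k ^ 2)) at 1 by lra. apply Rle_Rpower; lra.
Qed.

Lemma SZ_tail_lim g eta : 0 < eta -> (forall k, 0 <= g k) -> ex_series (fold_Z g) ->
  exists n, forall m, (n <= m)%nat -> SZ m g - SZ n g <= eta.
Proof.
  intros He Hg H.
  destruct (proj2 (is_lim_seq_spec _ _) (SZ_is_lim _ H) (mkposreal _ He)) as [n Hn].
  exists n. intros m Hm. pose proof (SZ_le_Series g m Hg H).
  specialize (Hn n (le_n n)). simpl in Hn. apply Rabs_lt_between in Hn. lra.
Qed.

Lemma SZ_mask_le n m g h : (n <= m)%nat -> (forall k, g k <= h k) ->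
  SZ m g - SZ n g <= SZ m h - SZ n h.
Proof.
  intros Hnm H. rewrite <- !SZ_mask by assumption. apply SZ_le. intros k _.
  unfold mask. destruct Z_le_gt_dec; [lra|apply H].
Qed.

(** [cub sg u v] and [cub sg v u] are the real and imaginary parts of
    [2 sg cos(2x) |w|^2 w] for [w = u + i v]. *)
Definition cub (sg : R) (u v : R -> R) (x : R) : R :=
  2 * sg * cos (2 * x) * (u x ^ 2 + v x ^ 2) * u x.

Lemma cont_cub sg u v : cont u -> cont v -> cont (cub sg u v).
Proof. intros Hu Hv. change (cont (fun x => cub sg u v x)). unfold cub. cont_tac. Qed.
#[export] Hint Resolve cont_cub : core.

(** A solution [f + i g], seen through its Fourier coefficients [A + i B]. *)
Record h1_solution (sg : R) (f g : R -> R -> R) (A B : R -> Z -> R) : Prop := {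
  sol_cont_re : forall t, cont (f t);
  sol_cont_im : forall t, cont (g t);
  sol_re : forall t k, A t k = fre (f t) (g t) k;
  sol_im : forall t k, B t k = fim (f t) (g t) k;
  sol_derive_re : forall t k, is_derive (fun t => A t k) t
    (IZR k ^ 2 * B t k + fim (cub sg (f t) (g t)) (cub sg (g t) (f t)) k);
  sol_derive_im : forall t k, is_derive (fun t => B t k) t
    (- (IZR k ^ 2 * A t k + fre (cub sg (f t) (g t)) (cub sg (g t) (f t)) k));
  sol_tail : forall t eta, 0 < eta ->
    exists n, forall m, (n <= m)%nat -> SZ m (h1 (A t) (B t)) - SZ n (h1 (A t) (B t)) <= eta;
  sol_h1_cont : forall t0 eta, 0 < eta -> locally t0 (fun t => forall n,
    SZ n (h1 (fun k => A t k - A t0 k) (fun k => B t k - B t0 k)) <= eta)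
}.

Lemma is_derive_of_quotient (F : R -> R) t l :
  (forall eta, 0 < eta -> locally' 0 (fun h => Rabs ((F (t + h) - F t) / h - l) < eta)) ->
  is_derive F t l.
Proof.
  intros H. apply is_derive_Reals. intros eta Heta.
  destruct (H eta Heta) as [d Hd]. exists d. intros h Hh0 Hh. apply Hd; [|assumption].
  unfold ball; simpl. unfold AbsRing_ball, minus, plus, opp, abs; simpl.
  now rewrite Ropp_0, Rplus_0_r.
Qed.

Lemma abs_components z x : Cmod z ^ 2 < x ^ 2 -> 0 < x ->
  Rabs (fst z) < x /\ Rabs (snd z) < x.
Proof.
  rewrite Cmod_sqr. intros H Hx.
  pose proof (pow2_ge_0 (fst z)). pose proof (pow2_ge_0 (snd z)).
  split; rewrite <- (Rabs_pos_eq x) by lra; apply Rsqr_lt_abs_0; rewrite !Rsqr_pow2; lra.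
Qed.

(** Since s >= 1, the H^s weights dominate those of H^1, which gives tails and continuity in time;
    the H^(s-2) derivative serves only to differentiate each coefficient separately. *)
Lemma solution_h1 s sg psi : 1 <= s -> global_solution s sg psi ->
  h1_solution sg (fun t x => fst (psi t x)) (fun t x => snd (psi t x))
    (fun t k => fst (fourier (psi t) k)) (fun t k => snd (fourier (psi t) k)).
Proof.
  intros Hs (Hfun & Hcont & psi_t & Hder & Heq).
  assert (C1 : forall t, cont (fun x => fst (psi t x))) by
    (intros t; apply cont_fst, Hfun).
  assert (C2 : forall t, cont (fun x => snd (psi t x))) by
    (intros t; apply cont_snd, Hfun).
  assert (HN : forall t k, fourier (nonlinearity sg (psi t)) k =
    (fre (cub sg (fun x => fst (psi t x)) (fun x => snd (psi t x)))
         (cub sg (fun x => snd (psi t x)) (fun x => fst (psi t x))) k,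
     fim (cub sg (fun x => fst (psi t x)) (fun x => snd (psi t x)))
         (cub sg (fun x => snd (psi t x)) (fun x => fst (psi t x))) k)).
  { intros t k.
    assert (E1 : forall x, fst (nonlinearity sg (psi t) x) =
      cub sg (fun x => fst (psi t x)) (fun x => snd (psi t x)) x).
    { intros x. unfold nonlinearity, cub. rewrite Cmod_sqr. simpl. ring. }
    assert (E2 : forall x, snd (nonlinearity sg (psi t) x) =
      cub sg (fun x => snd (psi t x)) (fun x => fst (psi t x)) x).
    { intros x. unfold nonlinearity, cub. rewrite Cmod_sqr. simpl. ring. }
    rewrite fourier_components.
    - f_equal; apply mean_ext; intros x; rewrite E1, E2; reflexivity.
    - intros x. eapply continuous_ext; [intros; symmetry; apply E1|]. now apply cont_cub.
    - intros x. eapply continuous_ext; [intros; symmetry; apply E2|]. now apply cont_cub. }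
  assert (Hd : forall t k eta, 0 < eta -> locally' 0 (fun h =>
    Rabs ((fst (fourier (psi (t + h)) k) - fst (fourier (psi t) k)) / h
       - fst (psi_t t k)) < eta /\
    Rabs ((snd (fourier (psi (t + h)) k) - snd (fourier (psi t) k)) / h
       - snd (psi_t t k)) < eta)).
  { intros t k eta Heta.
    (* The exponent may be negative and [w] small for large [k], but for a fixed mode the H^(s-2)
       norm still bounds sqrt(w) times the modulus of the coefficient. *)
    set (w := Rpower (1 + IZR k ^ 2) (s - 2)).
    assert (Hw : 0 < w) by (unfold w, Rpower; apply exp_pos).
    assert (Hsw : 0 < sqrt w) by now apply sqrt_lt_R0.
    destruct (Hder t (sqrt w * eta) ltac:(now apply Rmult_lt_0_compat)) as [d Hd].
    exists d. intros h Hh Hh0. specialize (Hd h Hh Hh0). cbv beta in Hd.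
    destruct Hd as [Hin Hnorm].
    set (c := fun k => (((fourier (psi (t + h)%R) k - fourier (psi t) k) / RtoC h) -
       psi_t t k)%C) in *.
    assert (Hsum := SZ_sob_le _ c (Z.abs_nat k) Hin).
    assert (Hterm := SZ_ge_term (Z.abs_nat k) (sob (s - 2) c) k (sob_nonneg _ _)
      ltac:(lia)).
    assert (Hn0 : 0 <= sobolev_norm (s - 2) c) by apply sqrt_pos.
    assert (Hck : Cmod (c k) ^ 2 < eta ^ 2).
    { apply Rmult_lt_reg_l with w; [assumption|].
      apply Rle_lt_trans with (sobolev_norm (s - 2) c ^ 2); [change (w * Cmod (c k) ^ 2) with (sob (s - 2) c k); lra|].
      replace (w * eta ^ 2) with ((sqrt w * eta) ^ 2)
        by (rewrite Rpow_mult_distr, pow2_sqrt; lra).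
      rewrite <- !Rsqr_pow2. apply Rsqr_incrst_1; [assumption|lra|].
      apply Rlt_le. now apply Rmult_lt_0_compat. }
    destruct (abs_components _ _ Hck Heta) as [K1 K2].
    unfold c in K1, K2.
    assert (D : forall z : C, (z / RtoC h)%C = (fst z / h, snd z / h)).
    { intros [x y]. unfold Cdiv, Cinv, Cmult, RtoC. simpl. f_equal; field; auto. }
    rewrite D in K1, K2. simpl in K1, K2. split; assumption. }
  assert (Hpsit : forall t k, psi_t t k =
    (IZR k ^ 2 * snd (fourier (psi t) k) + snd (fourier (nonlinearity sg (psi t)) k),
     - (IZR k ^ 2 * fst (fourier (psi t) k) + fst (fourier (nonlinearity sg (psi t)) k)))).
  { intros t k. specialize (Heq t k). unfold fourier_dxx in Heq.
    revert Heq. destruct (psi_t t k) as [p q], (fourier (psi t) k) as [x y],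
      (fourier (nonlinearity sg (psi t)) k) as [u v].
    unfold Ci, Cmult, Cplus, Copp, RtoC. simpl. intros E. injection E. intros E2 E1.
    f_equal; lra. }
  split.
  - exact C1.
  - exact C2.
  - intros t k. now rewrite fourier_components.
  - intros t k. now rewrite fourier_components.
  - intros t k. apply is_derive_of_quotient. intros eta Heta.
    generalize (Hd t k eta Heta). apply filter_imp. intros h [H _].
    rewrite Hpsit, HN in H. exact H.
  - intros t k. apply is_derive_of_quotient. intros eta Heta.
    generalize (Hd t k eta Heta). apply filter_imp. intros h [_ H].
    rewrite Hpsit, HN in H. exact H.
  - intros t eta Heta. destruct (Hfun t) as (_ & _ & Hin).
    destruct (SZ_tail_lim (sob s (fourier (psi t))) eta Heta (sob_nonneg _ _) Hin)
      as [n Hn].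
    exists n. intros m Hm. eapply Rle_trans; [|apply (Hn m Hm)].
    apply SZ_mask_le; [assumption|]. intros k. now apply h1_le_sob.
  - intros t0 eta Heta.
    generalize (Hcont t0 (sqrt eta) (sqrt_lt_R0 _ Heta)). apply filter_imp.
    intros t [Hin Hnorm] n. set (c := fun k => (fourier (psi t) k - fourier (psi t0) k)%C) in *.
    eapply Rle_trans; [apply (SZ_le n _ (sob s c)); intros k _; apply (h1_le_sob s c k Hs)|].
    eapply Rle_trans; [now apply SZ_sob_le|].
    assert (Hn0 : 0 <= sobolev_norm s c) by apply sqrt_pos.
    rewrite <- (pow2_sqrt eta) by lra. apply pow_incr. lra.
Qed.

Lemma h1_sum_le a b a' b' k :
  h1 (fun k => a k + a' k) (fun k => b k + b' k) k <= 2 * h1 a b k + 2 * h1 a' b' k.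
Proof.
  unfold h1. pose proof (pow2_ge_0 (IZR k)).
  replace (2 * ((1 + IZR k ^ 2) * (a k ^ 2 + b k ^ 2)) +
    2 * ((1 + IZR k ^ 2) * (a' k ^ 2 + b' k ^ 2))) with
    ((1 + IZR k ^ 2) * (2 * (a k ^ 2 + b k ^ 2) + 2 * (a' k ^ 2 + b' k ^ 2))) by ring.
  apply Rmult_le_compat_l; [lra|].
  pose proof (pow2_ge_0 (a k - a' k)). pose proof (pow2_ge_0 (b k - b' k)). nra.
Qed.

Lemma h1_ext a b a' b' k : a k = a' k -> b k = b' k -> h1 a b k = h1 a' b' k.
Proof. unfold h1. now intros -> ->. Qed.

(** Dini: [t -> A t] is continuous into [H^1], so its tails are uniformly small
    on compact time intervals. *)
Lemma uniform_tail sg f g A B T eta : h1_solution sg f g A B -> 0 < eta ->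
  exists n0 K, forall t, Rabs t <= T ->
    (forall n, SZ n (h1 (A t) (B t)) <= K) /\
    (forall n m, (n0 <= n <= m)%nat ->
       SZ m (h1 (A t) (B t)) - SZ n (h1 (A t) (B t)) <= eta).
Proof.
  intros Hsol Heta.
  (* Radius, bound and truncation threshold are all encoded by one number, because
     [compactness_value_1d] returns a single positive [d] below the local radii. The property is
     inherited by every smaller [e], hence holds for that [d]. *)
  assert (Hloc : forall t0, exists d : posreal, forall t, Rabs (t - t0) < d ->
    forall e, 0 < e <= d ->
    (forall n, SZ n (h1 (A t) (B t)) <= / e) /\
    (forall n m, / e <= INR n -> (n <= m)%nat ->
       SZ m (h1 (A t) (B t)) - SZ n (h1 (A t) (B t)) <= eta)).
  { intros t0.
    (* Near [t0] a tail is at most twice the squared H^1 distance to time [t0] plus twice the tail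
       there: two halves of [eta]. *)
    destruct (sol_tail _ _ _ _ _ Hsol t0 (eta / 4) ltac:(lra)) as [n0 Hn0].
    destruct (sol_h1_cont _ _ _ _ _ Hsol t0 (eta / 4) ltac:(lra)) as [r Hr].
    set (K := SZ n0 (h1 (A t0) (B t0)) + eta).
    assert (HK0 : 0 <= SZ n0 (h1 (A t0) (B t0))) by (apply SZ_nonneg; intros; apply h1_nonneg).
    set (M := INR n0 + 2 * K + eta).
    assert (HM : 0 < M) by (unfold M, K; pose proof (pos_INR n0); lra).
    assert (Hd : 0 < Rmin r (/ M)).
    { apply Rmin_glb_lt; [apply cond_pos|now apply Rinv_0_lt_compat]. }
    exists (mkposreal _ Hd). simpl. intros t Ht e He.
    assert (HMe : M <= / e).
    { rewrite <- (Rinv_inv M). apply Rinv_le_contravar; [lra|].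
      eapply Rle_trans; [apply He|apply Rmin_r]. }
    assert (Hdiff := Hr t (Rlt_le_trans _ _ _ Ht (Rmin_l _ _))).
    assert (Hle : forall k, h1 (A t) (B t) k <=
      2 * h1 (fun k => A t k - A t0 k) (fun k => B t k - B t0 k) k + 2 * h1 (A t0) (B t0) k).
    { intros k. eapply Rle_trans; [|apply h1_sum_le]. right. apply h1_ext; ring. }
    assert (Hall : forall n, SZ n (h1 (A t0) (B t0)) <= K).
    { intros n. destruct (Nat.le_ge_cases n0 n) as [H|H].
      - specialize (Hn0 n H). unfold K. lra.
      - pose proof (SZ_mono n n0 (h1 (A t0) (B t0)) (h1_nonneg _ _) H). unfold K. lra. }
    split.
    - intros n. eapply Rle_trans; [apply SZ_le; intros k _; apply Hle|].
      rewrite SZ_plus, !SZ_scal. specialize (Hdiff n). specialize (Hall n).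
      eapply Rle_trans; [|apply HMe]. unfold M. pose proof (pos_INR n0). lra.
    - intros n m Hn Hnm.
      assert (Hn0n : (n0 <= n)%nat).
      { apply INR_le. unfold M, K in HMe. lra. }
      eapply Rle_trans; [apply SZ_mask_le; [assumption|apply Hle]|].
      rewrite !SZ_plus, !SZ_scal. specialize (Hdiff m).
      assert (0 <= SZ n (h1 (fun k => A t k - A t0 k) (fun k => B t k - B t0 k)))
        by (apply SZ_nonneg; intros; apply h1_nonneg).
      assert (SZ n0 (h1 (A t0) (B t0)) <= SZ n (h1 (A t0) (B t0)))
        by (apply SZ_mono; [apply h1_nonneg|assumption]).
      specialize (Hn0 m ltac:(lia)). lra. }
  set (delta := fun t0 => proj1_sig (constructive_indefinite_description _ (Hloc t0))).
  assert (Hdelta := fun t0 => proj2_sig (constructive_indefinite_description _ (Hloc t0))).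
  destruct (compactness_value_1d (- T) T delta) as [d Hd].
  destruct (INR_unbounded (/ d)) as [n0 Hn0].
  exists n0, (/ d). intros t Ht. apply Rabs_le_between in Ht.
  apply NNPP. intros Hneg. apply (Hd t Ht). intros (t0 & _ & Ht0 & Hdt0).
  destruct (Hdelta t0 t Ht0 d (conj (cond_pos d) Hdt0)) as [H1 H2].
  apply Hneg. split; [assumption|]. intros n m Hnm. apply H2; [|lia].
  assert (INR n0 <= INR n) by (apply le_INR; lia). lra.
Qed.

(** * Mass and parity *)

Lemma Rabs_mult_le x y X Y : Rabs x <= X -> Rabs y <= Y -> Rabs (x * y) <= X * Y.
Proof. intros. rewrite Rabs_mult. apply Rmult_le_compat; auto using Rabs_pos. Qed.

Lemma Rabs_plus_le x y X Y : Rabs x <= X -> Rabs y <= Y -> Rabs (x + y) <= X + Y.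
Proof. intros. eapply Rle_trans; [apply Rabs_triang|]. lra. Qed.

Lemma Rabs_minus_le x y X Y : Rabs x <= X -> Rabs y <= Y -> Rabs (x - y) <= X + Y.
Proof. intros. apply Rabs_plus_le; [assumption|]. now rewrite Rabs_Ropp. Qed.

Lemma Rabs_cos_le y : Rabs (cos y) <= 1.
Proof. apply Rabs_le. pose proof (COS_bound y). lra. Qed.
Lemma Rabs_sin_le y : Rabs (sin y) <= 1.
Proof. apply Rabs_le. pose proof (SIN_bound y). lra. Qed.

Lemma Rabs_sqr_le x r : Rabs x <= r -> x ^ 2 <= r ^ 2.
Proof. intros H. rewrite <- pow2_abs. apply pow_incr. split; [apply Rabs_pos|assumption]. Qed.

Lemma cub_bound sg u v x r : Rabs sg <= 1 -> Rabs (u x) <= r -> Rabs (v x) <= r ->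
  Rabs (cub sg u v x) <= 4 * r ^ 3.
Proof.
  intros Hs Hu Hv. unfold cub.
  replace (4 * r ^ 3) with (2 * 1 * 1 * (2 * r ^ 2) * r) by ring.
  repeat apply Rabs_mult_le; auto using Rabs_cos_le.
  - rewrite Rabs_pos_eq; lra.
  - apply Rabs_sqr_le in Hu, Hv.
    pose proof (pow2_ge_0 (u x)). pose proof (pow2_ge_0 (v x)).
    rewrite Rabs_pos_eq; lra.
Qed.

Lemma cub_lip sg u v u' v' x r d : Rabs sg <= 1 ->
  Rabs (u x) <= r -> Rabs (v x) <= r -> Rabs (u' x) <= r -> Rabs (v' x) <= r ->
  Rabs (u x - u' x) <= d -> Rabs (v x - v' x) <= d ->
  Rabs (cub sg u v x - cub sg u' v' x) <= 12 * r ^ 2 * d.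
Proof.
  intros Hs Hu Hv Hu' Hv' Hdu Hdv. unfold cub.
  set (a := u x) in *. set (b := v x) in *. set (a' := u' x) in *. set (b' := v' x) in *.
  replace (2 * sg * cos (2 * x) * (a ^ 2 + b ^ 2) * a -
           2 * sg * cos (2 * x) * (a' ^ 2 + b' ^ 2) * a')
    with (2 * sg * cos (2 * x) *
      ((a * a + b * b) * (a - a') + ((a - a') * (a + a') + (b - b') * (b + b')) * a')) by ring.
  replace (12 * r ^ 2 * d) with
    (2 * 1 * 1 * ((r * r + r * r) * d + (d * (r + r) + d * (r + r)) * r)) by ring.
  repeat first [apply Rabs_mult_le | apply Rabs_plus_le | apply Rabs_minus_le
    | apply Rabs_cos_le | assumption].
  all: try (rewrite Rabs_pos_eq; lra).
Qed.

Lemma MVT_bound (F dF : R -> R) T delta :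
  (forall t, Rabs t <= T -> is_derive F t (dF t)) ->
  (forall t, Rabs t <= T -> Rabs (dF t) <= delta) ->
  forall t, Rabs t <= T -> Rabs (F t - F 0) <= delta * Rabs t.
Proof.
  intros Hd Hb t Ht.
  assert (Hin : forall c, Rmin 0 t <= c <= Rmax 0 t -> Rabs c <= T).
  { intros c Hc. eapply Rle_trans; [|exact Ht].
    unfold Rabs, Rmin, Rmax in *. destruct (Rle_dec 0 t), (Rcase_abs c), (Rcase_abs t); lra. }
  destruct (MVT_gen F 0 t dF) as (c & Hc & E).
  - intros x Hx. apply Hd, Hin. lra.
  - intros x Hx. apply continuity_pt_filterlim, (ex_derive_continuous F).
    eexists. apply Hd, Hin, Hx.
  - rewrite E, Rminus_0_r, Rabs_mult. apply Rmult_le_compat_r; [apply Rabs_pos|].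
    apply Hb, Hin, Hc.
Qed.

Lemma Gronwall_pos (Y dY : R -> R) C delta T : 0 < C -> 0 <= delta ->
  (forall t, 0 <= t <= T -> is_derive Y t (dY t)) ->
  (forall t, 0 <= t <= T -> dY t <= C * Y t + delta) -> Y 0 = 0 ->
  forall t, 0 <= t <= T -> Y t <= delta / C * exp (C * t).
Proof.
  intros HC Hd HY Hb H0 t Ht.
  (* Integrating factor: the differential inequality says exactly that this function is
     nonincreasing. *)
  set (Z := fun t => (Y t + delta / C) * exp (- (C * t))).
  set (dZ := fun t => (dY t - C * Y t - delta) * exp (- (C * t))).
  destruct (MVT_gen Z 0 t dZ) as (c & Hc & E).
  - intros x Hx. rewrite Rmin_left, Rmax_right in Hx by lra.
    assert (Hx' := HY x ltac:(lra)). unfold Z, dZ. auto_derive.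
    + exists (dY x). exact Hx'.
    + change (fun x0 => Y x0) with Y. rewrite (is_derive_unique _ _ _ Hx'). field. lra.
  - intros x Hx. rewrite Rmin_left, Rmax_right in Hx by lra.
    apply continuity_pt_filterlim, (ex_derive_continuous Z).
    assert (Hx' := HY x ltac:(lra)). unfold Z. auto_derive. exists (dY x). exact Hx'.
  - rewrite Rmin_left, Rmax_right in Hc by lra.
    assert (dZ c <= 0).
    { unfold dZ. specialize (Hb c ltac:(lra)). pose proof (exp_pos (- (C * c))). nra. }
    assert (Z t <= delta / C).
    { assert (Z0 : Z 0 = delta / C).
      { unfold Z. rewrite H0, Rmult_0_r, Ropp_0, exp_0. ring. }
      assert (dZ c * (t - 0) <= 0) by nra. lra. }
    unfold Z in H1. rewrite exp_Ropp in H1. pose proof (exp_pos (C * t)).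
    assert ((Y t + delta / C) * / exp (C * t) * exp (C * t) <= delta / C * exp (C * t))
      by (apply Rmult_le_compat_r; lra).
    rewrite Rmult_assoc, Rinv_l in H3 by lra.
    assert (0 <= delta / C) by (apply Rmult_le_pos; [lra|apply Rlt_le, Rinv_0_lt_compat; lra]).
    lra.
Qed.

(** Negative times follow by reflecting time, which is why the bound is on the absolute value of the
    derivative. *)
Lemma Gronwall (Y dY : R -> R) C delta T : 0 < C -> 0 <= delta ->
  (forall t, Rabs t <= T -> is_derive Y t (dY t)) ->
  (forall t, Rabs t <= T -> Rabs (dY t) <= C * Y t + delta) -> Y 0 = 0 ->
  forall t, Rabs t <= T -> Y t <= delta / C * exp (C * T).
Proof.
  intros HC Hd HY Hb H0 t Ht.
  assert (0 <= delta / C) by (apply Rmult_le_pos; [lra|apply Rlt_le, Rinv_0_lt_compat; lra]).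
  apply Rle_trans with (delta / C * exp (C * Rabs t)).
  2:{ apply Rmult_le_compat_l; [assumption|].
      assert (C * Rabs t <= C * T) by (apply Rmult_le_compat_l; lra).
      destruct H1 as [H1|H1]; [apply Rlt_le, exp_increasing, H1|rewrite H1; lra]. }
  destruct (Rle_dec 0 t) as [Hp|Hn].
  - rewrite (Rabs_pos_eq t) in * by assumption.
    apply (Gronwall_pos Y dY C delta T); auto; try lra.
    + intros u Hu. apply HY. rewrite Rabs_pos_eq; lra.
    + intros u Hu. eapply Rle_trans; [apply Rle_abs|]. apply Hb. rewrite Rabs_pos_eq; lra.
  - rewrite (Rabs_left t) in * by lra. replace (Y t) with (Y (- - t)) by (f_equal; ring).
    apply (Gronwall_pos (fun t => Y (- t)) (fun t => - dY (- t)) C delta T); auto; try lra.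
    + intros u Hu. assert (Hu' : is_derive Y (- u) (dY (- u))).
      { apply HY. rewrite Rabs_Ropp, Rabs_pos_eq; lra. }
      auto_derive; [exists (dY (- u)); exact Hu'|].
      change (fun x0 => Y x0) with Y. rewrite (is_derive_unique _ _ _ Hu'). ring.
    + intros u Hu. eapply Rle_trans; [apply Rle_abs|]. rewrite Rabs_Ropp. apply Hb.
      rewrite Rabs_Ropp, Rabs_pos_eq; lra.
    + now rewrite Ropp_0.
Qed.

(** One radius for the solution and all its truncations on a compact time interval. The bound for
    dominated coefficient families is there for the even and odd parts. The tail [d ^ 2 / 5] is the
    one for which the embedding bound sqrt(5 tau) equals [d]. *)
Lemma uniform_bounds sg f g A B T : h1_solution sg f g A B ->
  exists r, 0 < r /\
    (forall t, Rabs t <= T ->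
       (forall n, SZ n (h1 (A t) (B t)) <= r) /\
       (forall n a b x, (forall k, h1 a b k <= h1 (A t) (B t) k) ->
          Rabs (TA n a b x) <= r /\ Rabs (TB n a b x) <= r) /\
       (forall x, - PI < x < PI -> Rabs (f t x) <= r /\ Rabs (g t x) <= r)) /\
    (forall d, 0 < d -> exists n0, forall t n, Rabs t <= T -> (n0 <= n)%nat ->
       (forall x, - PI < x < PI ->
          Rabs (f t x - TA n (A t) (B t) x) <= d /\ Rabs (g t x - TB n (A t) (B t) x) <= d) /\
       (forall m, (n <= m)%nat ->
          SZ m (h1 (A t) (B t)) - SZ n (h1 (A t) (B t)) <= d ^ 2 / 5) /\
       (forall m x, (n <= m)%nat ->
          Rabs (TA m (A t) (B t) x - TA n (A t) (B t) x) <= d /\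
          Rabs (TB m (A t) (B t) x - TB n (A t) (B t) x) <= d)).
Proof.
  intros Hsol.
  assert (Hinv : forall t n tau, (forall m, (n <= m)%nat ->
     SZ m (h1 (A t) (B t)) - SZ n (h1 (A t) (B t)) <= tau) ->
     forall x, - PI < x < PI ->
     Rabs (f t x - TA n (A t) (B t) x) <= sqrt (5 * tau) /\
     Rabs (g t x - TB n (A t) (B t) x) <= sqrt (5 * tau)).
  { intros t n tau Htau x Hx.
    assert (E : forall m, SZ m (h1 (A t) (B t)) = SZ m (h1 (fre (f t) (g t)) (fim (f t) (g t)))).
    { intros m. apply SZ_ext. intros k _.
      apply h1_ext; [apply (sol_re _ _ _ _ _ Hsol)|apply (sol_im _ _ _ _ _ Hsol)]. }
    destruct (fourier_inversion (f t) (g t) n tau) with (x := x) as [H1 H2]; auto.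
    - apply (sol_cont_re _ _ _ _ _ Hsol).
    - apply (sol_cont_im _ _ _ _ _ Hsol).
    - intros m Hm. rewrite <- !E. auto.
    - rewrite (TA_ext n (A t) (B t) (fre (f t) (g t)) (fim (f t) (g t))).
      rewrite (TB_ext n (A t) (B t) (fre (f t) (g t)) (fim (f t) (g t))).
      + auto.
      + intros k _. split; [apply (sol_re _ _ _ _ _ Hsol)|apply (sol_im _ _ _ _ _ Hsol)].
      + intros k _. split; [apply (sol_re _ _ _ _ _ Hsol)|apply (sol_im _ _ _ _ _ Hsol)]. }
  destruct (uniform_tail sg f g A B T 1 Hsol Rlt_0_1) as (n1 & K & HK).
  (* The number sqrt(5 K) bounds every truncation and also the distance from the solution to its
     mode 0; the sum of the two bounds the solution. *)
  exists (1 + Rabs K + 2 * sqrt (5 * K)).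
  pose proof (sqrt_pos (5 * K)). pose proof (Rabs_pos K). pose proof (Rle_abs K).
  split; [lra|]. split.
  - intros t Ht. destruct (HK t Ht) as [HK1 _]. split; [|split].
    + intros n. specialize (HK1 n). lra.
    + intros n a b x Hab.
      destruct (sup_T_abs n a b x K) as [S1 S2]; [|lra].
      eapply Rle_trans; [apply SZ_le; intros k _; apply Hab|apply HK1].
    + intros x Hx.
      destruct (Hinv t 0%nat K) with (x := x) as [I1 I2]; auto.
      { intros m _. specialize (HK1 m).
        assert (0 <= SZ 0 (h1 (A t) (B t))) by apply h1_nonneg. lra. }
      destruct (sup_T_abs 0 (A t) (B t) x K (HK1 0%nat)) as [S1 S2].
      split; eapply Rle_trans.
      * replace (f t x) with ((f t x - TA 0 (A t) (B t) x) + TA 0 (A t) (B t) x) by ring.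
        apply Rabs_plus_le; eassumption.
      * lra.
      * replace (g t x) with ((g t x - TB 0 (A t) (B t) x) + TB 0 (A t) (B t) x) by ring.
        apply Rabs_plus_le; eassumption.
      * lra.
  - intros d Hd. assert (0 < d ^ 2) by now apply pow_lt.
    assert (Hsq : sqrt (5 * (d ^ 2 / 5)) = d).
    { replace (5 * (d ^ 2 / 5)) with (d ^ 2) by field. apply sqrt_pow2. lra. }
    destruct (uniform_tail sg f g A B T (d ^ 2 / 5) Hsol ltac:(lra)) as (n0 & K' & HT).
    exists n0. intros t n Ht Hn. destruct (HT t Ht) as [_ Htail]. rewrite <- Hsq.
    split; [|split].
    + apply Hinv. intros m Hm. apply Htail. lia.
    + intros m Hm. rewrite Hsq. apply Htail. lia.
    + intros m x Hm. apply T_tail; [assumption|]. apply Htail. lia.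
Qed.

(** This is [mean_dual] for the coefficients multiplied by i, which turns ([TA], [TB]) into (-[TB],
    [TA]). *)
Lemma pairing_im n a b P Q : cont P -> cont Q ->
  SZ n (fun k => a k * fim P Q k - b k * fre P Q k) =
  mean (fun x => Q x * TA n a b x - P x * TB n a b x).
Proof.
  intros HP HQ.
  rewrite (SZ_ext n _ (fun k => (- b k) * fre P Q k + a k * fim P Q k)) by (intros; ring).
  rewrite (mean_dual n (fun k => - b k) a) by assumption. apply mean_ext. intros x.
  replace (TA n (fun k => - b k) a x) with (- TB n a b x).
  replace (TB n (fun k => - b k) a x) with (TA n a b x).
  - ring.
  - apply SZ_ext. intros. ring.
  - unfold TA, TB. rewrite <- (Rmult_1_l (SZ n (fun k => - b k * _ - _))).
    replace (- SZ n (fun k => a k * sin (IZR k * x) + b k * cos (IZR k * x))) with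
      ((-1) * SZ n (fun k => a k * sin (IZR k * x) + b k * cos (IZR k * x))) by ring.
    rewrite Rmult_1_l, <- SZ_scal. apply SZ_ext. intros. ring.
Qed.

Definition msq (a b : Z -> R) (k : Z) : R := a k ^ 2 + b k ^ 2.

Lemma msq_nonneg a b k : 0 <= msq a b k.
Proof. unfold msq. pose proof (pow2_ge_0 (a k)). pose proof (pow2_ge_0 (b k)). lra. Qed.

Lemma is_derive_weighted_sqr (p q : R -> R) w t dp dq :
  is_derive p t dp -> is_derive q t dq ->
  is_derive (fun t => w * (p t ^ 2 + q t ^ 2)) t (2 * (w * (p t * dp + q t * dq))).
Proof.
  intros Dp Dq. auto_derive; [split; [exists dp; exact Dp|split; [exists dq; exact Dq|auto]]|].
  change (fun x => p x) with p. change (fun x => q x) with q.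
  rewrite (is_derive_unique _ _ _ Dp), (is_derive_unique _ _ _ Dq). ring.
Qed.

(** The linear part of the equation rotates each coefficient, so it drops out whatever the weight.
    The weights used are 1 for the mass, the indicator of even modes for parity, and k^2 for the
    energy. *)
Lemma weighted_mass_derive sg f g A B (w : Z -> R) n t : h1_solution sg f g A B ->
  is_derive (fun t => SZ n (fun k => w k * msq (A t) (B t) k)) t
    (2 * SZ n (fun k =>
       (w k * A t k) * fim (cub sg (f t) (g t)) (cub sg (g t) (f t)) k -
       (w k * B t k) * fre (cub sg (f t) (g t)) (cub sg (g t) (f t)) k)).
Proof.
  intros Hsol. rewrite <- SZ_scal.
  apply (is_derive_SZ n (fun k t => w k * msq (A t) (B t) k)). intros k _.
  pose proof (is_derive_weighted_sqr _ _ (w k) _ _ _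
    (sol_derive_re _ _ _ _ _ Hsol t k) (sol_derive_im _ _ _ _ _ Hsol t k)) as D.
  match type of D with is_derive _ _ ?l => match goal with |- is_derive _ _ ?l' =>
    replace l' with l by ring end end.
  exact D.
Qed.

(** The cubic term is a real multiple of the solution, so its pairing with the solution itself has
    no flux. The flux of a truncation is therefore bounded by the sup distance between the solution
    and the truncation. *)
Lemma mass_conservation sg f g A B T eta : Rabs sg <= 1 -> h1_solution sg f g A B ->
  0 < eta -> exists n0, forall t n, Rabs t <= T -> (n0 <= n)%nat ->
  Rabs (SZ n (msq (A t) (B t)) - SZ n (msq (A 0) (B 0))) <= eta.
Proof.
  intros Hs Hsol Heta.
  destruct (uniform_bounds sg f g A B T Hsol) as (r & Hr & Hbd & Happ).
  set (C := 16 * r ^ 3 * Rabs T).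
  assert (HC : 0 <= C).
  { unfold C. apply Rmult_le_pos; [|apply Rabs_pos]. pose proof (pow_lt r 3 Hr). lra. }
  destruct (Happ (eta / (C + 1))) as [n0 Hn0]; [apply Rdiv_lt_0_compat; lra|].
  set (d := eta / (C + 1)) in *.
  exists n0. intros t n Ht Hn.
  assert (HM : forall t, SZ n (msq (A t) (B t)) = SZ n (fun k => 1 * msq (A t) (B t) k)).
  { intros. apply SZ_ext. intros. ring. }
  rewrite !HM.
  eapply Rle_trans.
  { eapply (MVT_bound (fun t => SZ n (fun k => 1 * msq (A t) (B t) k)) _ T (16 * r ^ 3 * d));
      [intros u _; apply (weighted_mass_derive sg f g A B (fun _ => 1) n u Hsol)
      |clear t Ht; cbv beta|exact Ht].
    intros t Ht. destruct (Hbd t Ht) as (_ & _ & Hfg).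
      destruct (Hn0 t n Ht Hn) as (Hfn & _).
      pose proof (sol_cont_re _ _ _ _ _ Hsol t) as Cf.
      pose proof (sol_cont_im _ _ _ _ _ Hsol t) as Cg.
      set (P := cub sg (f t) (g t)). set (Q := cub sg (g t) (f t)).
      assert (CP : cont P) by (apply cont_cub; auto).
      assert (CQ : cont Q) by (apply cont_cub; auto).
      rewrite (SZ_ext n _ (fun k => A t k * fim P Q k - B t k * fre P Q k)) by
        (intros; ring).
      rewrite pairing_im by assumption.
      rewrite Rabs_mult, (Rabs_pos_eq 2) by lra.
      replace (16 * r ^ 3 * d) with (2 * ((4 * r ^ 3) * d + (4 * r ^ 3) * d)) by ring.
      apply Rmult_le_compat_l; [lra|].
      pose proof (cont_TA n (A t) (B t)) as CA. pose proof (cont_TB n (A t) (B t)) as CB.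
      apply Rabs_mean_bound; [cont_tac|].
      intros x Hx. destruct (Hfg x Hx) as [F1 F2]. destruct (Hfn x Hx) as [G1 G2].
      replace (Q x * TA n (A t) (B t) x - P x * TB n (A t) (B t) x) with
        (P x * (g t x - TB n (A t) (B t) x) - Q x * (f t x - TA n (A t) (B t) x))
        by (unfold P, Q, cub; ring).
      apply Rabs_minus_le; apply Rabs_mult_le; auto; apply cub_bound; auto. }
  assert (Rabs t <= Rabs T) by (eapply Rle_trans; [exact Ht|apply Rle_abs]).
  assert (0 < d) by (apply Rdiv_lt_0_compat; lra).
  apply Rle_trans with (C * d).
  - unfold C. replace (16 * r ^ 3 * Rabs T * d) with (16 * r ^ 3 * d * Rabs T) by ring.
    apply Rmult_le_compat_l; [|assumption]. pose proof (pow_lt r 3 Hr).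
    apply Rmult_le_pos; lra.
  - assert (d * (C + 1) = eta) by (unfold d; field; lra). nra.
Qed.

(** * Vanishing of the even modes *)

Definition even_part (c : Z -> R) (k : Z) : R := if Z.even k then c k else 0.
Definition odd_part (c : Z -> R) (k : Z) : R := if Z.even k then 0 else c k.

Lemma h1_even_part a b k : h1 (even_part a) (even_part b) k <= h1 a b k.
Proof.
  pose proof (h1_nonneg a b k). unfold h1, even_part in *. destruct (Z.even k); [lra|].
  simpl in *. lra.
Qed.
Lemma h1_odd_part a b k : h1 (odd_part a) (odd_part b) k <= h1 a b k.
Proof.
  pose proof (h1_nonneg a b k). unfold h1, odd_part in *. destruct (Z.even k); [|lra].
  simpl in *. lra.
Qed.

Lemma odd_shift k x : Z.even k = false ->
  cos (IZR k * (x + PI)) = - cos (IZR k * x) /\ sin (IZR k * (x + PI)) = - sin (IZR k * x).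
Proof.
  intros Hk.
  assert (Hc : cos (IZR k * PI) = -1).
  { pose proof (Zeven_odd_dec k) as [E|O].
    - apply Zeven_bool_iff in E. congruence.
    - destruct (Zodd_ex k O) as [q ->].
      rewrite plus_IZR, mult_IZR.
      replace ((IZR 2 * IZR q + IZR 1) * PI) with (2 * (IZR q * PI) + PI) by ring.
      rewrite neg_cos, cos_2a_sin, sin_IZR_PI. ring. }
  rewrite Rmult_plus_distr_l, cos_plus, sin_plus, sin_IZR_PI, Hc. split; ring.
Qed.

Lemma TA_odd_shift n a b x :
  TA n (odd_part a) (odd_part b) (x + PI) = - TA n (odd_part a) (odd_part b) x.
Proof.
  rewrite <- (Rmult_1_l (TA _ _ _ x)), Ropp_mult_distr_l. unfold TA. rewrite <- SZ_scal.
  apply SZ_ext. intros k _. unfold odd_part. destruct (Z.even k) eqn:E; [ring|].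
  destruct (odd_shift k x E) as [-> ->]. ring.
Qed.
Lemma TB_odd_shift n a b x :
  TB n (odd_part a) (odd_part b) (x + PI) = - TB n (odd_part a) (odd_part b) x.
Proof.
  rewrite <- (Rmult_1_l (TB _ _ _ x)), Ropp_mult_distr_l. unfold TB. rewrite <- SZ_scal.
  apply SZ_ext. intros k _. unfold odd_part. destruct (Z.even k) eqn:E; [ring|].
  destruct (odd_shift k x E) as [-> ->]. ring.
Qed.

(** Write e^{ikx} as e^{i(k+1)x} times e^{-ix}: both factors change sign under the shift by pi. *)
Lemma TA_even_shift n a b x :
  TA n (even_part a) (even_part b) (x + PI) = TA n (even_part a) (even_part b) x.
Proof.
  apply SZ_ext. intros k _. unfold even_part. destruct (Z.even k) eqn:E; [|ring].
  replace (IZR k * (x + PI)) with (IZR (k + 1) * (x + PI) - (x + PI))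
    by (rewrite plus_IZR; ring).
  rewrite cos_minus, sin_minus.
  destruct (odd_shift (k + 1) x) as [-> ->].
  { rewrite Z.even_add, E. reflexivity. }
  rewrite neg_cos, neg_sin.
  replace (IZR k * x) with (IZR (k + 1) * x - x) by (rewrite plus_IZR; ring).
  rewrite cos_minus, sin_minus. ring.
Qed.
Lemma TB_even_shift n a b x :
  TB n (even_part a) (even_part b) (x + PI) = TB n (even_part a) (even_part b) x.
Proof.
  apply SZ_ext. intros k _. unfold even_part. destruct (Z.even k) eqn:E; [|ring].
  replace (IZR k * (x + PI)) with (IZR (k + 1) * (x + PI) - (x + PI))
    by (rewrite plus_IZR; ring).
  rewrite cos_minus, sin_minus.
  destruct (odd_shift (k + 1) x) as [-> ->].
  { rewrite Z.even_add, E. reflexivity. }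
  rewrite neg_cos, neg_sin.
  replace (IZR k * x) with (IZR (k + 1) * x - x) by (rewrite plus_IZR; ring).
  rewrite cos_minus, sin_minus. ring.
Qed.

Lemma mean_antiperiodic h : cont h -> (forall x, h (x + PI) = - h x) -> mean h = 0.
Proof.
  intros Hh H. unfold mean.
  rewrite <- (RInt_Chasles h (- PI) 0 PI) by now apply cont_ex_RInt.
  assert (E : RInt h 0 PI = - RInt h (- PI) 0).
  { pose proof (RInt_comp_lin h 1 PI (- PI) 0) as E.
    replace (1 * - PI + PI) with 0 in E by ring. replace (1 * 0 + PI) with PI in E by ring.
    rewrite <- E by now apply cont_ex_RInt.
    rewrite <- (RInt_opp h) by now apply cont_ex_RInt.
    apply RInt_ext. intros x _. unfold scal; simpl. unfold mult, opp; simpl.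
    rewrite !Rmult_1_l. apply H. }
  rewrite E. unfold plus; simpl. ring.
Qed.

Lemma TA_even_odd n a b x :
  TA n a b x = TA n (even_part a) (even_part b) x + TA n (odd_part a) (odd_part b) x.
Proof.
  unfold TA. rewrite <- SZ_plus. apply SZ_ext. intros k _. unfold even_part, odd_part.
  destruct (Z.even k); ring.
Qed.
Lemma TB_even_odd n a b x :
  TB n a b x = TB n (even_part a) (even_part b) x + TB n (odd_part a) (odd_part b) x.
Proof.
  unfold TB. rewrite <- SZ_plus. apply SZ_ext. intros k _. unfold even_part, odd_part.
  destruct (Z.even k); ring.
Qed.

(** The part of the flux that is linear in the even modes is antiperiodic with
    antiperiod [pi], hence the bound is quadratic in them. *)
Lemma even_flux_bound sg n a b r : Rabs sg <= 1 ->
  (forall x, Rabs (TA n (even_part a) (even_part b) x) <= r /\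
             Rabs (TB n (even_part a) (even_part b) x) <= r) ->
  (forall x, Rabs (TA n (odd_part a) (odd_part b) x) <= r /\
             Rabs (TB n (odd_part a) (odd_part b) x) <= r) ->
  Rabs (mean (fun x =>
    cub sg (TB n a b) (TA n a b) x * TA n (even_part a) (even_part b) x -
    cub sg (TA n a b) (TB n a b) x * TB n (even_part a) (even_part b) x)) <=
  12 * r ^ 2 * SZ n (msq (even_part a) (even_part b)).
Proof.
  intros Hs He Ho.
  set (e1 := TA n (even_part a) (even_part b)) in *.
  set (e2 := TB n (even_part a) (even_part b)) in *.
  set (o1 := TA n (odd_part a) (odd_part b)) in *.
  set (o2 := TB n (odd_part a) (odd_part b)) in *.
  assert (C1 : cont e1) by apply cont_TA. assert (C2 : cont e2) by apply cont_TB.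
  assert (C3 : cont o1) by apply cont_TA. assert (C4 : cont o2) by apply cont_TB.
  (* The products of [e1] and [e2] cancel, so the flux carries the factor o2 e1 - o1 e2. [L] takes
     the part linear in the even modes, [G] all that is at least quadratic. *)
  set (G := fun x => 2 * sg * cos (2 * x) *
    ((e1 x ^ 2 + e2 x ^ 2 + 2 * (e1 x * o1 x + e2 x * o2 x)) * (o2 x * e1 x - o1 x * e2 x))).
  set (L := fun x => 2 * sg * cos (2 * x) * ((o1 x ^ 2 + o2 x ^ 2) *
    (o2 x * e1 x - o1 x * e2 x))).
  assert (CG : cont G) by (unfold G; cont_tac).
  assert (CL : cont L) by (unfold L; cont_tac).
  rewrite (mean_ext _ (fun x => G x + L x)).
  2:{ intros x. unfold cub, G, L. rewrite (TA_even_odd n a b x), (TB_even_odd n a b x).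
      fold e1 e2 o1 o2. ring. }
  rewrite mean_plus by assumption.
  rewrite (mean_antiperiodic L), Rplus_0_r.
  - unfold msq. rewrite <- Parseval. fold e1 e2. rewrite <- mean_scal by cont_tac.
    apply Rabs_mean_le; [assumption|cont_tac|]. intros x _. unfold G.
    destruct (He x) as [E1 E2]. destruct (Ho x) as [O1 O2].
    assert (Hr : 0 <= r) by (eapply Rle_trans; [apply Rabs_pos|exact E1]).
    set (p := Rabs (e1 x)). set (q := Rabs (e2 x)).
    assert (Hp : 0 <= p) by apply Rabs_pos. assert (Hq : 0 <= q) by apply Rabs_pos.
    apply Rle_trans with (2 * 1 * 1 * ((3 * r * (p + q)) * (r * (p + q)))).
    + apply Rabs_mult_le.
      * repeat apply Rabs_mult_le; auto using Rabs_cos_le. rewrite Rabs_pos_eq; lra.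
      * apply Rabs_mult_le.
        -- replace (3 * r * (p + q)) with (r * p + r * q + 2 * (p * r + q * r)) by ring.
           apply Rabs_plus_le; [apply Rabs_plus_le|].
           ++ simpl. rewrite Rmult_1_r. apply Rabs_mult_le; [exact E1|apply Rle_refl].
           ++ simpl. rewrite Rmult_1_r. apply Rabs_mult_le; [exact E2|apply Rle_refl].
           ++ apply Rabs_mult_le; [rewrite Rabs_pos_eq; lra|].
              apply Rabs_plus_le; apply Rabs_mult_le; auto; apply Rle_refl.
        -- rewrite Rmult_plus_distr_l.
           apply Rabs_minus_le; apply Rabs_mult_le; auto; apply Rle_refl.
    + rewrite <- (pow2_abs (e1 x)), <- (pow2_abs (e2 x)). fold p q.
      replace (2 * 1 * 1 * (3 * r * (p + q) * (r * (p + q))))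
        with (6 * r ^ 2 * (p + q) ^ 2) by ring.
      replace (12 * r ^ 2 * (p ^ 2 + q ^ 2)) with (6 * r ^ 2 * (2 * (p ^ 2 + q ^ 2))) by ring.
      apply Rmult_le_compat_l; [pose proof (pow2_ge_0 r); lra|].
      pose proof (pow2_ge_0 (p - q)). nra.
  - assumption.
  - intros x. unfold L, e1, e2, o1, o2.
    rewrite TA_odd_shift, TB_odd_shift, TA_even_shift, TB_even_shift.
    replace (2 * (x + PI)) with (2 * x + 2 * PI) by ring.
    rewrite cos_plus, cos_2PI, sin_2PI. ring.
Qed.

(** Instead of comparing the solution with its shifted copy, Gronwall is applied to the truncated
    mass of the even modes. Its derivative is bounded by a multiple of that mass plus an error from
    the truncation, and this error is arbitrarily small. *)
Lemma even_modes_vanish sg f g A B : Rabs sg <= 1 -> h1_solution sg f g A B ->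
  (forall k, Z.even k = true -> A 0 k = 0 /\ B 0 k = 0) ->
  forall t k, Z.even k = true -> A t k = 0 /\ B t k = 0.
Proof.
  intros Hs Hsol Hinit t0 k0 Hk0. set (T := Rabs t0).
  destruct (uniform_bounds sg f g A B T Hsol) as (r & Hr & Hbd & Happ).
  assert (Hr2 : 0 < r ^ 2) by now apply pow_lt.
  assert (Hr3 : 0 < r ^ 3) by now apply pow_lt.
  set (C := 24 * r ^ 2).
  set (w := fun k => if Z.even k then 1 else 0).
  assert (HY : forall n t, SZ n (fun k => w k * msq (A t) (B t) k) =
    SZ n (msq (even_part (A t)) (even_part (B t)))).
  { intros. apply SZ_ext. intros k _. unfold w, msq, even_part. destruct (Z.even k); ring. }
  assert (Hsmall : forall eta, 0 < eta -> msq (A t0) (B t0) k0 <= eta).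
  { intros eta Heta. set (E := 48 * r ^ 3 / C * exp (C * T)).
    assert (HE : 0 < E).
    { unfold E, C. apply Rmult_lt_0_compat; [|apply exp_pos]. apply Rdiv_lt_0_compat; lra. }
    destruct (Happ (eta / E)) as [n0 Hn0]; [now apply Rdiv_lt_0_compat|].
    set (d := eta / E) in *. assert (Hd : 0 < d) by now apply Rdiv_lt_0_compat.
    set (n := Nat.max n0 (Z.abs_nat k0)).
    apply Rle_trans with (SZ n (fun k => w k * msq (A t0) (B t0) k)).
    { eapply Rle_trans; [|apply (SZ_ge_term n (fun k => w k * msq (A t0) (B t0) k) k0)].
      - unfold w. rewrite Hk0. lra.
      - intros k. apply Rmult_le_pos; [unfold w; destruct (Z.even k); lra|apply msq_nonneg].
      - lia. }
    apply Rle_trans with ((48 * r ^ 3 * d) / C * exp (C * T)).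
    2:{ right. replace eta with (E * d) by (unfold d; field; lra). unfold E. unfold Rdiv. ring. }
    eapply (Gronwall (fun t => SZ n (fun k => w k * msq (A t) (B t) k))).
    - unfold C. lra.
    - pose proof (Rmult_lt_0_compat _ _ Hr3 Hd). lra.
    - intros t _. apply (weighted_mass_derive sg f g A B w n t Hsol).
    - intros t Ht. cbv beta. rewrite HY.
      destruct (Hbd t Ht) as (_ & HT & Hfg).
      destruct (Hn0 t n Ht ltac:(lia)) as (Hfn & _).
      pose proof (sol_cont_re _ _ _ _ _ Hsol t) as Cf.
      pose proof (sol_cont_im _ _ _ _ _ Hsol t) as Cg.
      set (P := cub sg (f t) (g t)). set (Q := cub sg (g t) (f t)).
      assert (CP : cont P) by (apply cont_cub; auto).
      assert (CQ : cont Q) by (apply cont_cub; auto).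
      set (a := A t) in *. set (b := B t) in *.
      rewrite (SZ_ext n _ (fun k => even_part a k * fim P Q k - even_part b k * fre P Q k)) by
        (intros k _; unfold w, even_part; destruct (Z.even k); ring).
      rewrite pairing_im by assumption.
      set (e1 := TA n (even_part a) (even_part b)) in *.
      set (e2 := TB n (even_part a) (even_part b)) in *.
      assert (C1 : cont e1) by apply cont_TA. assert (C2 : cont e2) by apply cont_TB.
      set (P' := cub sg (TA n a b) (TB n a b)). set (Q' := cub sg (TB n a b) (TA n a b)).
      assert (CP' : cont P') by (apply cont_cub; auto).
      assert (CQ' : cont Q') by (apply cont_cub; auto).
      assert (He : forall x, Rabs (e1 x) <= r /\ Rabs (e2 x) <= r).
      { intros x. apply HT. intros k. apply h1_even_part. }
      assert (Hflux := even_flux_bound sg n a b r Hs He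
        (fun x => HT n _ _ x (h1_odd_part a b))).
      fold P' Q' e1 e2 in Hflux.
      rewrite (mean_ext _ (fun x => (Q' x * e1 x - P' x * e2 x) +
        ((Q x - Q' x) * e1 x - (P x - P' x) * e2 x))) by (intros; ring).
      rewrite mean_plus by cont_tac.
      rewrite Rabs_mult, (Rabs_pos_eq 2) by lra.
      unfold C. replace (24 * r ^ 2 * SZ n (msq (even_part a) (even_part b)) + 48 * r ^ 3 * d)
        with (2 * (12 * r ^ 2 * SZ n (msq (even_part a) (even_part b)) +
          (12 * r ^ 2 * d * r + 12 * r ^ 2 * d * r))) by ring.
      apply Rmult_le_compat_l; [lra|]. apply Rabs_plus_le; [exact Hflux|].
      apply Rabs_mean_bound; [cont_tac|]. intros x Hx.
      destruct (Hfg x Hx) as [F1 F2]. destruct (Hfn x Hx) as [G1 G2].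
      destruct (HT n a b x (fun k => Rle_refl _)) as [S1 S2]. destruct (He x) as [E1 E2].
      apply Rabs_minus_le; apply Rabs_mult_le; auto; apply cub_lip; auto.
    - apply SZ_zero. intros k _. unfold w, msq. destruct (Z.even k) eqn:Ek; [|ring].
      destruct (Hinit k Ek) as [-> ->]. ring.
    - apply Rle_refl. }
  assert (H0 : msq (A t0) (B t0) k0 <= 0).
  { apply Rnot_lt_le. intros H. specialize (Hsmall (msq (A t0) (B t0) k0 / 2)). lra. }
  unfold msq in H0. pose proof (pow2_ge_0 (A t0 k0)). pose proof (pow2_ge_0 (B t0 k0)).
  split; apply Rsqr_0_uniq; rewrite Rsqr_pow2; lra.
Qed.

(** * Energy *)

(** Finite sums of products [c t * phi x]: the class in which the [t]-derivative
    commutes with [mean]. *)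
Inductive separable (t0 : R) : (R -> R -> R) -> (R -> R) -> Prop :=
| separable_base c dc phi : is_derive c t0 dc -> cont phi ->
    separable t0 (fun t x => c t * phi x) (fun x => dc * phi x)
| separable_plus F dF G dG : separable t0 F dF -> separable t0 G dG ->
    separable t0 (fun t x => F t x + G t x) (fun x => dF x + dG x)
| separable_ext F dF F' dF' : separable t0 F dF ->
    (forall t x, F t x = F' t x) -> (forall x, dF x = dF' x) -> separable t0 F' dF'.

Lemma cont_ext f g : (forall x, f x = g x) -> cont f -> cont g.
Proof. intros E H x. eapply continuous_ext; [exact E|apply H]. Qed.

Lemma separable_mult t0 F dF G dG : separable t0 F dF -> separable t0 G dG ->
  separable t0 (fun t x => F t x * G t x) (fun x => dF x * G t0 x + F t0 x * dG x).
Proof.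
  intros HF HG. induction HF as [c dc phi Hc Hphi| |].
  - induction HG as [c' dc' phi' Hc' Hphi'| |].
    + eapply separable_ext with (F := fun t x => (c t * c' t) * (phi x * phi' x))
        (dF := fun x => (dc * c' t0 + c t0 * dc') * (phi x * phi' x)).
      * apply (separable_base t0 (fun t => c t * c' t)); [|cont_tac].
        apply (is_derive_mult c c'); auto. intros. apply Rmult_comm.
      * intros. ring.
      * intros. ring.
    + eapply separable_ext; [apply (separable_plus _ _ _ _ _ IHHG1 IHHG2)| |];
        intros; simpl; ring.
    + eapply separable_ext; [apply IHHG| |]; intros; simpl; rewrite <- ?H, <- ?H0; ring.
  - eapply separable_ext; [apply (separable_plus _ _ _ _ _ IHHF1 IHHF2)| |];
      intros; simpl; ring.
  - eapply separable_ext; [apply IHHF| |]; intros; simpl; rewrite <- ?H, <- ?H0; ring.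
Qed.

Lemma separable_mean t0 F dF : separable t0 F dF ->
  (forall t, cont (F t)) /\ cont dF /\ is_derive (fun t => mean (F t)) t0 (mean dF).
Proof.
  intros H. induction H as [c dc phi Hc Hphi|F dF G dG _ (C1 & C2 & D) _ (C1' & C2' & D')
    |F dF F' dF' _ (C1 & C2 & D) E1 E2].
  - split; [intros; cont_tac|split; [cont_tac|]]. rewrite mean_scal by assumption.
    apply is_derive_ext with (fun t => mean phi * c t).
    { intros t. rewrite mean_scal by assumption. apply Rmult_comm. }
    rewrite (Rmult_comm dc). apply (is_derive_scal c); assumption.
  - split; [intros; apply (cont_plus (F t) (G t)); auto|split; [cont_tac|]].
    rewrite mean_plus by assumption.
    apply is_derive_ext with (fun t => mean (F t) + mean (G t)).
    { intros t. now rewrite <- mean_plus by auto. }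
    now apply (is_derive_plus (fun t => mean (F t)) (fun t => mean (G t))).
  - split; [|split].
    + intros t. eapply cont_ext; [apply E1|apply C1].
    + eapply cont_ext; [apply E2|apply C2].
    + rewrite (mean_ext dF' dF) by (intros; now rewrite E2).
      apply is_derive_ext with (fun t => mean (F t)); [|assumption].
      intros t. apply mean_ext, E1.
Qed.

Lemma separable_static t0 phi : cont phi -> separable t0 (fun _ => phi) (fun _ => 0).
Proof.
  intros H. eapply separable_ext; [apply (separable_base t0 (fun _ => 1) 0 phi)| |].
  - apply (is_derive_const (V := R_NormedModule) 1 t0).
  - assumption.
  - intros; simpl; ring.
  - intros; simpl; ring.
Qed.

Lemma separable_SZ t0 n (F : Z -> R -> R -> R) dF : (forall k, separable t0 (F k) (dF k)) ->
  separable t0 (fun t x => SZ n (fun k => F k t x)) (fun x => SZ n (fun k => dF k x)).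
Proof.
  intros H. induction n as [|n IH]; [apply (H 0%Z)|].
  eapply separable_ext.
  - apply separable_plus; [exact IH|].
    apply separable_plus; [apply (H (Z.of_nat (S n)))|apply (H (- Z.of_nat (S n))%Z)].
  - reflexivity.
  - reflexivity.
Qed.

Lemma separable_trig t0 (a b : R -> R) da db k : is_derive a t0 da -> is_derive b t0 db ->
  separable t0 (fun t x => a t * cos (k * x) - b t * sin (k * x))
    (fun x => da * cos (k * x) - db * sin (k * x)) /\
  separable t0 (fun t x => a t * sin (k * x) + b t * cos (k * x))
    (fun x => da * sin (k * x) + db * cos (k * x)).
Proof.
  intros Ha Hb. split.
  - eapply separable_ext; [apply separable_plus; [apply (separable_base t0 a da (fun x => cos (k * x)))
      |apply (separable_base t0 b db (fun x => - sin (k * x)))]| |]; auto; cont_tac;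
      intros; simpl; ring.
  - apply separable_plus; apply (separable_base t0); auto; cont_tac.
Qed.

Lemma separable_T sg f g A B t n : h1_solution sg f g A B ->
  exists A' B', (forall k,
    A' k = IZR k ^ 2 * B t k + fim (cub sg (f t) (g t)) (cub sg (g t) (f t)) k /\
    B' k = - (IZR k ^ 2 * A t k + fre (cub sg (f t) (g t)) (cub sg (g t) (f t)) k)) /\
  separable t (fun t => TA n (A t) (B t)) (TA n A' B') /\
  separable t (fun t => TB n (A t) (B t)) (TB n A' B').
Proof.
  intros Hsol.
  set (A' := fun k => IZR k ^ 2 * B t k + fim (cub sg (f t) (g t)) (cub sg (g t) (f t)) k).
  set (B' := fun k => - (IZR k ^ 2 * A t k + fre (cub sg (f t) (g t)) (cub sg (g t) (f t)) k)).
  exists A', B'. split; [now split|].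
  assert (H := fun k => separable_trig t (fun t => A t k) (fun t => B t k) (A' k) (B' k) (IZR k)
    (sol_derive_re _ _ _ _ _ Hsol t k) (sol_derive_im _ _ _ _ _ Hsol t k)).
  split.
  - apply (separable_SZ t n (fun k t x => A t k * cos (IZR k * x) - B t k * sin (IZR k * x))
      (fun k x => A' k * cos (IZR k * x) - B' k * sin (IZR k * x))). intros k. apply H.
  - apply (separable_SZ t n (fun k t x => A t k * sin (IZR k * x) + B t k * cos (IZR k * x))
      (fun k x => A' k * sin (IZR k * x) + B' k * cos (IZR k * x))). intros k. apply H.
Qed.

(** The density whose gradient in (u, v) is twice the cubic term, which makes the equation
    Hamiltonian. *)
Definition potential (sg : R) (u v : R -> R) (x : R) : R :=
  sg * cos (2 * x) * (u x ^ 2 + v x ^ 2) ^ 2.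

Definition kin (a b : Z -> R) (k : Z) : R := IZR k ^ 2 * msq a b k.

Definition energy (sg : R) (n : nat) (a b : Z -> R) : R :=
  SZ n (kin a b) + mean (potential sg (TA n a b) (TB n a b)).

Lemma is_derive_potential sg u v du dv t :
  separable t u du -> separable t v dv ->
  is_derive (fun t => mean (potential sg (u t) (v t))) t
    (mean (fun x => 2 * (du x * cub sg (u t) (v t) x + dv x * cub sg (v t) (u t) x))).
Proof.
  intros Hu Hv.
  pose proof (separable_plus _ _ _ _ _ (separable_mult _ _ _ _ _ Hu Hu)
    (separable_mult _ _ _ _ _ Hv Hv)) as H2.
  pose proof (separable_mult _ _ _ _ _ (separable_static t (fun x => sg * cos (2 * x))
    ltac:(cont_tac)) (separable_mult _ _ _ _ _ H2 H2)) as H.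
  eapply separable_mean, separable_ext; [exact H| |].
  - intros. unfold potential. ring.
  - intros. simpl. unfold cub. ring.
Qed.

(** For the Hamiltonian flow of the truncated system the derivative would be zero. What remains is
    the truncated energy gradient, with components k^2 a + p and k^2 b + q, paired with the modes of
    the cubic term of the solution minus that of its truncation. The factor k^2 is what calls for an
    H^1 bound of [rho] and [kap]. *)
Lemma is_derive_energy sg f g A B t n : h1_solution sg f g A B ->
  is_derive (fun t => energy sg n (A t) (B t)) t
   (2 * SZ n (fun k =>
      let u := TA n (A t) (B t) in let v := TB n (A t) (B t) in
      let p := fre (cub sg u v) (cub sg v u) k in
      let q := fim (cub sg u v) (cub sg v u) k in
      let rho := fre (cub sg (f t) (g t)) (cub sg (g t) (f t)) k - p in
      let kap := fim (cub sg (f t) (g t)) (cub sg (g t) (f t)) k - q in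
      (IZR k ^ 2 * A t k + p) * kap - (IZR k ^ 2 * B t k + q) * rho)).
Proof.
  intros Hsol. cbv zeta.
  destruct (separable_T sg f g A B t n Hsol) as (A' & B' & HAB & HTA & HTB).
  pose proof (is_derive_potential sg _ _ _ _ _ HTA HTB) as D1.
  pose proof (weighted_mass_derive sg f g A B (fun k => IZR k ^ 2) n t Hsol) as D2.
  pose proof (is_derive_plus _ _ _ _ _ D2 D1) as D.
  match type of D with is_derive _ _ ?l => match goal with |- is_derive _ _ ?l' =>
    replace l' with l; [exact D|] end end.
  clear D D1 D2.
  set (u := TA n (A t) (B t)). set (v := TB n (A t) (B t)).
  assert (Cu : cont u) by apply cont_TA. assert (Cv : cont v) by apply cont_TB.
  rewrite (mean_ext _ (fun x => 2 * (cub sg u v x * TA n A' B' x + cub sg v u x * TB n A' B' x)))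
    by (intros; unfold u, v; ring).
  pose proof (cont_cub sg u v Cu Cv). pose proof (cont_cub sg v u Cv Cu).
  pose proof (cont_TA n A' B'). pose proof (cont_TB n A' B').
  rewrite mean_scal by cont_tac. rewrite <- mean_dual by assumption.
  unfold plus; simpl. rewrite <- Rmult_plus_distr_l, <- SZ_plus. f_equal.
  apply SZ_ext. intros k _. destruct (HAB k) as [-> ->]. ring.
Qed.

(** * Truncation error of the cubic term, measured in H^1 *)

Definition dcub (sg : R) (u v du dv : R -> R) (x : R) : R :=
  2 * sg * (-2 * sin (2 * x) * ((u x ^ 2 + v x ^ 2) * u x) +
    cos (2 * x) * ((3 * u x ^ 2 + v x ^ 2) * du x + 2 * u x * v x * dv x)).

Lemma is_derive_cub sg u v du dv x : is_derive u x (du x) -> is_derive v x (dv x) ->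
  is_derive (cub sg u v) x (dcub sg u v du dv x).
Proof.
  intros Hu Hv. unfold cub, dcub.
  auto_derive; [split; [exists (du x); exact Hu|split; [exists (dv x); exact Hv|]]|].
  { split; [exists (du x); exact Hu|auto]. }
  change (fun x => u x) with u. change (fun x => v x) with v.
  rewrite (is_derive_unique _ _ _ Hu), (is_derive_unique _ _ _ Hv). ring.
Qed.

Lemma cont_dcub sg u v du dv : cont u -> cont v -> cont du -> cont dv ->
  cont (dcub sg u v du dv).
Proof.
  intros. change (cont (fun x => dcub sg u v du dv x)). unfold dcub. cont_tac.
Qed.

Lemma mean_derivative_periodic (F dF : R -> R) : (forall x, is_derive F x (dF x)) -> cont dF ->
  F PI = F (- PI) -> mean dF = 0.
Proof.
  intros Hd Hc Hp. unfold mean. rewrite (RInt_deriv F dF Hd Hc), Hp. ring.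
Qed.

Lemma cos_sin_opp_PI k : cos (IZR k * - PI) = cos (IZR k * PI) /\
  sin (IZR k * - PI) = 0 /\ sin (IZR k * PI) = 0.
Proof.
  rewrite <- Ropp_mult_distr_r, cos_neg, sin_neg, sin_IZR_PI. repeat split; ring.
Qed.

(** Integration by parts; periodicity enters through the equal values at the two endpoints. *)
Lemma fourier_derivative (f g df dg : R -> R) k :
  (forall x, is_derive f x (df x)) -> (forall x, is_derive g x (dg x)) ->
  cont df -> cont dg -> f PI = f (- PI) -> g PI = g (- PI) ->
  fre df dg k = - IZR k * fim f g k /\ fim df dg k = IZR k * fre f g k.
Proof.
  intros Hf Hg Cf Cg Pf Pg.
  assert (Cf0 : cont f) by (intros x; apply (ex_derive_continuous f); eexists; apply Hf).
  assert (Cg0 : cont g) by (intros x; apply (ex_derive_continuous g); eexists; apply Hg).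
  destruct (cos_sin_opp_PI k) as (K1 & K2 & K3).
  split.
  - assert (E : mean (fun x => (df x * cos (IZR k * x) + dg x * sin (IZR k * x)) +
      IZR k * (g x * cos (IZR k * x) - f x * sin (IZR k * x))) = 0).
    { apply (mean_derivative_periodic
        (fun x => f x * cos (IZR k * x) + g x * sin (IZR k * x))); [|cont_tac|].
      - intros x. auto_derive.
        + split; [exists (df x); apply Hf|split; [exists (dg x); apply Hg|auto]].
        + change (fun x => f x) with f. change (fun x => g x) with g.
          rewrite (is_derive_unique _ _ _ (Hf x)), (is_derive_unique _ _ _ (Hg x)). ring.
      - rewrite K1, K2, K3, Pf. ring. }
    rewrite mean_plus, mean_scal in E by cont_tac. unfold fre, fim. lra.
  - assert (E : mean (fun x => (dg x * cos (IZR k * x) - df x * sin (IZR k * x)) -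
      IZR k * (f x * cos (IZR k * x) + g x * sin (IZR k * x))) = 0).
    { apply (mean_derivative_periodic
        (fun x => g x * cos (IZR k * x) - f x * sin (IZR k * x))); [|cont_tac|].
      - intros x. auto_derive.
        + split; [exists (dg x); apply Hg|split; [exists (df x); apply Hf|auto]].
        + change (fun x => f x) with f. change (fun x => g x) with g.
          rewrite (is_derive_unique _ _ _ (Hf x)), (is_derive_unique _ _ _ (Hg x)). ring.
      - rewrite K1, K2, K3, Pg. ring. }
    rewrite mean_minus, mean_scal in E by cont_tac. unfold fre, fim. lra.
Qed.

Lemma h1_fourier_bound n (f g df dg : R -> R) :
  (forall x, is_derive f x (df x)) -> (forall x, is_derive g x (dg x)) ->
  cont df -> cont dg -> f PI = f (- PI) -> g PI = g (- PI) ->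
  SZ n (h1 (fre f g) (fim f g)) <=
  mean (fun x => f x ^ 2 + g x ^ 2) + mean (fun x => df x ^ 2 + dg x ^ 2).
Proof.
  intros Hf Hg Cf Cg Pf Pg.
  assert (Cf0 : cont f) by (intros x; apply (ex_derive_continuous f); eexists; apply Hf).
  assert (Cg0 : cont g) by (intros x; apply (ex_derive_continuous g); eexists; apply Hg).
  eapply Rle_trans; [|apply Rplus_le_compat; apply (Bessel n); assumption].
  rewrite <- SZ_plus. apply SZ_le. intros k _.
  destruct (fourier_derivative f g df dg k) as [-> ->]; auto.
  unfold h1. right. ring.
Qed.

(** The functions themselves are close in the sup norm, but their derivatives only in mean square;
    the latter are therefore kept on the right, as squares ready to be averaged. The constants are 3
    * 24^2, 3 * 8^2 * 2 and 3 * 16^2 * 2. *)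
Lemma dcub_diff sg u v du dv u' v' du' dv' x r d : Rabs sg <= 1 ->
  Rabs (u x) <= r -> Rabs (v x) <= r -> Rabs (u' x) <= r -> Rabs (v' x) <= r ->
  Rabs (u x - u' x) <= d -> Rabs (v x - v' x) <= d ->
  (dcub sg u v du dv x - dcub sg u' v' du' dv' x) ^ 2 <=
  1728 * r ^ 4 * d ^ 2 + 384 * r ^ 4 * ((du x - du' x) ^ 2 + (dv x - dv' x) ^ 2) +
  1536 * r ^ 2 * d ^ 2 * (du' x ^ 2 + dv' x ^ 2).
Proof.
  intros Hs Hu Hv Hu' Hv' Hdu Hdv. unfold dcub.
  set (a := u x) in *. set (b := v x) in *. set (a' := u' x) in *. set (b' := v' x) in *.
  set (p := du x). set (q := dv x). set (p' := du' x). set (q' := dv' x).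
  set (P := Rabs (p - p')). set (Q := Rabs (q - q')).
  set (P' := Rabs p'). set (Q' := Rabs q').
  assert (HP : 0 <= P) by apply Rabs_pos. assert (HQ : 0 <= Q) by apply Rabs_pos.
  assert (HP' : 0 <= P') by apply Rabs_pos. assert (HQ' : 0 <= Q') by apply Rabs_pos.
  assert (Hr : 0 <= r) by (eapply Rle_trans; [apply Rabs_pos|exact Hu]).
  assert (Hd : 0 <= d) by (eapply Rle_trans; [apply Rabs_pos|exact Hdu]).
  match goal with |- ?X ^ 2 <= _ => assert (Hab : Rabs X <=
    24 * r ^ 2 * d + 8 * r ^ 2 * (P + Q) + 16 * r * d * (P' + Q')) end.
  { match goal with |- Rabs ?X <= _ => replace X with (2 * sg *
      (2 * sin (2 * x) * - ((a * a + b * b) * (a - a') +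
         ((a - a') * (a + a') + (b - b') * (b + b')) * a') +
       cos (2 * x) * ((3 * (a * a) + b * b) * (p - p') +
         (3 * ((a - a') * (a + a')) + (b - b') * (b + b')) * p' +
         2 * (a * b) * (q - q') + 2 * (a * (b - b') + (a - a') * b') * q'))) by ring end.
    apply Rle_trans with (2 * 1 *
      (2 * 1 * ((r * r + r * r) * d + (d * (r + r) + d * (r + r)) * r) +
       1 * ((3 * (r * r) + r * r) * P + (3 * (d * (r + r)) + d * (r + r)) * P' +
         2 * (r * r) * Q + 2 * (r * d + d * r) * Q'))).
    - repeat first [apply Rabs_mult_le | apply Rabs_plus_le | apply Rabs_minus_le
        | apply Rabs_cos_le | apply Rabs_sin_le | assumption | apply Rle_refl
        | rewrite Rabs_Ropp].
      all: try (rewrite Rabs_pos_eq; lra).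
    - assert (0 <= r * r * Q) by (apply Rmult_le_pos; [nra|assumption]).
      assert (0 <= r * d * Q') by (apply Rmult_le_pos; [nra|assumption]).
      nra. }
  apply Rabs_sqr_le in Hab. eapply Rle_trans; [exact Hab|].
  set (X := 24 * r ^ 2 * d). set (Y := 8 * r ^ 2 * (P + Q)). set (Z := 16 * r * d * (P' + Q')).
  assert (E1 : (X + Y + Z) ^ 2 <= 3 * (X ^ 2 + Y ^ 2 + Z ^ 2)).
  { pose proof (pow2_ge_0 (X - Y)). pose proof (pow2_ge_0 (X - Z)).
    pose proof (pow2_ge_0 (Y - Z)). nra. }
  assert (E2 : (P + Q) ^ 2 <= 2 * ((p - p') ^ 2 + (q - q') ^ 2)).
  { rewrite <- (pow2_abs (p - p')), <- (pow2_abs (q - q')). fold P Q.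
    pose proof (pow2_ge_0 (P - Q)). nra. }
  assert (E3 : (P' + Q') ^ 2 <= 2 * (p' ^ 2 + q' ^ 2)).
  { rewrite <- (pow2_abs p'), <- (pow2_abs q'). fold P' Q'.
    pose proof (pow2_ge_0 (P' - Q')). nra. }
  eapply Rle_trans; [exact E1|].
  replace (3 * (X ^ 2 + Y ^ 2 + Z ^ 2)) with (1728 * r ^ 4 * d ^ 2 +
    192 * r ^ 4 * (P + Q) ^ 2 + 768 * r ^ 2 * d ^ 2 * (P' + Q') ^ 2) by (unfold X, Y, Z; ring).
  assert (0 <= r ^ 4) by now apply pow_le.
  assert (0 <= r ^ 2 * d ^ 2) by (apply Rmult_le_pos; now apply pow_le).
  assert (r ^ 4 * (P + Q) ^ 2 <= r ^ 4 * (2 * ((p - p') ^ 2 + (q - q') ^ 2)))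
    by now apply Rmult_le_compat_l.
  assert (r ^ 2 * d ^ 2 * (P' + Q') ^ 2 <= r ^ 2 * d ^ 2 * (2 * (p' ^ 2 + q' ^ 2)))
    by now apply Rmult_le_compat_l.
  nra.
Qed.

Lemma T_PI n a b : TA n a b PI = TA n a b (- PI) /\ TB n a b PI = TB n a b (- PI).
Proof.
  split; apply SZ_ext; intros k _; destruct (cos_sin_opp_PI k) as (-> & -> & ->); ring.
Qed.

Lemma cub_PI sg n a b :
  cub sg (TA n a b) (TB n a b) PI = cub sg (TA n a b) (TB n a b) (- PI) /\
  cub sg (TB n a b) (TA n a b) PI = cub sg (TB n a b) (TA n a b) (- PI).
Proof.
  destruct (T_PI n a b) as [E1 E2]. unfold cub. rewrite E1, E2.
  replace (2 * - PI) with (- (2 * PI)) by ring. rewrite cos_neg. auto.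
Qed.

Lemma kin_derivative a b k :
  msq (fun k => - IZR k * b k) (fun k => IZR k * a k) k = kin a b k.
Proof. unfold kin, msq. ring. Qed.

Lemma kin_le_h1 a b k : kin a b k <= h1 a b k.
Proof.
  unfold kin, h1. fold (msq a b k). pose proof (msq_nonneg a b k).
  rewrite Rmult_plus_distr_r. lra.
Qed.

Lemma Rsqr_sum_bound x y c : Rabs x <= c -> Rabs y <= c -> x ^ 2 + y ^ 2 <= 2 * c ^ 2.
Proof. intros H1 H2. apply Rabs_sqr_le in H1, H2. lra. Qed.

(** The r^4 part has to exceed 288 + 3456 + 768/5, from the cubic difference and from the first two
    terms of [dcub_diff] taken twice; the r^3 part is 2 * 1536 r^2 times the bound r on the kinetic
    energy. *)
Definition h1_const (r : R) : R := 4800 * r ^ 4 + 3072 * r ^ 3.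

Lemma truncation_difference_h1 sg a b r d n m : Rabs sg <= 1 -> (n <= m)%nat ->
  (forall j x, Rabs (TA j a b x) <= r /\ Rabs (TB j a b x) <= r) ->
  SZ n (h1 a b) <= r ->
  SZ m (h1 a b) - SZ n (h1 a b) <= d ^ 2 / 5 ->
  (forall x, Rabs (TA m a b x - TA n a b x) <= d /\ Rabs (TB m a b x - TB n a b x) <= d) ->
  let G := fun x => cub sg (TA m a b) (TB m a b) x - cub sg (TA n a b) (TB n a b) x in
  let H := fun x => cub sg (TB m a b) (TA m a b) x - cub sg (TB n a b) (TA n a b) x in
  SZ n (h1 (fre G H) (fim G H)) <= h1_const r * d ^ 2.
Proof.
  intros Hs Hnm Hr Hn Htail Hd G H.
  set (da := fun k => - IZR k * b k). set (db := fun k => IZR k * a k).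
  set (dG := fun x =>
    dcub sg (TA m a b) (TB m a b) (TA m da db) (TB m da db) x -
    dcub sg (TA n a b) (TB n a b) (TA n da db) (TB n da db) x).
  set (dH := fun x =>
    dcub sg (TB m a b) (TA m a b) (TB m da db) (TA m da db) x -
    dcub sg (TB n a b) (TA n a b) (TB n da db) (TA n da db) x).
  assert (CdG : cont dG).
  { unfold dG. apply cont_minus; apply cont_dcub; auto. }
  assert (CdH : cont dH).
  { unfold dH. apply cont_minus; apply cont_dcub; auto. }
  assert (DG : forall x, is_derive G x (dG x)).
  { intros x. unfold G, dG.
    apply (is_derive_minus (cub sg (TA m a b) (TB m a b)) (cub sg (TA n a b) (TB n a b)));
      apply is_derive_cub; apply is_derive_TA || apply is_derive_TB. }
  assert (DH : forall x, is_derive H x (dH x)).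
  { intros x. unfold H, dH.
    apply (is_derive_minus (cub sg (TB m a b) (TA m a b)) (cub sg (TB n a b) (TA n a b)));
      apply is_derive_cub; apply is_derive_TA || apply is_derive_TB. }
  assert (CG : cont G) by (intros x; apply (ex_derive_continuous G); eexists; apply DG).
  assert (CH : cont H) by (intros x; apply (ex_derive_continuous H); eexists; apply DH).
  eapply Rle_trans; [apply (h1_fourier_bound n G H dG dH); auto|].
  { unfold G. now rewrite (proj1 (cub_PI sg m a b)), (proj1 (cub_PI sg n a b)). }
  { unfold H. now rewrite (proj2 (cub_PI sg m a b)), (proj2 (cub_PI sg n a b)). }
  assert (Hr0 : 0 <= r).
  { eapply Rle_trans; [apply Rabs_pos|apply (proj1 (Hr 0%nat 0))]. }
  assert (M1 : mean (fun x => G x ^ 2 + H x ^ 2) <= 2 * (12 * r ^ 2 * d) ^ 2).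
  { rewrite <- (mean_const (2 * _)). apply mean_le; cont_tac. intros x _.
    destruct (Hr m x) as [U1 U2]. destruct (Hr n x) as [V1 V2]. destruct (Hd x) as [D1 D2].
    apply Rsqr_sum_bound; apply cub_lip; auto. }
  pose proof (cont_TA m da db) as C1. pose proof (cont_TB m da db) as C2.
  pose proof (cont_TA n da db) as C3. pose proof (cont_TB n da db) as C4.
  set (W := fun x => (TA m da db x - TA n da db x) ^ 2 + (TB m da db x - TB n da db x) ^ 2).
  set (V := fun x => TA n da db x ^ 2 + TB n da db x ^ 2).
  assert (CW : cont W) by (unfold W; cont_tac).
  assert (CV : cont V) by (unfold V; cont_tac).
  (* By Parseval the mean of [W] is the kinetic energy of the modes n < |k| <= m, hence at most
     their H^1 tail. *)
  assert (HW : mean W <= d ^ 2 / 5).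
  { rewrite (mean_ext W (fun x => TA m (mask n da) (mask n db) x ^ 2 +
      TB m (mask n da) (mask n db) x ^ 2)).
    2:{ intros x. unfold W. now rewrite TA_mask, TB_mask. }
    rewrite Parseval. eapply Rle_trans; [|exact Htail]. rewrite <- SZ_mask by assumption.
    apply SZ_le. intros k _. pose proof (kin_le_h1 a b k) as K.
    rewrite <- kin_derivative in K. fold da db in K. unfold msq in K. unfold mask.
    destruct Z_le_gt_dec; [simpl; lra|exact K]. }
  assert (HV : mean V <= r).
  { unfold V. rewrite Parseval. eapply Rle_trans; [|exact Hn]. apply SZ_le. intros k _.
    rewrite <- (kin_le_h1 a b k), <- kin_derivative. apply Rle_refl. }
  assert (M2 : mean (fun x => dG x ^ 2 + dH x ^ 2) <=
    mean (fun x => 2 * (1728 * r ^ 4 * d ^ 2) +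
      (2 * (384 * r ^ 4) * W x + 2 * (1536 * r ^ 2 * d ^ 2) * V x))).
  { apply mean_le; cont_tac. intros x _. unfold W, V.
    destruct (Hr m x) as [U1 U2]. destruct (Hr n x) as [V1 V2]. destruct (Hd x) as [D1 D2].
    assert (K1 := dcub_diff sg (TA m a b) (TB m a b) (TA m da db) (TB m da db)
      (TA n a b) (TB n a b) (TA n da db) (TB n da db) x r d Hs U1 U2 V1 V2 D1 D2).
    assert (K2 := dcub_diff sg (TB m a b) (TA m a b) (TB m da db) (TA m da db)
      (TB n a b) (TA n a b) (TB n da db) (TA n da db) x r d Hs U2 U1 V2 V1 D2 D1).
    unfold dG, dH. lra. }
  set (S2 := mean (fun x => dG x ^ 2 + dH x ^ 2)) in *.
  set (S1 := mean (fun x => G x ^ 2 + H x ^ 2)) in *.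
  rewrite !mean_plus, !mean_scal, mean_const in M2 by cont_tac.
  assert (0 <= r ^ 4) by now apply pow_le.
  assert (0 <= r ^ 3) by now apply pow_le.
  assert (0 <= r ^ 2 * d ^ 2) by (apply Rmult_le_pos; apply pow2_ge_0).
  assert (K1 : r ^ 4 * mean W <= r ^ 4 * (d ^ 2 / 5)) by now apply Rmult_le_compat_l.
  assert (K2 : r ^ 2 * d ^ 2 * mean V <= r ^ 2 * d ^ 2 * r) by now apply Rmult_le_compat_l.
  assert (0 <= r ^ 4 * d ^ 2) by (apply Rmult_le_pos; [assumption|apply pow2_ge_0]).
  unfold h1_const. lra.
Qed.

(** The intermediate truncation [m] separates a smooth difference, handled by
    [truncation_difference_h1], from one known only in the sup norm. For the latter the modes up to
    [n] cost a factor 1 + n^2, and [m] is chosen after [n] to pay for it. *)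
Lemma remainder_h1 sg f g a b r d n : Rabs sg <= 1 -> cont f -> cont g -> 0 < r -> 0 < d ->
  (forall x, - PI < x < PI -> Rabs (f x) <= r /\ Rabs (g x) <= r) ->
  (forall j x, Rabs (TA j a b x) <= r /\ Rabs (TB j a b x) <= r) ->
  SZ n (h1 a b) <= r ->
  (forall m, (n <= m)%nat -> SZ m (h1 a b) - SZ n (h1 a b) <= d ^ 2 / 5) ->
  (forall m x, (n <= m)%nat ->
     Rabs (TA m a b x - TA n a b x) <= d /\ Rabs (TB m a b x - TB n a b x) <= d) ->
  (forall e, 0 < e -> exists m0, forall m, (m0 <= m)%nat -> forall x, - PI < x < PI ->
     Rabs (f x - TA m a b x) <= e /\ Rabs (g x - TB m a b x) <= e) ->
  let N1 := cub sg (TA n a b) (TB n a b) in let N2 := cub sg (TB n a b) (TA n a b) in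
  SZ n (h1 (fun k => fre (cub sg f g) (cub sg g f) k - fre N1 N2 k)
           (fun k => fim (cub sg f g) (cub sg g f) k - fim N1 N2 k)) <=
  (2 * h1_const r + 2) * d ^ 2.
Proof.
  intros Hs Cf Cg Hr Hd Hfg HT Hn Htail Hdiff Hlim N1 N2.
  assert (Hr2 : 0 < r ^ 2) by now apply pow_lt.
  assert (Hn0 : 0 <= INR n) by apply pos_INR.
  (* Twice the square of the Lipschitz bound 12 r^2 e is 288 r^4 e^2, which is at most 17^2 r^4 e^2;
     the factor 1 + n absorbs the H^1 weight. *)
  set (e := d / (17 * r ^ 2 * (1 + INR n))).
  assert (Hden : 0 < 17 * r ^ 2 * (1 + INR n)) by (apply Rmult_lt_0_compat; lra).
  assert (He : 0 < e) by (apply Rdiv_lt_0_compat; assumption).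
  destruct (Hlim e He) as [m0 Hm0]. set (m := Nat.max m0 n).
  set (P1 := cub sg (TA m a b) (TB m a b)). set (P2 := cub sg (TB m a b) (TA m a b)).
  set (F1 := cub sg f g). set (F2 := cub sg g f).
  assert (CN1 : cont N1) by (apply cont_cub; auto).
  assert (CN2 : cont N2) by (apply cont_cub; auto).
  assert (CP1 : cont P1) by (apply cont_cub; auto).
  assert (CP2 : cont P2) by (apply cont_cub; auto).
  assert (CF1 : cont F1) by (apply cont_cub; auto).
  assert (CF2 : cont F2) by (apply cont_cub; auto).
  assert (Efre : forall u v u' v' k, cont u -> cont v -> cont u' -> cont v' ->
    fre (fun x => u x - u' x) (fun x => v x - v' x) k = fre u v k - fre u' v' k).
  { intros. unfold fre. rewrite <- mean_minus by cont_tac. apply mean_ext. intros. ring. }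
  assert (Efim : forall u v u' v' k, cont u -> cont v -> cont u' -> cont v' ->
    fim (fun x => u x - u' x) (fun x => v x - v' x) k = fim u v k - fim u' v' k).
  { intros. unfold fim. rewrite <- mean_minus by cont_tac. apply mean_ext. intros. ring. }
  set (G := fun x => P1 x - N1 x). set (H := fun x => P2 x - N2 x).
  set (U := fun x => F1 x - P1 x). set (V := fun x => F2 x - P2 x).
  assert (B1 : SZ n (h1 (fre G H) (fim G H)) <= h1_const r * d ^ 2).
  { apply (truncation_difference_h1 sg a b r d n m); auto.
    - lia.
    - apply Htail. lia.
    - intros x. apply Hdiff. lia. }
  assert (B2 : SZ n (h1 (fre U V) (fim U V)) <= d ^ 2).
  { apply Rle_trans with ((1 + INR n ^ 2) * (2 * (12 * r ^ 2 * e) ^ 2)).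
    - apply Rle_trans with ((1 + INR n ^ 2) * SZ n (fun k => fre U V k ^ 2 + fim U V k ^ 2)).
      + rewrite <- SZ_scal. apply SZ_le. intros k Hk. unfold h1.
        apply Rmult_le_compat_r.
        * apply (msq_nonneg (fre U V) (fim U V)).
        * apply Rplus_le_compat_l. rewrite INR_IZR_INZ. apply Rabs_sqr_le.
          rewrite <- abs_IZR. now apply IZR_le.
      + apply Rmult_le_compat_l; [pose proof (pow2_ge_0 (INR n)); lra|].
        eapply Rle_trans; [apply Bessel; unfold U, V; cont_tac|].
        rewrite <- (mean_const (2 * _)). apply mean_le; unfold U, V; cont_tac.
        intros x Hx. destruct (Hfg x Hx) as [A1 A2]. destruct (HT m x) as [T1 T2].
        destruct (Hm0 m ltac:(lia) x Hx) as [D1 D2].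
        apply Rsqr_sum_bound; apply cub_lip; auto.
    - apply Rle_trans with ((1 + INR n) ^ 2 * (289 * r ^ 4 * e ^ 2)).
      + assert (0 <= r ^ 4 * e ^ 2) by (apply Rmult_le_pos; apply pow_le; lra).
        pose proof (pow2_ge_0 (12 * r ^ 2 * e)).
        apply Rmult_le_compat; [nra|lra|nra|].
        replace (2 * (12 * r ^ 2 * e) ^ 2) with (288 * (r ^ 4 * e ^ 2)) by ring. lra.
      + right. unfold e. field. split; lra. }
  eapply Rle_trans.
  { apply (SZ_le n _ (fun k => 2 * h1 (fre U V) (fim U V) k + 2 * h1 (fre G H) (fim G H) k)).
    intros k _. eapply Rle_trans; [|apply h1_sum_le].
    right. apply h1_ext; unfold U, V, G, H.
    - rewrite !Efre by assumption. ring.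
    - rewrite !Efim by assumption. ring. }
  rewrite SZ_plus, !SZ_scal. lra.
Qed.

Lemma weighted_young d x y : 0 < d -> 2 * Rabs (x * y) <= d * x ^ 2 + y ^ 2 / d.
Proof.
  intros Hd. rewrite Rabs_mult, <- (pow2_abs x), <- (pow2_abs y).
  set (X := Rabs x). set (Y := Rabs y).
  assert (H : d * X ^ 2 + Y ^ 2 / d - 2 * (X * Y) = (d * X - Y) ^ 2 / d) by (field; lra).
  assert (0 <= (d * X - Y) ^ 2 / d).
  { apply Rmult_le_pos; [apply pow2_ge_0|apply Rlt_le, Rinv_0_lt_compat, Hd]. }
  lra.
Qed.

(** Young's inequality with parameter [d] splits the pairing of [is_derive_energy]: the gradient
    side is bounded and gets the factor d, the remainder side is O(d^2) and gets 1/d. One factor k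
    goes to each side, so H^1 norms suffice. *)
Lemma energy_conservation sg f g A B T eta : Rabs sg <= 1 -> h1_solution sg f g A B ->
  0 < eta -> exists n0, forall t n, Rabs t <= T -> (n0 <= n)%nat ->
  Rabs (energy sg n (A t) (B t) - energy sg n (A 0) (B 0)) <= eta.
Proof.
  intros Hs Hsol Heta.
  destruct (uniform_bounds sg f g A B T Hsol) as (r & Hr & Hbd & Happ).
  assert (Hr6 : 0 < r ^ 6) by now apply pow_lt.
  assert (Hr4 : 0 < r ^ 4) by now apply pow_lt.
  assert (Hr3 : 0 < r ^ 3) by now apply pow_lt.
  set (K := r + 32 * r ^ 6 + (2 * h1_const r + 2)).
  assert (HK : 0 < K) by (unfold K, h1_const; lra).
  set (C := K * Rabs T). assert (HC : 0 <= C) by (apply Rmult_le_pos; [lra|apply Rabs_pos]).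
  set (d := eta / (C + 1)). assert (Hd : 0 < d) by (apply Rdiv_lt_0_compat; lra).
  destruct (Happ d Hd) as [n0 Hn0].
  exists n0. intros t n Ht Hn.
  eapply Rle_trans.
  { eapply (MVT_bound (fun t => energy sg n (A t) (B t)) _ T (K * d));
      [intros u _; apply (is_derive_energy sg f g A B u n Hsol)
      |clear t Ht; cbv beta zeta|exact Ht].
    intros t Ht. destruct (Hbd t Ht) as (Hh1 & HT & Hfg).
    destruct (Hn0 t n Ht Hn) as (_ & Htail & Hdiff).
    pose proof (sol_cont_re _ _ _ _ _ Hsol t) as Cf.
    pose proof (sol_cont_im _ _ _ _ _ Hsol t) as Cg.
    set (a := A t) in *. set (b := B t) in *.
    set (N1 := cub sg (TA n a b) (TB n a b)). set (N2 := cub sg (TB n a b) (TA n a b)).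
    assert (CN1 : cont N1) by (apply cont_cub; auto).
    assert (CN2 : cont N2) by (apply cont_cub; auto).
    assert (HT' : forall j x, Rabs (TA j a b x) <= r /\ Rabs (TB j a b x) <= r).
    { intros. apply HT. intros. apply Rle_refl. }
    assert (Hrem : SZ n (h1 (fun k => fre (cub sg (f t) (g t)) (cub sg (g t) (f t)) k - fre N1 N2 k)
           (fun k => fim (cub sg (f t) (g t)) (cub sg (g t) (f t)) k - fim N1 N2 k)) <=
      (2 * h1_const r + 2) * d ^ 2).
    { apply (remainder_h1 sg (f t) (g t) a b r d n); auto.
      intros e He. destruct (Happ e He) as [m0 Hm0]. exists m0. intros m Hm.
      apply (Hm0 t m Ht Hm). }
    assert (HN : SZ n (msq (fre N1 N2) (fim N1 N2)) <= 32 * r ^ 6).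
    { eapply Rle_trans; [apply (Bessel n N1 N2); assumption|].
      rewrite <- (mean_const (32 * _)). apply mean_le; cont_tac. intros x _.
      replace (32 * r ^ 6) with (2 * (4 * r ^ 3) ^ 2) by ring.
      destruct (HT' n x). apply Rsqr_sum_bound; apply cub_bound; auto. }
    set (rho := fun k => fre (cub sg (f t) (g t)) (cub sg (g t) (f t)) k - fre N1 N2 k) in *.
    set (kap := fun k => fim (cub sg (f t) (g t)) (cub sg (g t) (f t)) k - fim N1 N2 k) in *.
    rewrite Rabs_mult, (Rabs_pos_eq 2) by lra.
    apply Rle_trans with (SZ n (fun k => d * (h1 a b k + msq (fre N1 N2) (fim N1 N2) k) +
      / d * h1 rho kap k)).
    - eapply Rle_trans; [apply Rmult_le_compat_l; [lra|apply Rabs_SZ]|].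
      rewrite <- SZ_scal. apply SZ_le. intros k _.
      set (p := fre N1 N2 k). set (q := fim N1 N2 k).
      change (fre (cub sg (f t) (g t)) (cub sg (g t) (f t)) k - p) with (rho k).
      change (fim (cub sg (f t) (g t)) (cub sg (g t) (f t)) k - q) with (kap k).
      set (K' := IZR k).
      pose proof (weighted_young d (K' * a k) (K' * kap k) Hd) as Y1.
      pose proof (weighted_young d (K' * b k) (K' * rho k) Hd) as Y2.
      pose proof (weighted_young d p (kap k) Hd) as Y3.
      pose proof (weighted_young d q (rho k) Hd) as Y4.
      apply Rle_trans with (2 * (Rabs (K' * a k * (K' * kap k)) + Rabs (p * kap k) +
        (Rabs (K' * b k * (K' * rho k)) + Rabs (q * rho k)))).
      + apply Rmult_le_compat_l; [lra|].
        replace ((K' ^ 2 * a k + p) * kap k - (K' ^ 2 * b k + q) * rho k) with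
          (K' * a k * (K' * kap k) + p * kap k - (K' * b k * (K' * rho k) + q * rho k)) by ring.
        apply Rabs_minus_le; apply Rabs_triang.
      + unfold h1, msq. fold p q K'. unfold Rdiv in *.
        pose proof (pow2_ge_0 (a k)). pose proof (pow2_ge_0 (b k)).
        assert (0 <= d * (a k ^ 2 + b k ^ 2)) by (apply Rmult_le_pos; lra).
        lra.
    - rewrite SZ_plus, !SZ_scal, SZ_plus.
      assert (/ d * SZ n (h1 rho kap) <= (2 * h1_const r + 2) * d).
      { apply Rmult_le_reg_l with d; [assumption|].
        rewrite <- Rmult_assoc, Rinv_r, Rmult_1_l by lra. lra. }
      specialize (Hh1 n).
      assert (d * (SZ n (h1 a b) + SZ n (msq (fre N1 N2) (fim N1 N2))) <= d * (r + 32 * r ^ 6))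
        by (apply Rmult_le_compat_l; lra).
      unfold K. lra. }
  assert (Rabs t <= Rabs T) by (eapply Rle_trans; [exact Ht|apply Rle_abs]).
  apply Rle_trans with (C * d).
  - unfold C. replace (K * Rabs T * d) with (K * d * Rabs T) by ring.
    apply Rmult_le_compat_l; [|assumption]. apply Rmult_le_pos; lra.
  - assert (d * (C + 1) = eta) by (unfold d; field; lra). nra.
Qed.

(** * Reduced dynamics *)

(** Coefficients of the data: cos x + sin x = ((1 - i) e^{ix} + (1 + i) e^{-ix}) / 2. *)
Definition init_re (eps : R) (k : Z) : R :=
  if Z.eq_dec (Z.abs k) 1 then eps / 2 else 0.
Definition init_im (eps : R) (k : Z) : R :=
  if Z.eq_dec k 1 then - eps / 2 else if Z.eq_dec k (-1) then eps / 2 else 0.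

Lemma SZ_vanish n m g : (n <= m)%nat ->
  (forall k, (Z.of_nat n < Z.abs k)%Z -> g k = 0) -> SZ m g = SZ n g.
Proof.
  intros Hnm H. pose proof (SZ_mask n m g Hnm) as E.
  rewrite SZ_zero in E; [lra|]. intros k _. unfold mask.
  destruct Z_le_gt_dec; [reflexivity|apply H; lia].
Qed.

Lemma SZ_1 g : SZ 1 g = g 0%Z + (g 1%Z + g (-1)%Z).
Proof. reflexivity. Qed.

Lemma init_high eps k : (1 < Z.abs k)%Z -> init_re eps k = 0 /\ init_im eps k = 0.
Proof.
  intros H. unfold init_re, init_im.
  repeat destruct Z.eq_dec; try lia; auto.
Qed.

Lemma init_T eps n x : (1 <= n)%nat ->
  TA n (init_re eps) (init_im eps) x = eps * (cos x + sin x) /\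
  TB n (init_re eps) (init_im eps) x = 0.
Proof.
  intros Hn. unfold TA, TB.
  rewrite (SZ_vanish 1 n _ Hn), (SZ_vanish 1 n _ Hn).
  - rewrite !SZ_1. unfold init_re, init_im. simpl.
    replace (-1 * x) with (- x) by ring. rewrite Rmult_1_l, cos_neg, sin_neg.
    split; field.
  - intros k Hk. destruct (init_high eps k) as [-> ->]; [lia|ring].
  - intros k Hk. destruct (init_high eps k) as [-> ->]; [lia|ring].
Qed.

Lemma init_coefs sg f g A B eps : h1_solution sg f g A B ->
  (forall x, f 0 x = eps * (cos x + sin x)) -> (forall x, g 0 x = 0) ->
  forall k, A 0 k = init_re eps k /\ B 0 k = init_im eps k.
Proof.
  intros Hsol Hf Hg k. set (n := Nat.max 1 (Z.abs_nat k)).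
  rewrite (sol_re _ _ _ _ _ Hsol), (sol_im _ _ _ _ _ Hsol).
  rewrite <- (fre_T n (init_re eps) (init_im eps) k) at 1 by lia.
  rewrite <- (fim_T n (init_re eps) (init_im eps) k) at 1 by lia.
  assert (E := fun x => init_T eps n x ltac:(lia)).
  split; apply mean_ext; intros x; destruct (E x) as [-> ->]; now rewrite Hf, Hg.
Qed.

(** One factor |w|^2 is estimated in the sup norm, with 10 = 2 * 5 from [sup_T], and the other in
    mean by Parseval. Keeping the mass as a factor lets the kinetic part be absorbed later. *)
Lemma potential_bound sg n a b : Rabs sg <= 1 ->
  Rabs (mean (potential sg (TA n a b) (TB n a b))) <=
  10 * SZ n (h1 a b) * SZ n (msq a b).
Proof.
  intros Hs. set (S := SZ n (h1 a b)). unfold msq. rewrite <- Parseval.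
  pose proof (cont_TA n a b) as CA. pose proof (cont_TB n a b) as CB.
  rewrite <- mean_scal by cont_tac. apply Rabs_mean_le.
  - change (cont (fun x => potential sg (TA n a b) (TB n a b) x)). unfold potential. cont_tac.
  - cont_tac.
  - intros x _. unfold potential. destruct (sup_T n a b x) as [S1 S2].
    fold (h1 a b) S in S1, S2.
    set (q := TA n a b x ^ 2 + TB n a b x ^ 2) in *.
    assert (Hq : 0 <= q) by (unfold q; pose proof (pow2_ge_0 (TA n a b x));
      pose proof (pow2_ge_0 (TB n a b x)); lra).
    replace (q ^ 2) with (q * q) by ring.
    apply Rle_trans with (1 * 1 * (q * q)).
    + apply Rabs_mult_le; [apply Rabs_mult_le; auto using Rabs_cos_le|].
      rewrite Rabs_pos_eq; nra.
    + assert (q <= 10 * S) by (unfold q; lra). nra.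
Qed.

Lemma h1_split n a b : SZ n (h1 a b) = SZ n (kin a b) + SZ n (msq a b).
Proof. rewrite <- SZ_plus. apply SZ_ext. intros. unfold h1, kin, msq. ring. Qed.

Lemma kin_nonneg a b k : 0 <= kin a b k.
Proof. apply Rmult_le_pos; [apply pow2_ge_0|apply msq_nonneg]. Qed.

(* Odd [k] other than [1] and [-1] have [k^2 >= 9], so [k^2 - 1 >= (4/5) (k^2 + 1)]. *)
Lemma high_modes_weight a b k :
  (forall j, Z.even j = true -> a j = 0 /\ b j = 0) ->
  mask 1 (h1 a b) k <= 5 / 4 * (kin a b k - msq a b k).
Proof.
  intros He. unfold mask, h1, kin. fold (msq a b k).
  destruct (Z.even k) eqn:Ek.
  - destruct (He k Ek) as [E1 E2]. unfold msq. rewrite E1, E2.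
    destruct Z_le_gt_dec; simpl; lra.
  - pose proof (msq_nonneg a b k). destruct Z_le_gt_dec as [H1|H1].
    + assert (K : (k * k = 1)%Z).
      { destruct (Z.eq_dec k 0) as [->|]; [discriminate|].
        assert (k = 1 \/ k = -1)%Z as [-> | ->] by lia; reflexivity. }
      replace (IZR k ^ 2) with 1; [lra|]. rewrite <- (f_equal IZR K), mult_IZR. ring.
    + assert (K : (9 <= k * k)%Z).
      { assert (3 <= Z.abs k)%Z; [|nia].
        destruct (Z.eq_dec (Z.abs k) 2); [|lia].
        assert (k = 2 \/ k = -2)%Z as [-> | ->] by lia; discriminate. }
      apply IZR_le in K. rewrite mult_IZR in K. nra.
Qed.

(** Kinetic energy and mass both start at eps^2, so their difference stays within the two potentials
    and the conservation errors, all O(eps^4); [high_modes_weight] converts this into an H^1 bound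
    off the modes 1 and -1. The mass of these two modes then differs from eps^2 by the mass error
    plus that tail. *)
Lemma a_priori sg f g A B eps : Rabs sg <= 1 -> h1_solution sg f g A B ->
  0 < eps <= / 10 ->
  (forall x, f 0 x = eps * (cos x + sin x)) -> (forall x, g 0 x = 0) ->
  forall t,
    A t 0%Z = 0 /\ B t 0%Z = 0 /\
    Rabs (msq (A t) (B t) 1 + msq (A t) (B t) (-1) - eps ^ 2) <= 80 * eps ^ 4 /\
    (forall n, (1 <= n)%nat -> SZ n (h1 (A t) (B t)) - SZ 1 (h1 (A t) (B t)) <= 80 * eps ^ 4).
Proof.
  intros Hs Hsol Heps Hf Hg t.
  pose proof (init_coefs sg f g A B eps Hsol Hf Hg) as Hinit.
  assert (Heven : forall t k, Z.even k = true -> A t k = 0 /\ B t k = 0).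
  { apply (even_modes_vanish sg f g A B Hs Hsol). intros k Hk.
    destruct (Hinit k) as [-> ->]. unfold init_re, init_im.
    repeat destruct Z.eq_dec; auto; exfalso.
    - assert (k = 1 \/ k = -1)%Z as [-> | ->] by lia; discriminate.
    - assert (k = 1 \/ k = -1)%Z as [-> | ->] by lia; discriminate.
    - assert (k = 1 \/ k = -1)%Z as [-> | ->] by lia; discriminate.
    - subst; discriminate.
    - subst; discriminate. }
  assert (Hm0 : forall n, (1 <= n)%nat -> SZ n (msq (A 0) (B 0)) = eps ^ 2 /\
    SZ n (kin (A 0) (B 0)) = eps ^ 2).
  { intros n Hn. rewrite (SZ_vanish 1 n (msq _ _) Hn), (SZ_vanish 1 n (kin _ _) Hn).
    - rewrite !SZ_1. unfold kin, msq. rewrite !(proj1 (Hinit _)), !(proj2 (Hinit _)).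
      unfold init_re, init_im. simpl. split; field.
    - intros k Hk. unfold kin, msq. destruct (Hinit k) as [-> ->].
      destruct (init_high eps k) as [-> ->]; [lia|ring].
    - intros k Hk. unfold msq. destruct (Hinit k) as [-> ->].
      destruct (init_high eps k) as [-> ->]; [lia|ring]. }
  assert (He2 : 0 < eps ^ 2 <= / 100) by (split; [apply pow_lt; lra|nra]).
  set (e2 := eps ^ 2) in *. replace (eps ^ 4) with (e2 * e2) by (unfold e2; ring).
  assert (He4 : 0 < e2 * e2) by (apply Rmult_lt_0_compat; lra).
  (* The truncation levels depend on [t], but the tolerance eps^4 does not, so the final bounds are
     uniform in time. *)
  destruct (mass_conservation sg f g A B (Rabs t) (e2 * e2) Hs Hsol He4) as [n1 Hn1].
  destruct (energy_conservation sg f g A B (Rabs t) (e2 * e2) Hs Hsol He4) as [n2 Hn2].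
  assert (Hbig : forall n, (1 <= n)%nat -> (n1 <= n)%nat -> (n2 <= n)%nat ->
    Rabs (SZ n (msq (A t) (B t)) - e2) <= e2 * e2 /\
    SZ n (h1 (A t) (B t)) - SZ 1 (h1 (A t) (B t)) <= 67 * (e2 * e2)).
  { intros n H1 H2 H3.
    destruct (Hm0 n H1) as [M0 K0].
    specialize (Hn1 t n (Rle_refl _) H2). specialize (Hn2 t n (Rle_refl _) H3).
    rewrite M0 in Hn1. unfold energy in Hn2. rewrite K0 in Hn2.
    pose proof (potential_bound sg n (A 0) (B 0) Hs) as P0.
    pose proof (potential_bound sg n (A t) (B t) Hs) as Pt.
    rewrite h1_split, M0, K0 in P0. rewrite h1_split in Pt.
    assert (0 <= SZ n (kin (A t) (B t))) by (apply SZ_nonneg; intros; apply kin_nonneg).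
    assert (0 <= SZ n (msq (A t) (B t))) by (apply SZ_nonneg; intros; apply msq_nonneg).
    split; [exact Hn1|].
    rewrite <- SZ_mask by assumption.
    eapply Rle_trans; [apply SZ_le; intros k _; apply (high_modes_weight _ _ _ (Heven t))|].
    rewrite SZ_scal, SZ_minus.
    set (K := SZ n (kin (A t) (B t))) in *. set (M := SZ n (msq (A t) (B t))) in *.
    apply Rabs_le_between in Hn1, Hn2, P0, Pt.
    assert (HM : M <= 101 / 100 * e2) by nra.
    assert (HKM : (K + M) * M <= (K + 101 / 100 * e2) * (101 / 100 * e2)).
    { apply Rmult_le_compat; lra. }
    assert (Ke : K * e2 <= K * / 100) by (apply Rmult_le_compat_l; lra).
    assert (e2 * e2 <= e2 * / 100) by (apply Rmult_le_compat_l; lra).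
    (* As e2 <= 1/100, the share of the potential proportional to [K] has a factor of about 1/10 and
       is absorbed. Reinserting this crude bound into the energy inequality gives the constant
       67. *)
    assert (HK : K <= 2 * e2) by lra.
    assert (K * e2 <= 2 * e2 * e2) by (apply Rmult_le_compat_r; lra).
    lra. }
  split; [apply (Heven t 0%Z eq_refl)|]. split; [apply (Heven t 0%Z eq_refl)|].
  set (N := Nat.max 1 (Nat.max n1 n2)).
  split.
  - destruct (Hbig N) as [Q1 Q2]; try lia.
    assert (E : SZ 1 (msq (A t) (B t)) = msq (A t) (B t) 1 + msq (A t) (B t) (-1)).
    { rewrite SZ_1. unfold msq at 1. destruct (Heven t 0%Z eq_refl) as [-> ->]. ring. }
    rewrite <- E.
    assert (SZ 1 (msq (A t) (B t)) <= SZ N (msq (A t) (B t)))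
      by (apply SZ_mono; [apply msq_nonneg|lia]).
    assert (SZ N (msq (A t) (B t)) - SZ 1 (msq (A t) (B t)) <=
      SZ N (h1 (A t) (B t)) - SZ 1 (h1 (A t) (B t))).
    { apply SZ_mask_le; [lia|]. intros k. unfold h1. fold (msq (A t) (B t) k).
      pose proof (msq_nonneg (A t) (B t) k). pose proof (pow2_ge_0 (IZR k)). nra. }
    apply Rabs_le_between in Q1. apply Rabs_le. lra.
  - intros n Hn. destruct (Hbig (Nat.max n N)) as [_ Q2]; try lia.
    assert (SZ n (h1 (A t) (B t)) <= SZ (Nat.max n N) (h1 (A t) (B t)))
      by (apply SZ_mono; [apply h1_nonneg|lia]).
    lra.
Qed.

(** * The cubic term on two modes and its resonant averages *)

Lemma mean_resonant c1 c2 c3 c4 c5 c6 :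
  mean (fun x => c1 * cos (2 * x) + c2 * cos (2 * x) ^ 2 + c3 * (cos (2 * x) * sin (2 * x)) +
    c4 * cos (2 * x) ^ 3 + c5 * (cos (2 * x) ^ 2 * sin (2 * x)) +
    c6 * (cos (2 * x) * sin (2 * x) ^ 2)) = c2 / 2.
Proof.
  assert (T : forall x, sin (2 * x) ^ 2 = 1 - cos (2 * x) ^ 2).
  { intros x. pose proof (sin2_cos2 (2 * x)) as H. rewrite !Rsqr_pow2 in H. lra. }
  (* Linearisation into the frequencies 0, 2, 4, 6: among the six monomials only the square of the
     cosine has a constant term. *)
  rewrite (mean_ext _ (fun x => c2 / 2 * cos (IZR 0 * x) +
    ((c1 + 3 * c4 / 4 + c6 / 4) * cos (IZR 2 * x) + c2 / 2 * cos (IZR 4 * x) +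
     (c4 / 4 - c6 / 4) * cos (IZR 6 * x)) +
    (c5 / 4 * sin (IZR 2 * x) + c3 / 2 * sin (IZR 4 * x) + c5 / 4 * sin (IZR 6 * x)))).
  - rewrite !mean_plus, !mean_scal, !mean_cos, !mean_sin by cont_tac.
    simpl. field.
  - intros x.
    replace (IZR 4 * x) with (2 * x + 2 * x) by (simpl; ring).
    replace (IZR 6 * x) with ((2 * x + 2 * x) + 2 * x) by (simpl; ring).
    rewrite Rmult_0_l, cos_0.
    rewrite (cos_plus (2 * x + 2 * x)), (sin_plus (2 * x + 2 * x)), cos_plus, sin_plus.
    specialize (T x). revert T. change (IZR 2) with 2.
    set (c := cos (2 * x)). set (s := sin (2 * x)). intros T.
    replace (s * s) with (s ^ 2) by ring. rewrite T.
    replace ((s * c + c * s) * s) with (2 * c * s ^ 2) by ring. rewrite T.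
    field.
Qed.

Lemma mean_resonant_product sg M X L a b c :
  mean (fun x => 2 * sg * cos (2 * x) *
    (M + 2 * X * cos (2 * x) + 2 * L * sin (2 * x)) *
    (a + b * cos (2 * x) + c * sin (2 * x))) = sg * (M * b + 2 * X * a).
Proof.
  rewrite (mean_ext _ (fun x => (2 * sg * M * a) * cos (2 * x) +
    (2 * sg * (M * b + 2 * X * a)) * cos (2 * x) ^ 2 +
    (2 * sg * (M * c + 2 * L * a)) * (cos (2 * x) * sin (2 * x)) +
    (2 * sg * (2 * X * b)) * cos (2 * x) ^ 3 +
    (2 * sg * (2 * X * c + 2 * L * b)) * (cos (2 * x) ^ 2 * sin (2 * x)) +
    (2 * sg * (2 * L * c)) * (cos (2 * x) * sin (2 * x) ^ 2))) by (intros; ring).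
  rewrite mean_resonant. field.
Qed.

(** With v = p e^{ix} + q e^{-ix}, these are |v|^2 and the real and imaginary parts of v e^{-ix} = p
    + q e^{-2ix} and of v e^{ix} = q + p e^{2ix}; [X] and [L] are the real and imaginary parts of
    conj(p) q. *)
Lemma two_mode_trig a b x : a 0%Z = 0 -> b 0%Z = 0 ->
  let v1 := TA 1 a b x in let v2 := TB 1 a b x in
  let X := a 1%Z * a (-1)%Z + b 1%Z * b (-1)%Z in
  let L := a 1%Z * b (-1)%Z - b 1%Z * a (-1)%Z in
  v1 ^ 2 + v2 ^ 2 = msq a b 1 + msq a b (-1) + 2 * X * cos (2 * x) + 2 * L * sin (2 * x) /\
  v1 * cos x + v2 * sin x = a 1%Z + a (-1)%Z * cos (2 * x) + b (-1)%Z * sin (2 * x) /\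
  v2 * cos x - v1 * sin x = b 1%Z + b (-1)%Z * cos (2 * x) + - a (-1)%Z * sin (2 * x) /\
  v1 * cos x - v2 * sin x = a (-1)%Z + a 1%Z * cos (2 * x) + - b 1%Z * sin (2 * x) /\
  v2 * cos x + v1 * sin x = b (-1)%Z + b 1%Z * cos (2 * x) + a 1%Z * sin (2 * x).
Proof.
  intros Ha Hb v1 v2 X L.
  assert (T : sin x * sin x + cos x * cos x = 1) by (apply sin2_cos2).
  assert (E1 : v1 = (a 1%Z + a (-1)%Z) * cos x - (b 1%Z - b (-1)%Z) * sin x).
  { unfold v1, TA. rewrite SZ_1, Ha, Hb, Rmult_1_l.
    replace (-1 * x) with (- x) by ring. rewrite cos_neg, sin_neg. ring. }
  assert (E2 : v2 = (a 1%Z - a (-1)%Z) * sin x + (b 1%Z + b (-1)%Z) * cos x).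
  { unfold v2, TB. rewrite SZ_1, Ha, Hb, Rmult_1_l.
    replace (-1 * x) with (- x) by ring. rewrite cos_neg, sin_neg. ring. }
  rewrite E1, E2, cos_2a, sin_2a. unfold X, L, msq. clear E1 E2 v1 v2 X L.
  revert T. set (s := sin x). set (c := cos x). generalize (a 1%Z) (b 1%Z) (a (-1)%Z) (b (-1)%Z).
  intros p1 q1 p2 q2 T. repeat split.
  - rewrite <- (Rmult_1_r (p1 ^ 2 + q1 ^ 2 + (p2 ^ 2 + q2 ^ 2))), <- T. ring.
  all: match goal with |- _ = ?p + ?y + ?z =>
    transitivity (p * (s * s + c * c) + y + z); [ring|rewrite T; ring] end.
Qed.

(** The effective vector field on (p, q). The term [L] of |v|^2 multiplies sin 2x and averages out
    against cos 2x, so only [X] survives. *)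
Lemma resonant_coefs sg a b : a 0%Z = 0 -> b 0%Z = 0 ->
  let N1 := cub sg (TA 1 a b) (TB 1 a b) in let N2 := cub sg (TB 1 a b) (TA 1 a b) in
  let M := msq a b 1 + msq a b (-1) in
  let X := a 1%Z * a (-1)%Z + b 1%Z * b (-1)%Z in
  fre N1 N2 1 = sg * (M * a (-1)%Z + 2 * X * a 1%Z) /\
  fim N1 N2 1 = sg * (M * b (-1)%Z + 2 * X * b 1%Z) /\
  fre N1 N2 (-1) = sg * (M * a 1%Z + 2 * X * a (-1)%Z) /\
  fim N1 N2 (-1) = sg * (M * b 1%Z + 2 * X * b (-1)%Z).
Proof.
  intros Ha Hb N1 N2 M X. set (L := a 1%Z * b (-1)%Z - b 1%Z * a (-1)%Z).
  assert (Tr := fun x => two_mode_trig a b x Ha Hb). cbv zeta in Tr. fold M X L in Tr.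
  unfold fre, fim.
  split; [|split; [|split]].
  - rewrite <- (mean_resonant_product sg M X L (a 1%Z) (a (-1)%Z) (b (-1)%Z)).
    apply mean_ext. intros x. destruct (Tr x) as (Q & T1 & _).
    rewrite <- Q, <- T1. unfold N1, N2, cub. rewrite Rmult_1_l. ring.
  - rewrite <- (mean_resonant_product sg M X L (b 1%Z) (b (-1)%Z) (- a (-1)%Z)).
    apply mean_ext. intros x. destruct (Tr x) as (Q & _ & T1 & _).
    rewrite <- Q, <- T1. unfold N1, N2, cub. rewrite Rmult_1_l. ring.
  - rewrite <- (mean_resonant_product sg M X L (a (-1)%Z) (a 1%Z) (- b 1%Z)).
    apply mean_ext. intros x. destruct (Tr x) as (Q & _ & _ & T1 & _).
    rewrite <- Q, <- T1. unfold N1, N2, cub. replace (-1 * x) with (- x) by ring.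
    rewrite cos_neg, sin_neg. ring.
  - rewrite <- (mean_resonant_product sg M X L (b (-1)%Z) (b 1%Z) (a 1%Z)).
    apply mean_ext. intros x. destruct (Tr x) as (Q & _ & _ & _ & T1).
    rewrite <- Q, <- T1. unfold N1, N2, cub. replace (-1 * x) with (- x) by ring.
    rewrite cos_neg, sin_neg. ring.
Qed.

Lemma fourier_diff_bound u v u' v' k c : cont u -> cont v -> cont u' -> cont v' ->
  (forall x, - PI < x < PI -> Rabs (u x - u' x) <= c /\ Rabs (v x - v' x) <= c) ->
  Rabs (fre u v k - fre u' v' k) <= 2 * c /\ Rabs (fim u v k - fim u' v' k) <= 2 * c.
Proof.
  intros Cu Cv Cu' Cv' H. unfold fre, fim. rewrite <- !mean_minus by cont_tac.
  replace (2 * c) with (c * 1 + c * 1) by ring.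
  split; (apply Rabs_mean_bound; [cont_tac|]; intros x Hx; destruct (H x Hx) as [H1 H2]).
  - replace (u x * cos (IZR k * x) + v x * sin (IZR k * x) -
      (u' x * cos (IZR k * x) + v' x * sin (IZR k * x))) with
      ((u x - u' x) * cos (IZR k * x) + (v x - v' x) * sin (IZR k * x)) by ring.
    apply Rabs_plus_le; apply Rabs_mult_le; auto using Rabs_cos_le, Rabs_sin_le.
  - replace (v x * cos (IZR k * x) - u x * sin (IZR k * x) -
      (v' x * cos (IZR k * x) - u' x * sin (IZR k * x))) with
      ((v x - v' x) * cos (IZR k * x) - (u x - u' x) * sin (IZR k * x)) by ring.
    apply Rabs_minus_le; apply Rabs_mult_le; auto using Rabs_cos_le, Rabs_sin_le.
Qed.

Lemma sqr_le_abs x c : 0 <= c -> x ^ 2 <= c ^ 2 -> Rabs x <= c.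
Proof.
  intros Hc H. rewrite <- (Rabs_pos_eq c Hc). apply Rsqr_le_abs_0. now rewrite !Rsqr_pow2.
Qed.

(** The cubic term has Lipschitz constant of order eps^2 on functions of size 7 eps, and the
    two-mode part is at distance 20 eps^2, since 5 * 80 eps^4 is the square of 20 eps^2. *)
Lemma resonant_approximation sg f g A B eps : Rabs sg <= 1 -> h1_solution sg f g A B ->
  0 < eps <= / 10 ->
  (forall x, f 0 x = eps * (cos x + sin x)) -> (forall x, g 0 x = 0) ->
  forall t k,
  let N1 := cub sg (TA 1 (A t) (B t)) (TB 1 (A t) (B t)) in
  let N2 := cub sg (TB 1 (A t) (B t)) (TA 1 (A t) (B t)) in
  Rabs (fre (cub sg (f t) (g t)) (cub sg (g t) (f t)) k - fre N1 N2 k) <= 23520 * eps ^ 4 /\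
  Rabs (fim (cub sg (f t) (g t)) (cub sg (g t) (f t)) k - fim N1 N2 k) <= 23520 * eps ^ 4.
Proof.
  intros Hs Hsol Heps Hf Hg t k N1 N2.
  destruct (a_priori sg f g A B eps Hs Hsol Heps Hf Hg t) as (HA0 & HB0 & HM & Htail).
  pose proof (sol_cont_re _ _ _ _ _ Hsol t) as Cf.
  pose proof (sol_cont_im _ _ _ _ _ Hsol t) as Cg.
  set (a := A t) in *. set (b := B t) in *.
  assert (He2 : 0 < eps ^ 2 <= / 100) by (split; [apply pow_lt; lra|nra]).
  assert (HT : forall x, Rabs (TA 1 a b x) <= 5 * eps /\ Rabs (TB 1 a b x) <= 5 * eps).
  { intros x. destruct (sup_T 1 a b x) as [S1 S2]. fold (h1 a b) in S1, S2.
    assert (E : SZ 1 (h1 a b) = 2 * (msq a b 1 + msq a b (-1))).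
    { rewrite SZ_1. unfold h1 at 1, msq. rewrite HA0, HB0. unfold h1. simpl. ring. }
    rewrite E in S1, S2. apply Rabs_le_between in HM.
    replace (eps ^ 4) with (eps ^ 2 * eps ^ 2) in HM by ring.
    split; apply sqr_le_abs; nra. }
  assert (Hdiff : forall x, - PI < x < PI ->
    Rabs (f t x - TA 1 a b x) <= 20 * eps ^ 2 /\ Rabs (g t x - TB 1 a b x) <= 20 * eps ^ 2).
  { intros x Hx.
    assert (Ec : forall k, a k = fre (f t) (g t) k /\ b k = fim (f t) (g t) k).
    { intros j. split; [apply (sol_re _ _ _ _ _ Hsol)|apply (sol_im _ _ _ _ _ Hsol)]. }
    assert (E : forall m, SZ m (h1 (fre (f t) (g t)) (fim (f t) (g t))) = SZ m (h1 a b)).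
    { intros m. apply SZ_ext. intros j _. destruct (Ec j). now apply h1_ext. }
    destruct (fourier_inversion (f t) (g t) 1 (80 * eps ^ 4) Cf Cg) with (x := x) as [I1 I2];
      auto.
    { intros m Hm. rewrite !E. now apply Htail. }
    rewrite <- (TA_ext 1 a b) in I1 by auto. rewrite <- (TB_ext 1 a b) in I2 by auto.
    replace (5 * (80 * eps ^ 4)) with ((20 * eps ^ 2) ^ 2) in I1, I2 by ring.
    rewrite sqrt_pow2 in I1, I2 by lra. auto. }
  assert (Hfg : forall x, - PI < x < PI -> Rabs (f t x) <= 7 * eps /\ Rabs (g t x) <= 7 * eps).
  { intros x Hx. destruct (HT x) as [T1 T2]. destruct (Hdiff x Hx) as [D1 D2].
    assert (20 * eps ^ 2 + 5 * eps <= 7 * eps) by nra.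
    split; (eapply Rle_trans; [|eassumption]).
    - replace (f t x) with ((f t x - TA 1 a b x) + TA 1 a b x) by ring.
      now apply Rabs_plus_le.
    - replace (g t x) with ((g t x - TB 1 a b x) + TB 1 a b x) by ring.
      now apply Rabs_plus_le. }
  replace (23520 * eps ^ 4) with (2 * (12 * (7 * eps) ^ 2 * (20 * eps ^ 2))) by ring.
  apply fourier_diff_bound; try (apply cont_cub; auto).
  intros x Hx. destruct (Hfg x Hx) as [F1 F2]. destruct (HT x) as [T1 T2].
  destruct (Hdiff x Hx) as [D1 D2].
  split; apply cub_lip; auto; lra.
Qed.

(** * Slow rotation between the two modes *)

Lemma is_derive_bilinear (p q u v : R -> R) t dp dq du dv :
  is_derive p t dp -> is_derive q t dq -> is_derive u t du -> is_derive v t dv ->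
  is_derive (fun t => p t * v t - q t * u t) t
    (dp * v t + p t * dv - (dq * u t + q t * du)).
Proof.
  intros Hp Hq Hu Hv.
  apply (is_derive_minus (fun t => p t * v t) (fun t => q t * u t)).
  - apply (is_derive_mult p v); auto. intros. apply Rmult_comm.
  - apply (is_derive_mult q u); auto. intros. apply Rmult_comm.
Qed.

Lemma is_derive_rotation (J L : R -> R) w t dJ dL :
  is_derive J t dJ -> is_derive L t dL ->
  is_derive (fun t => J t * cos (w * t) - L t * sin (w * t)) t
    ((dJ - w * L t) * cos (w * t) - (dL + w * J t) * sin (w * t)) /\
  is_derive (fun t => J t * sin (w * t) + L t * cos (w * t)) t
    ((dJ - w * L t) * sin (w * t) + (dL + w * J t) * cos (w * t)).
Proof.
  intros HJ HL. split.
  - auto_derive; [split; [exists dJ; exact HJ|split; [exists dL; exact HL|auto]]|].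
    change (fun x => J x) with J. change (fun x => L x) with L.
    rewrite (is_derive_unique _ _ _ HJ), (is_derive_unique _ _ _ HL). ring.
  - auto_derive; [split; [exists dJ; exact HJ|split; [exists dL; exact HL|auto]]|].
    change (fun x => J x) with J. change (fun x => L x) with L.
    rewrite (is_derive_unique _ _ _ HJ), (is_derive_unique _ _ _ HL). ring.
Qed.

(** In the rotating frame [W1], [W2] the derivatives consist of the errors alone. Two components
    with two error terms each give the factor 4. *)
Lemma perturbed_rotation (J L dJ dL : R -> R) w delta :
  (forall t, is_derive J t (dJ t)) -> (forall t, is_derive L t (dL t)) ->
  (forall t, Rabs (dJ t - w * L t) <= delta) -> (forall t, Rabs (dL t + w * J t) <= delta) ->
  J 0 = 0 -> forall t, Rabs (J t - L 0 * sin (w * t)) <= 4 * delta * Rabs t.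
Proof.
  intros HJ HL EJ EL J0 t.
  assert (R1 := fun u => proj1 (is_derive_rotation J L w u _ _ (HJ u) (HL u))).
  assert (R2 := fun u => proj2 (is_derive_rotation J L w u _ _ (HJ u) (HL u))).
  set (W1 := fun t => J t * cos (w * t) - L t * sin (w * t)) in *.
  set (W2 := fun t => J t * sin (w * t) + L t * cos (w * t)) in *.
  assert (B1 := MVT_bound W1 _ (Rabs t) (delta * 1 + delta * 1) (fun u _ => R1 u)).
  assert (B2 := MVT_bound W2 _ (Rabs t) (delta * 1 + delta * 1) (fun u _ => R2 u)).
  specialize (B1 (fun u _ => Rabs_minus_le _ _ _ _
    (Rabs_mult_le _ _ _ _ (EJ u) (Rabs_cos_le _)) (Rabs_mult_le _ _ _ _ (EL u) (Rabs_sin_le _)))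
    t (Rle_refl _)).
  specialize (B2 (fun u _ => Rabs_plus_le _ _ _ _
    (Rabs_mult_le _ _ _ _ (EJ u) (Rabs_sin_le _)) (Rabs_mult_le _ _ _ _ (EL u) (Rabs_cos_le _)))
    t (Rle_refl _)).
  assert (E : J t - L 0 * sin (w * t) =
    (W1 t - W1 0) * cos (w * t) + (W2 t - W2 0) * sin (w * t)).
  { unfold W1, W2. rewrite Rmult_0_r, sin_0, cos_0, J0.
    pose proof (sin2_cos2 (w * t)) as T. unfold Rsqr in T.
    set (c := cos (w * t)) in *. set (s := sin (w * t)) in *.
    transitivity (J t * (s * s + c * c) - L 0 * s); [rewrite T; ring|ring]. }
  rewrite E. replace (4 * delta * Rabs t) with
    ((delta * 1 + delta * 1) * Rabs t * 1 + (delta * 1 + delta * 1) * Rabs t * 1) by ring.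
  apply Rabs_plus_le; apply Rabs_mult_le; auto using Rabs_cos_le, Rabs_sin_le.
Qed.

(** The factor [sg] in [L] makes the rotation the same for both signs, as [sg * sg = 1]; the sign
    survives only in [L 0 = sg * eps ^ 2]. *)
Lemma reduced_dynamics sg f g A B eps : sg = 1 \/ sg = -1 -> h1_solution sg f g A B ->
  0 < eps <= / 10 ->
  (forall x, f 0 x = eps * (cos x + sin x)) -> (forall x, g 0 x = 0) ->
  forall t, Rabs (msq (A t) (B t) 1 - msq (A t) (B t) (-1) -
    sg * eps ^ 2 * sin (2 * eps ^ 2 * t)) <= 1200000 * eps ^ 5 * Rabs t.
Proof.
  intros Hsg Hsol Heps Hf Hg.
  assert (Hs : Rabs sg <= 1).
  { destruct Hsg as [-> | ->]; [rewrite Rabs_R1|rewrite Rabs_left]; lra. }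
  assert (Hs2 : sg * sg = 1) by (destruct Hsg as [-> | ->]; ring).
  pose proof (init_coefs sg f g A B eps Hsol Hf Hg) as Hinit.
  set (P := fun t k => fre (cub sg (f t) (g t)) (cub sg (g t) (f t)) k).
  set (Q := fun t k => fim (cub sg (f t) (g t)) (cub sg (g t) (f t)) k).
  assert (DA : forall t k, is_derive (fun t => A t k) t (IZR k ^ 2 * B t k + Q t k))
    by apply (sol_derive_re _ _ _ _ _ Hsol).
  assert (DB : forall t k, is_derive (fun t => B t k) t (- (IZR k ^ 2 * A t k + P t k)))
    by apply (sol_derive_im _ _ _ _ _ Hsol).
  set (J := fun t => msq (A t) (B t) 1 - msq (A t) (B t) (-1)).
  set (dJ := fun t => 2 * (A t 1%Z * Q t 1%Z - B t 1%Z * P t 1%Z) -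
    2 * (A t (-1)%Z * Q t (-1)%Z - B t (-1)%Z * P t (-1)%Z)).
  set (L := fun t => 2 * sg * (A t 1%Z * B t (-1)%Z - B t 1%Z * A t (-1)%Z)).
  set (dL := fun t => 2 * sg * (Q t 1%Z * B t (-1)%Z - A t 1%Z * P t (-1)%Z +
    P t 1%Z * A t (-1)%Z - B t 1%Z * Q t (-1)%Z)).
  assert (HJ : forall t, is_derive J t (dJ t)).
  { intros t.
    pose proof (is_derive_weighted_sqr _ _ 1 _ _ _ (DA t 1%Z) (DB t 1%Z)) as D1.
    pose proof (is_derive_weighted_sqr _ _ 1 _ _ _ (DA t (-1)%Z) (DB t (-1)%Z)) as D2.
    pose proof (is_derive_minus _ _ _ _ _ D1 D2) as D.
    eapply is_derive_ext;
      [|match type of D with is_derive _ _ ?l => replace (dJ t) with l; [exact D|] end].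
    - intros u. unfold minus, plus, opp, J, msq; simpl. ring.
    - unfold minus, plus, opp, dJ; simpl. ring. }
  assert (HL : forall t, is_derive L t (dL t)).
  { intros t.
    pose proof (is_derive_bilinear _ _ _ _ _ _ _ _ _ (DA t 1%Z) (DB t 1%Z)
      (DA t (-1)%Z) (DB t (-1)%Z)) as D.
    apply (is_derive_scal _ _ (2 * sg)) in D.
    match type of D with is_derive _ _ ?l => replace (dL t) with l; [exact D|] end.
    unfold dL. simpl. ring. }
  assert (He2 : 0 < eps ^ 2 <= / 100) by (split; [apply pow_lt; lra|nra]).
  assert (He4 : 0 < eps ^ 4) by (apply pow_lt; lra).
  assert (He5 : eps ^ 5 = eps * eps ^ 4) by ring.
  assert (He6 : eps ^ 4 * eps ^ 2 <= / 10 * eps ^ 5).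
  { rewrite He5. replace (eps ^ 4 * eps ^ 2) with (eps * (eps * eps ^ 4)) by ring.
    apply Rmult_le_compat_r; [|lra]. apply Rlt_le, Rmult_lt_0_compat; lra. }
  assert (Hpt : forall t,
    Rabs (dJ t - 2 * eps ^ 2 * L t) <= 300000 * eps ^ 5 /\
    Rabs (dL t + 2 * eps ^ 2 * J t) <= 300000 * eps ^ 5).
  { intros t.
    destruct (a_priori sg f g A B eps Hs Hsol Heps Hf Hg t) as (HA0 & HB0 & HM & _).
    assert (Happ := resonant_approximation sg f g A B eps Hs Hsol Heps Hf Hg t).
    cbv zeta in Happ.
    destruct (resonant_coefs sg (A t) (B t) HA0 HB0) as (R1 & R2 & R3 & R4).
    destruct (Happ 1%Z) as [P1 Q1]. destruct (Happ (-1)%Z) as [P2 Q2]. clear Happ.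
    rewrite R1 in P1. rewrite R2 in Q1. rewrite R3 in P2. rewrite R4 in Q2.
    fold (P t 1%Z) in P1. fold (Q t 1%Z) in Q1.
    fold (P t (-1)%Z) in P2. fold (Q t (-1)%Z) in Q2.
    unfold dJ, dL, J, L. unfold msq in *.
    revert HM P1 Q1 P2 Q2. generalize (A t 1%Z) (B t 1%Z) (A t (-1)%Z) (B t (-1)%Z)
      (P t 1%Z) (Q t 1%Z) (P t (-1)%Z) (Q t (-1)%Z).
    intros p1 q1 p2 q2 U1 V1 U2 V2 HM. set (M := p1 ^ 2 + q1 ^ 2 + (p2 ^ 2 + q2 ^ 2)) in *.
    set (X := p1 * p2 + q1 * q2). intros HU1 HV1 HU2 HV2.
    set (u1 := U1 - sg * (M * p2 + 2 * X * p1)) in *.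
    set (v1 := V1 - sg * (M * q2 + 2 * X * q1)) in *.
    set (u2 := U2 - sg * (M * p1 + 2 * X * p2)) in *.
    set (v2 := V2 - sg * (M * q1 + 2 * X * q2)) in *.
    assert (Hsm : p1 ^ 2 + q1 ^ 2 + (p2 ^ 2 + q2 ^ 2) <= 2 * eps ^ 2).
    { fold M. apply Rabs_le_between in HM.
      replace (eps ^ 4) with (eps ^ 2 * eps ^ 2) in HM by ring. nra. }
    pose proof (pow2_ge_0 p1). pose proof (pow2_ge_0 q1).
    pose proof (pow2_ge_0 p2). pose proof (pow2_ge_0 q2).
    assert (Hp1 : Rabs p1 <= 3 / 2 * eps) by (apply sqr_le_abs; nra).
    assert (Hq1 : Rabs q1 <= 3 / 2 * eps) by (apply sqr_le_abs; nra).
    assert (Hp2 : Rabs p2 <= 3 / 2 * eps) by (apply sqr_le_abs; nra).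
    assert (Hq2 : Rabs q2 <= 3 / 2 * eps) by (apply sqr_le_abs; nra).
    assert (HLL : Rabs (p1 * q2 - q1 * p2) <= 2 * eps ^ 2).
    { apply Rabs_le. pose proof (pow2_ge_0 (p1 - q2)). pose proof (pow2_ge_0 (p1 + q2)).
      pose proof (pow2_ge_0 (q1 - p2)). pose proof (pow2_ge_0 (q1 + p2)). split; nra. }
    assert (HJJ : Rabs (p1 ^ 2 + q1 ^ 2 - (p2 ^ 2 + q2 ^ 2)) <= 2 * eps ^ 2)
      by (apply Rabs_le; lra).
    set (c := 23520 * eps ^ 4) in *.
    assert (R2abs : Rabs 2 <= 2) by (rewrite Rabs_pos_eq; lra).
    assert (R4abs : Rabs 4 <= 4) by (rewrite Rabs_pos_eq; lra).
    split.
    - replace (2 * (p1 * V1 - q1 * U1) - 2 * (p2 * V2 - q2 * U2) -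
        2 * eps ^ 2 * (2 * sg * (p1 * q2 - q1 * p2))) with
        (* The resonant part rotates with frequency 2 M. The errors left are the nonresonant
           remainders, O(eps^4) times an amplitude, and the detuning M - eps^2, which contributes
           only O(eps^6). *)
        (2 * (p1 * v1 - q1 * u1) - 2 * (p2 * v2 - q2 * u2) +
         4 * sg * ((M - eps ^ 2) * (p1 * q2 - q1 * p2)))
        by (unfold u1, u2, v1, v2, X; ring).
      apply Rle_trans with (2 * (3 / 2 * eps * c + 3 / 2 * eps * c) +
        2 * (3 / 2 * eps * c + 3 / 2 * eps * c) + 4 * 1 * (80 * eps ^ 4 * (2 * eps ^ 2))).
      + repeat first [assumption | apply Rabs_minus_le | apply Rabs_plus_le | apply Rabs_mult_le].
      + unfold c. rewrite He5 in *. nra.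
    - replace (2 * sg * (V1 * q2 - p1 * U2 + U1 * p2 - q1 * V2) +
        2 * eps ^ 2 * (p1 ^ 2 + q1 ^ 2 - (p2 ^ 2 + q2 ^ 2))) with
        (2 * sg * (v1 * q2 - p1 * u2 + u1 * p2 - q1 * v2) -
         2 * ((M - eps ^ 2) * (p1 ^ 2 + q1 ^ 2 - (p2 ^ 2 + q2 ^ 2))) +
         2 * (1 - sg * sg) * (M * (p1 ^ 2 + q1 ^ 2 - (p2 ^ 2 + q2 ^ 2))))
        by (unfold u1, u2, v1, v2, X, M; ring).
      rewrite Hs2, Rminus_diag, Rmult_0_r, Rmult_0_l, Rplus_0_r.
      apply Rle_trans with (2 * 1 * (c * (3 / 2 * eps) + 3 / 2 * eps * c +
        c * (3 / 2 * eps) + 3 / 2 * eps * c) + 2 * (80 * eps ^ 4 * (2 * eps ^ 2))).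
      + repeat first [assumption | apply Rabs_minus_le | apply Rabs_plus_le | apply Rabs_mult_le].
      + unfold c. rewrite He5 in *. nra. }
  intros t.
  assert (HL0 : L 0 = sg * eps ^ 2).
  { unfold L. rewrite !(proj1 (Hinit _)), !(proj2 (Hinit _)).
    unfold init_re, init_im. simpl. field. }
  assert (HJ0 : J 0 = 0).
  { unfold J, msq. rewrite !(proj1 (Hinit _)), !(proj2 (Hinit _)).
    unfold init_re, init_im. simpl. field. }
  rewrite <- HL0. fold (J t).
  replace (1200000 * eps ^ 5) with (4 * (300000 * eps ^ 5)) by ring.
  apply (perturbed_rotation J L dJ dL (2 * eps ^ 2)); auto; intros u; apply Hpt.
Qed.

Theorem theorem1p1 :
  forall sigma : R, sigma = 1 \/ sigma = -1 ->
  exists eps0 C0 : R, 0 < eps0 /\ 0 < C0 /\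
  forall eps : R, 0 < eps <= eps0 ->
  forall (s : R) (psi : R -> R -> C), 1 <= s ->
  global_solution s sigma psi ->
  (forall x : R, psi 0 x = RtoC (eps * (cos x + sin x))) ->
  forall t : R, Rabs t <= Rpower eps (- (9 / 4)) ->
  Rabs (Cmod (fourier (psi t) 1) ^ 2 + Cmod (fourier (psi t) (-1)) ^ 2
        - eps ^ 2) <= C0 * eps ^ 3 /\
  Rabs (Cmod (fourier (psi t) 1) ^ 2 - Cmod (fourier (psi t) (-1)) ^ 2
        - sigma * eps ^ 2 * sin (2 * eps ^ 2 * t)) <= C0 * Rpower eps (9 / 4).
Proof.
  intros sigma Hsigma. exists (/ 10), 1200000. split; [lra|]. split; [lra|].
  intros eps Heps s psi Hs Hglob Hinit t Ht.
  pose proof (solution_h1 s sigma psi Hs Hglob) as Hsol.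
  assert (Hf : forall x, fst (psi 0 x) = eps * (cos x + sin x)) by
    (intros x; now rewrite Hinit).
  assert (Hg : forall x, snd (psi 0 x) = 0) by (intros x; now rewrite Hinit).
  rewrite !Cmod_sqr. split.
  - assert (Habs : Rabs sigma <= 1).
    { destruct Hsigma as [-> | ->]; [rewrite Rabs_R1|rewrite Rabs_left]; lra. }
    destruct (a_priori _ _ _ _ _ eps Habs Hsol Heps Hf Hg t) as (_ & _ & HM & _).
    eapply Rle_trans; [exact HM|].
    replace (80 * eps ^ 4) with (80 * eps * eps ^ 3) by ring.
    apply Rmult_le_compat_r; [apply pow_le|]; lra.
  - eapply Rle_trans; [apply (reduced_dynamics _ _ _ _ _ eps Hsigma Hsol Heps Hf Hg t)|].
    rewrite Rmult_assoc. apply Rmult_le_compat_l; [lra|].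
    apply Rle_trans with (eps ^ 5 * Rpower eps (- (9 / 4))).
    + apply Rmult_le_compat_l; [apply pow_le; lra|assumption].
    + rewrite <- (Rpower_pow 5 eps) by lra. rewrite <- Rpower_plus.
      (* The accumulated error is eps^(11/4); the spare factor eps^(1/2) is at most one. *)
      replace (INR 5 + - (9 / 4)) with (9 / 4 + / 2) by (simpl; lra).
      rewrite Rpower_plus. rewrite <- (Rmult_1_r (Rpower eps (9 / 4))) at 2.
      apply Rmult_le_compat_l; [apply Rlt_le, exp_pos|].
      unfold Rpower. rewrite <- exp_0.
      assert (Hln : ln eps <= 0) by (rewrite <- ln_1; apply ln_le; lra).
      assert (Hle : / 2 * ln eps <= 0) by lra.
      destruct Hle as [Hle|Hle]; [apply Rlt_le, exp_increasing, Hle|rewrite Hle; lra].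
Qed.
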